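(* Let $\alpha\in(0,1)$, $\theta=\alpha/2$, $\varepsilon>0$, $T>0$, $\gamma\ge1$, $h=L/M$, and let $t_k=T(k/N)^\gamma$, $0\le k\le N$, be the graded mesh, with steps $\tau_k=t_k-t_{k-1}$, $\tau=\max_k\tau_k$, ratios $r_k=\tau_k/\tau_{k-1}$, and $r^*$ the maximum step ratio. Let $\phi$ be the solution of the periodic time-fractional Allen--Cahn problem $\partial_t^\alpha\phi=\varepsilon^2\Delta\phi+f(\phi)$ on $\Omega=(0,L)^2$, $0<t\le T$, $\phi(\cdot,0)=\phi_{\rm init}$ with $\max_{\bar\Omega}|\phi_{\rm init}|\le1$, and suppose that for some constant $C_\phi$ and all $t\in(0,T]$ $$\|\phi(t)\|_{W^{4,\infty}}\le C_\phi,\qquad\|\partial_t^\ell\phi(t)\|_{W^{2,\infty}}\le C_\phi(1+t^{\alpha-\ell}),\quad\ell=1,2,3.$$ Let $\kappa\ge\|f'\|_{C[-1,1]}$, and assume $$\tau\le\left(\frac{4}{11(1-\theta)(4\varepsilon^2/h^2+\kappa)\Gamma(2-\alpha)}\right)^{1/\alpha}\quad\text{and}\quad\tau\le\left(\frac{2}{33\,\kappa\,\Gamma(2-\alpha)\,(1+2(1-\theta)r^* )}\right)^{1/\alpha}.$$ Let $\{\phi^n\}_{n=0}^N$ be the solution of the stabilized IMEX-Alikhanov scheme (see context) with $\phi^0=\phi_{\rm init}$ on the grid, and let $e^n=\phi(t_n)-\phi^n$ on the grid. Then there is an $\alpha$-robust constant $C_3>0$, depending on the data (including $\alpha$ and $\kappa$)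 but independent of $N$, $h$ and $n$, such that $$\|e^n\|_\infty\le C_3\left(N^{-\min\{\gamma\alpha,2\}}+h^2\right),\qquad 0\le n\le N .$$
   Context: Caputo derivative: $\partial_t^\alpha v(t)=\int_0^t\omega_{1-\alpha}(t-s)\,\partial_sv(s)\,ds$, $\omega_\mu(t)=t^{\mu-1}/\Gamma(\mu)$. A constant is called $\alpha$-robust if it may depend on $\alpha$ but remains bounded as $\alpha\to1^-$. Nonlinearity: $f=-F'$, where $F$ is a bistable potential (typical example $F(\phi)=\frac14(1-\phi^2)^2$, $f(\phi)=\phi-\phi^3$); $f$ is $C^1$, nonconstant on $[-1,1]$ (so $\kappa>0$), with $f(1)\le0\le f(-1)$. Known fact: since $\max|\phi_{\rm init}|\le1$, the exact solution satisfies $|\phi(\mathbf x,t)|\le1$ for all $\mathbf x\in\bar\Omega$, $t>0$. Space grid: periodic boundary conditions on $\Omega=(0,L)^2$, $M$ a positive integer, $h=L/M$, grid points $(ih,jh)$. $\mathbb V_h$ is the space of real grid functions $v=(v_{ij})$ that are $M$-periodic in $i$ and in $j$; $\|v\|_\infty=\max_{1\le i,j\le M}|v_{ij}|$; $\Delta_hv_{ij}=h^{-2}(v_{i+1,j}+v_{i-1,j}+v_{i,j+1}+v_{i,j-1}-4v_{ij})$. The function $f$ and min/max act pointwise on grid functions. Alikhanov formula: $t_{n-\theta}=(1-\theta)t_n+\theta t_{n-1}$, $t_{k-1/2}=(t_k+t_{k-1})/2$, $\nabla_\tau w^k=w^k-w^{k-1}$, and $$\mathbb D_\tau^\alpha w^n=\sum_{k=1}^nA^{(n)}_{n-k}\nabla_\tau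 w^k ,$$ where $$a^{(n)}_{n-k}=\frac1{\tau_k}\int_{t_{k-1}}^{\min\{t_k,t_{n-\theta}\}}\omega_{1-\alpha}(t_{n-\theta}-s)\,ds\quad(1\le k\le n),$$ $$b^{(n)}_{n-k}=\frac{2}{\tau_k(\tau_k+\tau_{k+1})}\int_{t_{k-1}}^{t_k}(s-t_{k-1/2})\,\omega_{1-\alpha}(t_{n-\theta}-s)\,ds\quad(1\le k\le n-1),$$ $A^{(1)}_0=a^{(1)}_0$, and for $n\ge2$: $A^{(n)}_0=a^{(n)}_0+b^{(n)}_1/r_n$; $A^{(n)}_{n-k}=a^{(n)}_{n-k}+b^{(n)}_{n-k+1}/r_k-b^{(n)}_{n-k}$ for $2\le k\le n-1$; $A^{(n)}_{n-1}=a^{(n)}_{n-1}-b^{(n)}_{n-1}$. Stabilized IMEX-Alikhanov scheme: $\phi^0=\phi_{\rm init}$ on the grid; $\bar\phi^{n,\theta}=(1-\theta)\phi^n+\theta\phi^{n-1}$; $\widehat\phi^{1,\theta}=\phi^0$, and for $n\ge2$ $$\widehat\phi^{n,\theta}=\min\{\max\{(1+(1-\theta)r_n)\phi^{n-1}-(1-\theta)r_n\phi^{n-2},-1\},1\};$$ for $1\le n\le N$, $\phi^n\in\mathbb V_h$ is the (unique) solution of $$\mathbb D_\tau^\alpha\phi^n=\varepsilon^2\Delta_h\bar\phi^{n,\theta}+f(\widehat\phi^{n,\theta})-\kappa(\bar\phi^{n,\theta}-\widehat\phi^{n,\theta}).$$ *)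

(* Defs.v *)
From HB Require Import structures.
From mathcomp Require Import all_boot all_order all_algebra.
From mathcomp Require Import all_classical all_reals all_analysis.

Set Implicit Arguments.
Unset Strict Implicit.
Unset Printing Implicit Defensive.

Import Order.TTheory GRing.Theory Num.Theory.
Import numFieldNormedType.Exports.

Local Open Scope classical_set_scope.
Local Open Scope ring_scope.

Section Defs.
Context {R : realType}.

Notation mu := (@lebesgue_measure R).
Notation mu2 := (mu \x mu)%E.

Definition Gamma (x : R) : R :=
  \int[mu]_(s in `]0, +oo[) (s `^ (x - 1) * expR (- s)).

Definition omega (m s : R) : R := s `^ (m - 1) / Gamma m.

Definition caputo (alpha : R) (v : R -> R) (t : R) : R :=
  \int[mu]_(s in `]0, t[) (omega (1 - alpha) (t - s) * derive1 v s).

(* A constant depending on alpha, seen as a function of alpha. *)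
Definition alpha_robust (C : R -> R) : Prop :=
  exists B : R, \forall a \near 1^'-, `|C a| <= B.

(* Derivative at t of a function that only matters on ]0, T]: two-sided for
   t < T and left-sided at t = T. *)
Definition dt_quot (T : R) (u : R -> R) (t : R) : set_system R :=
  (fun s => (u s - u t) / (s - t)) @ within `]0, T] t^'.

Definition dt (T : R) (u : R -> R) (t : R) : R := lim (dt_quot T u t).

(* Functions on the torus are L-periodic functions on the plane. *)
Definition periodic (L : R) (u : R * R -> R) : Prop :=
  forall x y, u (x + L, y) = u (x, y) /\ u (x, y + L) = u (x, y).

Definition cell (L : R) : set (R * R) := `[0, L] `*` `[0, L].

Definition dx (u : R * R -> R) : R * R -> R := 'D_(1, 0) u.
Definition dy (u : R * R -> R) : R * R -> R := 'D_(0, 1) u.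

Definition pderiv (a b : nat) (u : R * R -> R) : R * R -> R :=
  iter a dx (iter b dy u).

Definition laplacian (u : R * R -> R) (p : R * R) : R :=
  pderiv 2 0 u p + pderiv 0 2 u p.

(* By Schwarz's theorem this is the usual C^k: derivatives taken in another
   order exist and agree with these. *)
Definition Ck (k : nat) (u : R * R -> R) : Prop :=
  forall a b, (a + b <= k)%N ->
    continuous (pderiv a b u) /\
    ((a + b < k)%N -> forall p, derivable (pderiv a b u) p (1, 0) /\
                                derivable (pderiv a b u) p (0, 1)).

Definition weak_deriv (L : R) (a b : nat) (u v : R * R -> R) : Prop :=
  forall psi : R * R -> R, periodic L psi -> (forall k, Ck k psi) ->
    \int[mu2]_(p in cell L) (u p * pderiv a b psi p) =
    (-1) ^+ (a + b) * \int[mu2]_(p in cell L) (v p * psi p).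

(* u belongs to W^{k,oo} of the torus and its norm, the maximum of the
   essential suprema of the weak derivatives of order at most k, is at most C.
   Only k >= 1 is used; elements of W^{k,oo} are then identified, as usual,
   with their continuous representatives, so that they have point values. *)
Definition Winfty_norm_le (L : R) (k : nat) (u : R * R -> R) (C : R) : Prop :=
  continuous u /\
  exists D : nat -> nat -> R * R -> R, D 0%N 0%N = u /\
    forall a b, (a + b <= k)%N ->
      [/\ measurable_fun (cell L) (D a b),
          {ae mu2, forall p, cell L p -> `|D a b p| <= C} &
          weak_deriv L a b u (D a b)].

Record bistable (F f : R -> R) : Prop := Bistable {
  bistable_potential : forall x : R, is_derive x 1 F (- f x);
  bistable_derivable : forall x : R, derivable f x 1;
  bistable_C1 : continuous (derive1 f);
  bistable_nonconstant :
    exists x y, [/\ x \in `[-1, 1], y \in `[-1, 1] & f x != f y];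
  bistable_right : f 1 <= 0;
  bistable_left : 0 <= f (-1) }.

(* phi t p is the value at time t and point p; only 0 <= t <= T matters. *)
Record allen_cahn_solution (L T alpha eps : R) (f : R -> R)
    (phi_init : R * R -> R) (phi : R -> R * R -> R) : Prop := AllenCahn {
  ac_periodic : forall t, 0 <= t <= T -> periodic L (phi t);
  ac_continuous :
    {within [set z : R * (R * R) | 0 <= z.1 <= T],
      continuous (fun z : R * (R * R) => phi z.1 z.2)};
  ac_init : forall p, phi 0 p = phi_init p;
  ac_C2 : forall t, 0 < t <= T -> Ck 2 (phi t);
  ac_time_derivable :
    forall t p, 0 < t < T -> derivable (phi ^~ p) t 1;
  ac_caputo_integrable : forall t p, 0 < t <= T ->
    mu.-integrable `]0, t[
      (fun s => (omega (1 - alpha) (t - s) * derive1 (phi ^~ p) s)%:E);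
  ac_equation : forall t p, 0 < t <= T ->
    caputo alpha (phi ^~ p) t = eps ^+ 2 * laplacian (phi t) p + f (phi t p) }.

Record regularity (L T alpha Cphi : R) (phi : R -> R * R -> R) : Prop :=
  Regularity {
  reg_space : forall t, 0 < t <= T -> Winfty_norm_le L 4 (phi t) Cphi;
  reg_time_derivable : forall t p l, 0 < t <= T -> (l < 3)%N ->
    cvg (dt_quot T (iter l (dt T) (phi ^~ p)) t);
  reg_time : forall t l, 0 < t <= T -> (1 <= l <= 3)%N ->
    Winfty_norm_le L 2 (fun p => iter l (dt T) (phi ^~ p) t)
      (Cphi * (1 + t `^ (alpha - l%:R))) }.

Definition gridfun := int -> int -> R.

Definition Vh (M : nat) (v : gridfun) : Prop :=
  forall i j, v (i + M%:Z) j = v i j /\ v i (j + M%:Z) = v i j.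

Definition grid_norm (M : nat) (v : gridfun) : R :=
  \big[Num.max/0]_(1 <= i < M.+1) \big[Num.max/0]_(1 <= j < M.+1)
    `|v i%:Z j%:Z|.

Definition lap_h (h : R) (v : gridfun) : gridfun := fun i j =>
  h ^- 2 * (v (i + 1) j + v (i - 1) j + v i (j + 1) + v i (j - 1)
            - 4 * v i j).

Definition on_grid (h : R) (u : R * R -> R) : gridfun :=
  fun i j => u (i%:~R * h, j%:~R * h).

Definition graded_mesh (T gamma : R) (N k : nat) : R :=
  T * (k%:R / N%:R) `^ gamma.

Section Mesh.
Variable t : nat -> R.

Definition step (k : nat) : R := t k - t k.-1.

Definition ratio (k : nat) : R := step k / step k.-1.

Definition max_step (N : nat) : R :=
  \big[Num.max/0]_(1 <= k < N.+1) step k.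

(* For N = 1 there is no ratio and the value is 0. *)
Definition max_ratio (N : nat) : R :=
  \big[Num.max/0]_(2 <= k < N.+1) ratio k.

Variables alpha theta : R.

Definition t_theta (n : nat) : R := (1 - theta) * t n + theta * t n.-1.

Definition t_half (k : nat) : R := (t k + t k.-1) / 2.

(* a_coef n k, b_coef n k, A_coef n k stand for the coefficients with upper
   index (n) and lower index n - k; in particular lower index n - k + 1
   corresponds to k.-1. *)
Definition a_coef (n k : nat) : R :=
  (step k)^-1 *
  \int[mu]_(s in `[t k.-1, Num.min (t k) (t_theta n)])
    omega (1 - alpha) (t_theta n - s).

Definition b_coef (n k : nat) : R :=
  2 / (step k * (step k + step k.+1)) *
  \int[mu]_(s in `[t k.-1, t k])
    ((s - t_half k) * omega (1 - alpha) (t_theta n - s)).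

Definition A_coef (n k : nat) : R :=
  if n == 1%N then a_coef n k
  else if k == n then a_coef n n + b_coef n n.-1 / ratio n
  else if k == 1%N then a_coef n 1 - b_coef n 1
  else a_coef n k + b_coef n k.-1 / ratio k - b_coef n k.

Definition D_tau (w : nat -> R) (n : nat) : R :=
  \sum_(1 <= k < n.+1) A_coef n k * (w k - w k.-1).

Definition phi_bar (p : nat -> gridfun) (n : nat) : gridfun := fun i j =>
  (1 - theta) * p n i j + theta * p n.-1 i j.

Definition phi_hat (p : nat -> gridfun) (n : nat) : gridfun := fun i j =>
  if n == 1%N then p 0%N i j
  else Num.min
    (Num.max ((1 + (1 - theta) * ratio n) * p n.-1 i j
              - (1 - theta) * ratio n * p n.-2 i j) (-1)) 1.

Definition imex_alikhanov (M N : nat) (h eps kappa : R) (f : R -> R)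
    (phi0 : gridfun) (p : nat -> gridfun) : Prop :=
  [/\ forall n, (n <= N)%N -> Vh M (p n),
      forall i j, p 0%N i j = phi0 i j &
      forall n i j, (1 <= n <= N)%N ->
        D_tau (fun k => p k i j) n =
          eps ^+ 2 * lap_h h (phi_bar p n) i j + f (phi_hat p n i j)
          - kappa * (phi_bar p n i j - phi_hat p n i j)].

End Mesh.
End Defs.

(* Main.v *)
(** The first step restriction forces tau^alpha <= C h^2, so it is enough to
    bound the error by C (tau^alpha + h^2).  The weights of the Alikhanov formula
    are positive and increase towards the current level, with a jump at the last
    level which, under that restriction, absorbs the explicit half of the
    diffusion and of the stabilization; looking at a grid maximum, one obtains a
    comparison principle for the scheme.  Functions B <= C X with
    D_tau B^n >= K B^(n-1) + X + X (omega_(1-alpha)(t_n) + t_n^(-alpha) / n)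
    are combinations of t^alpha, of 2 - 1/n and of an exponential, with C uniform
    for alpha in [a0, 1).  The truncation error of D_tau is at most
    C tau_n^alpha (omega_(1-alpha)(t_n) + t_n^(-alpha) / n): the cells before the
    last one are estimated locally, and the last one by superconvergence.  In
    space, testing with averages of the kernels (1 + cos)^n turns bounds on weak
    derivatives into bounds on differences of the same order, and repeated halving
    of the step compares the discrete and the classical Laplacian.  Comparison is
    applied to phi - 1 and - phi - 1, whence phi leaves [-1, 1] by at most
    O(h^2) and the truncation of the extrapolation is harmless, and then to the
    error and its opposite. *)
Require Import Defs.
From HB Require Import structures.
From mathcomp Require Import all_boot all_order all_algebra.
From mathcomp Require Import all_classical all_reals all_analysis.
From mathcomp Require Import measurable_realfun ring lra zify.

Set Implicit Arguments.
Unset Strict Implicit.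
Unset Printing Implicit Defensive.

Import Order.TTheory GRing.Theory Num.Theory.
Import numFieldNormedType.Exports.

Local Open Scope classical_set_scope.
Local Open Scope ring_scope.

(** * Calculus and the Gamma function *)

(** The obstacle is uniformity as al tends to 1. Then Gamma (1 - al) blows up and omega_(1-al)(t_n)
    degenerates like 1 - al, so this term alone cannot carry the truncation error. Constants are
    therefore allowed to involve only Gamma (2 - al), which is bounded above and below, and the
    weight receives the second term t_n^(-al) / n, which survives the limit. The barrier 2 - 1/n
    fits this weight: its first jump meets the oldest coefficient, its last jump the newest one, and
    1/n <= (1 - al) + n^(al - 2). Barriers are constant in space, so the discrete Laplacian does not
    see them and the comparison reduces to inequalities in time. In space only essential bounds on
    weak derivatives are available, so there is no pointwise fourth derivative to expand with;
    differences of order four take its place. All constants are fixed for a whole range al >= a0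
    before the mesh, the grid and the solution are given. *)

Section Calculus.
Context {R : realType}.
Notation mu := (@lebesgue_measure R).

Lemma is_derive_continuous (f : R -> R) (x df : R) :
  is_derive x 1 f df -> {for x, continuous f}.
Proof. by move=> [/derivable1_diffP/differentiable_continuous]. Qed.

Lemma continuous_itv_integrable (f : R -> R) (a b : R) :
  {within `[a, b], continuous f} -> mu.-integrable `[a, b] (EFin \o f).
Proof. exact/continuous_compact_integrable/segment_compact. Qed.

Lemma is_derive_FTC (f F : R -> R) (a b : R) : a <= b ->
  (forall x, x \in `[a, b] -> is_derive x 1 F (f x)) ->
  {within `[a, b], continuous f} ->
  (\int[mu]_(x in `[a, b]) (f x)%:E = (F b - F a)%:E)%E.
Proof.
rewrite le_eqVlt => /predU1P[<- _ _|ab dF cf].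
  by rewrite set_itv1 integral_set1 subrr.
rewrite EFinB; apply: continuous_FTC2 => //.
- split.
  + by move=> x /subset_itv_oo_cc /dF [].
  + by apply: cvg_at_right_filter; apply: is_derive_continuous (dF _ _); rewrite bound_itvE ltW.
  + by apply: cvg_at_left_filter; apply: is_derive_continuous (dF _ _); rewrite bound_itvE ltW.
- by move=> x /subset_itv_oo_cc /dF [_ <-]; rewrite derive1E.
Qed.

Lemma is_derive_within_continuous (f df : R -> R) (a b : R) :
  (forall x, x \in `[a, b] -> is_derive x 1 f (df x)) ->
  {within `[a, b], continuous f}.
Proof. by move=> d; apply: derivable_within_continuous => x /d[]. Qed.

Lemma natSinv_cvg0 (c : R) : c / n.+1%:R @[n --> \oo] --> (0 : R).
Proof.
rewrite -[X in _ --> X](mulr0 c); apply: cvgMr.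
have := @cvg_harmonic R; exact.
Qed.

(** Meant for integrands that are unbounded at an end of the interval, as the kernel is. The formula
    holds on the closed intervals [[u n, v n]] inside, and monotone convergence, for which [f] must
    be nonnegative, passes to the limit. *)
Lemma improper_FTC (f F : R -> R) (a b : R) : a < b ->
  (forall x, x \in `]a, b[ -> is_derive x 1 F (f x)) ->
  {in `]a, b[, continuous f} -> {in `]a, b[, forall x, 0 <= f x} ->
  F @ a^'+ --> F a -> F @ b^'- --> F b ->
  (\int[mu]_(x in `]a, b[) (f x)%:E = (F b - F a)%:E)%E.
Proof.
move=> ab dF cf f0 Fa Fb.
(* The quarter keeps [u n <= v n] from the first index on. *)
pose d n : R := (b - a) / 4 / n.+1%:R.
have dgt0 n : 0 < d n by rewrite /d divr_gt0// divr_gt0// subr_gt0.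
have dle n : d n <= (b - a) / 4.
  by rewrite /d ler_pdivrMr// ler_peMr// ?ler1n// divr_ge0// subr_ge0 ltW.
have dcvg : d n @[n --> \oo] --> 0 by exact: natSinv_cvg0.
pose u n : R := a + d n; pose v n : R := b - d n.
pose S n : set R := `[u n, v n]%classic.
have SU : `]a, b[%classic = \bigcup_n S n.
  apply/seteqP; split => [x /=|x [n _]]; rewrite /S /= !in_itv/=; last first.
    by rewrite /u /v; have := dgt0 n; lra.
  move=> /andP[ax xb].
  have e0 : 0 < Num.min (x - a) (b - x) by rewrite lt_min !subr_gt0 ax xb.
  move/cvgrPdist_lt : dcvg => /(_ _ e0)[n _ /(_ n (leqnn n))]/=.
  rewrite sub0r normrN gtr0_norm// lt_min => /andP[xa bx].
  by exists n => //=; rewrite in_itv/= /u /v; lra.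
have Ssub n (x : R) : x \in `[u n, v n] -> x \in `]a, b[.
  by rewrite !in_itv/= /u /v; have := dgt0 n; lra.
have cS n : {within S n, continuous f}.
  by apply: continuous_in_subspaceT => x /[!inE] /Ssub /cf.
have IS n : (\int[mu]_(x in S n) (f x)%:E = (F (v n) - F (u n))%:E)%E.
  rewrite /S; eapply is_derive_FTC.
  - by rewrite /u /v; have := dle n; lra.
  - by move=> x /Ssub; exact: dF.
  - exact: cS.
have I1 : (\int[mu]_(x in S n) (f x)%:E @[n --> \oo] --> \int[mu]_(x in `]a, b[) (f x)%:E)%E.
  rewrite SU; apply: ge0_nondecreasing_set_cvg_integral.
  - apply/nondecreasing_seqP => n; rewrite subsetEset => x; rewrite /S/= !in_itv/= /u /v.
    have : d n.+1 <= d n.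
      rewrite /d ler_pM2l ?divr_gt0 ?subr_gt0// lef_pV2 ?posrE//.
      by rewrite ler_nat.
    lra.
  - by move=> n; exact: measurable_itv.
  - by move=> n; have /integrableP[] := continuous_itv_integrable (cS n).
  - by move=> n x /Ssub /f0; rewrite lee_fin.
have I2 : (\int[mu]_(x in S n) (f x)%:E @[n --> \oo] --> (F b - F a)%:E)%E.
  under eq_fun do rewrite IS.
  apply: cvg_EFin; first by near=> n.
  apply: cvgB; [apply: (cvg_comp _ _ _ Fb)|apply: (cvg_comp _ _ _ Fa)].
  - move=> A [e /= e0 eA].
    move/cvgrPdist_lt : dcvg => /(_ _ e0)[n _ nA]; exists n => // m /nA /=.
    rewrite sub0r normrN gtr0_norm// => de; apply: eA => /=.
      by rewrite /v opprB addrC subrK gtr0_norm.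
    by rewrite /v ltrBlDr ltrDl.
  - move=> A [e /= e0 eA].
    move/cvgrPdist_lt : dcvg => /(_ _ e0)[n _ nA]; exists n => // m /nA /=.
    rewrite sub0r normrN gtr0_norm// => de; apply: eA => /=.
      by rewrite /u opprD addrA subrr sub0r normrN gtr0_norm.
    by rewrite /u ltrDl.
by rewrite -(cvg_lim _ I1)// -(cvg_lim _ I2).
Unshelve. all: by end_near. Qed.

Lemma EFin_Rintegral (D : set R) (f : R -> R) : measurable D ->
  mu.-integrable D (EFin \o f) ->
  (\int[mu]_(x in D) (f x)%:E = (\int[mu]_(x in D) f x)%:E)%E.
Proof. by move=> mD fi; rewrite fineK//; exact: integrable_fin_num. Qed.

Lemma Rintegral_FTC (f F : R -> R) (a b : R) : a <= b ->
  (forall x, x \in `[a, b] -> is_derive x 1 F (f x)) ->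
  {within `[a, b], continuous f} ->
  \int[mu]_(x in `[a, b]) f x = F b - F a.
Proof. by move=> ab dF cf; rewrite /Rintegral (@is_derive_FTC f F). Qed.

Lemma Rintegral_cst_itv (a b c : R) : a <= b ->
  \int[mu]_(x in `[a, b]) c = c * (b - a).
Proof.
move=> ab; rewrite mulrBr; apply: (@Rintegral_FTC (fun=> c) (fun x => c * x)) => //.
  by move=> x _; apply: is_derive_eq; rewrite /GRing.scale/= mulr1.
by apply: continuous_subspaceT => x; exact: cst_continuous.
Qed.

Lemma improper_FTC_integrable (f F : R -> R) (a b : R) : a < b ->
  (forall x, x \in `]a, b[ -> is_derive x 1 F (f x)) ->
  {in `]a, b[, continuous f} -> {in `]a, b[, forall x, 0 <= f x} ->
  F @ a^'+ --> F a -> F @ b^'- --> F b ->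
  mu.-integrable `]a, b[ (EFin \o f) /\
  \int[mu]_(x in `]a, b[) f x = F b - F a.
Proof.
move=> ab dF cf f0 Fa Fb; have H := improper_FTC ab dF cf f0 Fa Fb.
split; last by rewrite /Rintegral H.
apply/integrableP; split.
  apply/measurable_EFinP; apply: open_continuous_measurable_fun => //.
  by move=> x; rewrite inE => /cf.
have := ltry (F b - F a); rewrite -H; congr (_ < _)%E; apply: eq_integral => x.
by rewrite inE => /f0 ?; rewrite /= ger0_norm.
Qed.

Lemma is_derive_comp_subl (f : R -> R) (c x df : R) :
  is_derive (c - x) 1 f df -> is_derive x 1 (fun y => f (c - y)) (- df).
Proof.
move=> dfx.
have := @is_derive1_comp R f (fun y => c - y) x df (-1) dfx.
rewrite mulrN1; apply.
by rewrite -[-1]add0r; exact: is_deriveB.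
Qed.

End Calculus.

Section GammaFunction.
Context {R : realType}.
Notation mu := (@lebesgue_measure R).

(** The intervals [1/(n+2), n+2] exhaust the half-line and avoid both the singularity at 0 and
    infinity. The shift by 2 makes the first one, [1/2, 2], nondegenerate; the lower bound on Gamma
    is read off there. *)
Let u n : R := n.+2%:R^-1.
Let v n : R := n.+2%:R.

Let u_gt0 n : 0 < u n. Proof. by rewrite invr_gt0. Qed.

Let u_lt_v n : u n < v n.
Proof. by rewrite (@lt_trans _ _ 1)// ?invf_lt1// ltr1n. Qed.

Let pos_uv n (x : R) : x \in `[u n, v n] -> 0 < x.
Proof. by rewrite in_itv/= => /andP[+ _]; exact: lt_le_trans. Qed.

Let cvg_integral_uv (f : R -> R) :
  (forall x : R, 0 < x -> {for x, continuous f}) -> (forall x : R, 0 < x -> 0 <= f x) ->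
  (\int[mu]_(x in `[u n, v n]) f x)%:E @[n --> \oo] -->
  (\int[mu]_(x in `]0%R, +oo[) (f x)%:E)%E.
Proof.
move=> cf f0.
have cS n : {within `[u n, v n], continuous f}.
  by apply: continuous_in_subspaceT => x /[!inE] /pos_uv /cf.
have -> : `]0%R, +oo[%classic = \bigcup_n `[u n, v n]%classic.
  apply/seteqP; split => [x /=|x [n _ /= /pos_uv]]; rewrite !in_itv/= andbT// => x0.
  have := truncnS_gt x^-1; have := truncnS_gt x.
  set p := Num.truncn x; set q := Num.truncn x^-1 => xp xq.
  exists (p + q)%N => //=; rewrite in_itv/= /u /v; apply/andP; split.
    rewrite invf_ple ?posrE//; apply: le_trans (ltW xq) _.
    by rewrite ler_nat; lia.
  by apply: le_trans (ltW xp) _; rewrite ler_nat; lia.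
under eq_fun do rewrite -EFin_Rintegral ?continuous_itv_integrable//.
apply: ge0_nondecreasing_set_cvg_integral.
- apply/nondecreasing_seqP => n; rewrite subsetEset => x /=; rewrite !in_itv/= => /andP[ux xv].
  rewrite (le_trans _ ux) ?(le_trans xv)//= /u /v ?ler_nat//.
  by rewrite lef_pV2 ?posrE// ler_nat.
- by move=> n; exact: measurable_itv.
- by move=> n; have /integrableP[] := continuous_itv_integrable (cS n).
- by move=> n x /pos_uv /f0; rewrite lee_fin.
Qed.

Let cvg_u : u n @[n --> \oo] --> (0 : R).
Proof.
apply/cvgrPdist_lt => e e0.
have /cvgrPdist_lt/(_ e e0)[n _ H] := @natSinv_cvg0 R 1.
by exists n => // m /= nm; have := H m.+1 (leqW nm); rewrite /= div1r.
Qed.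

Let is_derive_expRN (x : R) : is_derive x 1 (fun s => expR (- s)) (- expR (- x)).
Proof.
have := @is_derive1_comp R expR -%R x (expR (- x)) (-1) _ _.
by rewrite mulrN1; apply.
Qed.

Let continuous_powR (a x : R) : 0 < x -> {for x, continuous (fun s : R => s `^ a)}.
Proof. by move=> x0; apply: is_derive_continuous (@is_derive1_powR R a x x0). Qed.

Let continuous_expRN (x : R) : {for x, continuous (fun s => expR (- s))}.
Proof. exact: is_derive_continuous (is_derive_expRN x). Qed.

Let f (a s : R) := s `^ a * expR (- s).

Let f_ge0 a s : 0 <= f a s.
Proof. by rewrite mulr_ge0// ?powR_ge0// expR_ge0. Qed.

Let continuous_f (a x : R) : 0 < x -> {for x, continuous (f a)}.
Proof. by move=> x0; apply: continuousM; [exact: continuous_powR|exact: continuous_expRN]. Qed.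

Let within_continuous (g : R -> R) n : (forall x : R, 0 < x -> {for x, continuous g}) ->
  {within `[u n, v n], continuous g}.
Proof. by move=> cg; apply: continuous_in_subspaceT => x /[!inE] /pos_uv /cg. Qed.

(** [Gamma] is the real part of an extended integral and would be 0 if that integral diverged; a
    finite limit of the truncated integrals excludes this and gives the value. *)
Lemma Gamma_lim (a : R) (l : R) :
  \int[mu]_(x in `[u n, v n]) f (a - 1) x @[n --> \oo] --> l -> Gamma a = l.
Proof.
move=> fl; have /= H := cvg_integral_uv (@continuous_f (a - 1)) (fun x _ => f_ge0 _ x).
have /= H2 : (\int[mu]_(x in `[u n, v n]) f (a - 1) x)%:E @[n --> \oo] --> l%:E.
  by apply: cvg_EFin; [near=> n|exact: fl].
rewrite /Gamma /Rintegral.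
have -> : (\int[mu]_(x in `]0%R, +oo[) (x `^ (a - 1) * expR (- x))%:E)%E = l%:E.
  by rewrite -(cvg_lim _ H)// -(cvg_lim _ H2).
by [].
Unshelve. all: by end_near. Qed.

Let J a n : R := \int[mu]_(x in `[u n, v n]) f a x.

(** For [a] in [0, 1] one has x^a <= 1 + x, and (1 + x) e^(-x) has the primitive -(2 + x) e^(-x);
    its integral over the half-line is 2, whatever [a]. *)
Let J_le2 (a : R) n : 0 <= a <= 1 -> J a n <= 2.
Proof.
move=> /andP[a0 a1].
have -> : 2 = (2 : R) - 0 by rewrite subr0.
have xa x : 0 < x -> x `^ a <= 1 + x.
  move=> x0; have [x1|x1] := leP x 1.
    rewrite (le_trans (_ : _ <= 1))//; last by rewrite lerDl ltW.
    by rewrite -(powRr0 x) ger_powR// x0.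
  rewrite (le_trans (_ : _ <= x))//; last by rewrite lerDr.
  by rewrite -{2}(powRr1 (ltW x0)) ler_powR// ltW.
pose g (x : R) := (1 + x) * expR (- x).
have cg x : 0 < x -> {for x, continuous g}.
  move=> x0; apply: continuousM; last exact: continuous_expRN.
  by apply: continuousD; [exact: cst_continuous|exact].
have gI : \int[mu]_(x in `[u n, v n]) g x =
   - (2 + v n) * expR (- v n) - (- (2 + u n) * expR (- u n)).
  apply: (@Rintegral_FTC R _ (fun x => - (2 + x) * expR (- x))); first exact: ltW.
    move=> x _.
    have dx : is_derive x 1 (fun x : R => - (2 + x)) (- (0 + 1)) by exact: is_deriveN.
    have := is_deriveM dx (is_derive_expRN x).
    by rewrite /GRing.scale/=; congr is_derive; rewrite /g; ring.
  exact: within_continuous.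
apply: (@le_trans _ _ (\int[mu]_(x in `[u n, v n]) g x)).
  apply: le_Rintegral => //.
  - exact/continuous_itv_integrable/within_continuous/continuous_f.
  - exact/continuous_itv_integrable/within_continuous.
  - by move=> x /= /pos_uv x0; rewrite /f /g ler_wpM2r ?expR_ge0 ?xa.
rewrite gI -mulNr opprK addrC mulNr lerB//; last first.
  by rewrite mulr_ge0 ?expR_ge0// addr_ge0// ltW// (lt_trans _ (u_lt_v n)).
rewrite expRN -ler_pdivlMr ?invr_gt0 ?expR_gt0// invrK.
have := expR_ge1Dx (u n); have := u_gt0 n; lra.
Qed.

(** On [1/2, 2], whose length exceeds 1, the integrand is at least e^(-2) / 2. *)
Let J_ge (a : R) n : 0 <= a <= 1 -> expR (- 2) / 2 <= J a n.
Proof.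
move=> /andP[a0 a1].
apply: (@le_trans _ _ (\int[mu]_(x in `[u 0, v 0]) (expR (- 2) / 2))).
  rewrite Rintegral_cst_itv ?(ltW (u_lt_v 0))// /u /v.
  rewrite -[X in X <= _]mulr1 ler_wpM2l//= ?divr_ge0 ?expR_ge0//; lra.
apply: (@le_trans _ _ (J a 0)).
  apply: le_Rintegral => //.
  - by apply: continuous_itv_integrable => x; exact: cst_continuous.
  - exact/continuous_itv_integrable/within_continuous/continuous_f.
  - move=> x /= xuv; have x0 := pos_uv xuv.
    move: xuv; rewrite in_itv/= /u /v => /andP[ux xv].
    rewrite mulrC /f ler_pM ?expR_ge0// ?ler_expR ?lerN2//.
    apply: (@le_trans _ _ (2^-1 `^ a)); last by apply: ge0_ler_powR; rewrite ?nnegrE// ltW.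
    by rewrite -{1}(powRr1 (_ : 0 <= 2^-1 :> R))// ger_powR//; lra.
rewrite -lee_fin /J -!EFin_Rintegral//; try exact/continuous_itv_integrable/within_continuous/continuous_f.
apply: ge0_subset_integral => //.
- by have /integrableP[] := continuous_itv_integrable (@within_continuous _ n (@continuous_f a)).
- by move=> x _; rewrite lee_fin.
- move=> x /=; rewrite !in_itv/= /u /v => /andP[ux xv]; apply/andP; split.
    by rewrite (le_trans _ ux)// lef_pV2 ?posrE// ler_nat.
  by rewrite (le_trans xv)// ler_nat.
Qed.

Let J_cvg (a : R) : 0 <= a <= 1 -> J a n @[n --> \oo] --> Gamma (a + 1).
Proof.
move=> a01; have /= H := cvg_integral_uv (@continuous_f a) (fun x _ => f_ge0 _ x).
have le2 : (\int[mu]_(x in `]0%R, +oo[) (f a x)%:E <= 2%:E)%E.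
  by apply: cvge_le H; near=> n; rewrite lee_fin J_le2.
have ge0 : (0%:E <= \int[mu]_(x in `]0%R, +oo[) (f a x)%:E)%E.
  by apply: integral_ge0 => x _; rewrite lee_fin.
have fin : (\int[mu]_(x in `]0%R, +oo[) (f a x)%:E)%E \is a fin_num.
  by rewrite ge0_fin_numE// (le_lt_trans le2) ?ltry.
rewrite -(fineK fin) in H.
have {}H : J a n @[n --> \oo] --> fine (\int[mu]_(x in `]0%R, +oo[) (f a x)%:E)%E.
  exact: (fine_cvg H).
move: (fine _) H => r H;
suff -> : Gamma (a + 1) = r by [].
by apply: Gamma_lim; rewrite addrK.
Unshelve. all: by end_near. Qed.

Lemma Gamma_bounds (a : R) : 0 <= a <= 1 -> expR (- 2) / 2 <= Gamma (a + 1) <= 2.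
Proof.
move=> a01; apply/andP; split.
  by apply: cvgr_to_ge (J_cvg a01) _; near=> n; exact: J_ge.
by apply: cvgr_to_le (J_cvg a01) _; near=> n; exact: J_le2.
Unshelve. all: by end_near. Qed.

(** Integration by parts on [[u n, v n]], where everything is smooth; both boundary terms vanish in
    the limit. *)
Lemma GammaD1 (a : R) : 0 < a < 1 -> Gamma (a + 1) = a * Gamma a.
Proof.
move=> /andP[a0 a1].
have H n : a * \int[mu]_(x in `[u n, v n]) f (a - 1) x =
    J a n + (f a (v n) - f a (u n)).
  rewrite -RintegralZl//; last exact/continuous_itv_integrable/within_continuous/continuous_f.
  have E : \int[mu]_(x in `[u n, v n]) (a * f (a - 1) x - f a x) = f a (v n) - f a (u n).
    apply: Rintegral_FTC; first exact: ltW.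
      move=> x /pos_uv x0.
      have := is_deriveM (is_derive1_powR a x0) (is_derive_expRN x).
      by rewrite /GRing.scale/= /f; congr is_derive; ring.
    apply: within_continuous => x x0; apply: continuousB; last exact: continuous_f.
    by apply: continuousM; [exact: cst_continuous|exact: continuous_f].
  rewrite -E.
  rewrite RintegralB//; last 2 first.
  - apply/continuous_itv_integrable/within_continuous => x x0.
    by apply: continuousM; [exact: cst_continuous|exact: continuous_f].
  - exact/continuous_itv_integrable/within_continuous/continuous_f.
  by rewrite /J addrCA subrr addr0.
have fu0 : f a (u n) @[n --> \oo] --> (0 : R).
  have ua : u n `^ a @[n --> \oo] --> (0 : R).
    apply: (@cvg_comp _ _ _ u (fun x => x `^ a) _ (0^'+)); last exact: powR_cvg0.
    move=> A [e /= e0 eA].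
    move/cvgrPdist_lt : cvg_u => /(_ _ e0)[n _ nA]; exists n => // m /nA /= um.
    by apply: eA.
  apply: (@squeeze_cvgr _ _ _ _ (fun=> 0) (fun n => u n `^ a)) => //; last exact: cvg_cst.
  near=> n; rewrite f_ge0/= /f -[X in _ <= X]mulr1 ler_wpM2l ?powR_ge0//.
  by rewrite expR_le1 oppr_le0 ltW.
have fv0 : f a (v n) @[n --> \oo] --> (0 : R).
  (* By e^x >= 1 + x^2 / 2 the boundary term at [v n] is at most 2 / v n, and [u n] is the inverse
     of [v n]. *)
  apply: (@squeeze_cvgr _ _ _ _ (fun=> 0) (fun n => 2 * u n)); last 2 first.
  - exact: cvg_cst.
  - by rewrite -[X in _ --> X](mulr0 2); apply: cvgMr.
  near=> n; rewrite f_ge0/= /f expRN ler_pdivrMr ?expR_gt0//.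
  have v1 : 1 <= v n by rewrite /v ler1n.
  apply: (@le_trans _ _ (v n)); first by rewrite ler1_powR// ltW.
  have := expR_ge1Dxn 1 (ltW (lt_trans (u_gt0 n) (u_lt_v n))).
  rewrite -ler_pdivrMl ?mulr_gt0//.
  apply: le_trans.
  have -> : (2 * u n)^-1 * v n = v n ^+ 2 / 2 by rewrite invfM /u invrK -/(v n) expr2; ring.
  by rewrite (_ : 2`! = 2)// lerDr.
have : (\int[mu]_(x in `[u n, v n]) f (a - 1) x) @[n --> \oo] --> a^-1 * Gamma (a + 1).
  under eq_fun do rewrite -(mulKf (lt0r_neq0 a0) (\int[mu]_(x in `[u _, v _]) f (a - 1) x)) H.
  apply: cvgMr; rewrite -[X in _ --> X]addr0; apply: cvgD.
    by apply: J_cvg; rewrite !ltW.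
  by rewrite -[X in _ --> X](subrr 0); apply: cvgB.
by move=> /Gamma_lim ->; rewrite mulVKf// gt_eqF.
Unshelve. all: by end_near. Qed.

End GammaFunction.

(** * The fractional kernel on a cell *)

Lemma Rintegral_FTC_eq (R : realType) (f F : R -> R) (a b v : R) : a <= b ->
  F b - F a = v ->
  (forall x, x \in `[a, b] -> is_derive x 1 F (f x)) ->
  {within `[a, b], continuous f} ->
  \int[@lebesgue_measure R]_(x in `[a, b]) f x = v.
Proof. by move=> ab <-; exact: Rintegral_FTC. Qed.

Lemma le_powRl (R : realType) (a x y : R) :
  0 <= a -> 0 <= x -> x <= y -> x `^ a <= y `^ a.
Proof.
by move=> a0 x0 xy; apply: ge0_ler_powR; rewrite ?nnegrE// (le_trans x0).
Qed.

Section Kernel.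
Context {R : realType}.
Notation mu := (@lebesgue_measure R).
Variable al : R.
Hypothesis al01 : 0 < al < 1.

Let al_gt0 : 0 < al. Proof. by case/andP: al01. Qed.
Let al_lt1 : al < 1. Proof. by case/andP: al01. Qed.

(** This is omega_(2-al), the primitive of the kernel that vanishes at 0. Unlike the kernel it
    carries Gamma (2 - al), which stays away from 0 and infinity as al tends to 1. *)
Definition omega_prim (x : R) : R := x `^ (1 - al) / Gamma (2 - al).

Lemma Gamma2B_bounds : expR (- 2) / 2 <= Gamma (2 - al) <= 2.
Proof.
have -> : 2 - al = (1 - al) + 1 by ring.
by apply: Gamma_bounds; move: al01; lra.
Qed.

Lemma Gamma2B_gt0 : 0 < Gamma (2 - al).
Proof.
case/andP: Gamma2B_bounds => + _; apply: lt_le_trans.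
by rewrite divr_gt0// expR_gt0.
Qed.

Lemma Gamma2BE : Gamma (2 - al) = (1 - al) * Gamma (1 - al).
Proof.
have -> : 2 - al = (1 - al) + 1 by ring.
by apply: GammaD1; move: al01; lra.
Qed.

Lemma Gamma1B_gt0 : 0 < Gamma (1 - al).
Proof. by rewrite -(pmulr_rgt0 _ (_ : 0 < 1 - al)) ?subr_gt0// -Gamma2BE Gamma2B_gt0. Qed.

Lemma omegaE (x : R) : omega (1 - al) x = x `^ (- al) / Gamma (1 - al).
Proof. by rewrite /omega; congr (_ `^ _ / _); ring. Qed.

Lemma omega_ge0 (x : R) : 0 <= omega (1 - al) x.
Proof. by rewrite omegaE divr_ge0 ?powR_ge0 ?(ltW Gamma1B_gt0). Qed.

Lemma omega_gt0 (x : R) : 0 < x -> 0 < omega (1 - al) x.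
Proof. by move=> x0; rewrite omegaE divr_gt0 ?powR_gt0 ?Gamma1B_gt0. Qed.

Lemma le_powRN (x y : R) : 0 < x -> x <= y -> y `^ (- al) <= x `^ (- al).
Proof.
move=> x0 xy; rewrite !powRN lef_pV2 ?posrE ?powR_gt0 ?(lt_le_trans x0)//.
by apply: le_powRl => //; exact: ltW.
Qed.

Lemma le_omega (x y : R) : 0 < x -> x <= y -> omega (1 - al) y <= omega (1 - al) x.
Proof.
by move=> x0 xy; rewrite !omegaE ler_wpM2r ?invr_ge0 ?(ltW Gamma1B_gt0)// le_powRN.
Qed.

Lemma omega_prim0 : omega_prim 0 = 0.
Proof. by rewrite /omega_prim powR0 ?mul0r// gt_eqF// subr_gt0. Qed.

Lemma omega_prim_ge0 (x : R) : 0 <= omega_prim x.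
Proof. by rewrite /omega_prim divr_ge0 ?powR_ge0 ?(ltW Gamma2B_gt0). Qed.

Lemma is_derive_omega_prim (x : R) : 0 < x ->
  is_derive x 1 omega_prim (omega (1 - al) x).
Proof.
move=> x0; have D := is_derive1_powR (1 - al) x0.
have -> : omega_prim = (Gamma (2 - al))^-1 \*: (fun x : R => x `^ (1 - al)).
  by apply/funext => y; rewrite /omega_prim /= /GRing.scale/= mulrC.
apply: is_derive_eq; rewrite omegaE /GRing.scale/= Gamma2BE.
rewrite (_ : 1 - al - 1 = - al); last by ring.
rewrite invfM; field.
by rewrite !gt_eqF ?Gamma1B_gt0// subr_gt0.
Qed.

Definition omega_slope (x : R) : R := al * x `^ (- al - 1) / Gamma (1 - al).

Lemma is_derive_omega (x : R) : 0 < x ->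
  is_derive x 1 (omega (1 - al)) (- omega_slope x).
Proof.
move=> x0; have D := is_derive1_powR (- al) x0.
have -> : omega (1 - al) = (Gamma (1 - al))^-1 \*: (fun x : R => x `^ (- al)).
  by apply/funext => y; rewrite omegaE /= /GRing.scale/= mulrC.
by apply: is_derive_eq; rewrite /GRing.scale/= /omega_slope; ring.
Qed.

Lemma le_omega_slope (x y : R) : 0 < x -> x <= y -> omega_slope y <= omega_slope x.
Proof.
move=> x0 xy; rewrite /omega_slope ler_wpM2r ?invr_ge0 ?(ltW Gamma1B_gt0)//.
rewrite ler_wpM2l ?(ltW al_gt0)//.
have -> : - al - 1 = - (al + 1) by ring.
rewrite !powRN lef_pV2 ?posrE ?powR_gt0 ?(lt_le_trans x0)//.
by apply: le_powRl => //; [rewrite addr_ge0// ltW|exact: ltW].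
Qed.

Lemma omega_slope_ge0 (x : R) : 0 <= omega_slope x.
Proof. by rewrite /omega_slope divr_ge0 ?(ltW Gamma1B_gt0)// mulr_ge0 ?powR_ge0 ?ltW. Qed.

Lemma le_omega_prim (x y : R) : 0 <= x -> x <= y -> omega_prim x <= omega_prim y.
Proof.
move=> x0 xy; rewrite /omega_prim ler_wpM2r ?invr_ge0 ?(ltW Gamma2B_gt0)//.
by rewrite le_powRl// subr_ge0 ltW.
Qed.

(** Concavity of the primitive: an increment of given length shrinks as it moves away from 0. It
    lets increments seen from t_(n-theta) dominate those seen from t_n. *)
Lemma omega_prim_incr (x y d : R) : 0 < x -> x <= y -> 0 <= d ->
  omega_prim (y + d) - omega_prim y <= omega_prim (x + d) - omega_prim x.
Proof.
move=> x0 xy d0.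
have D (s : R) : s \in `[x, y] -> is_derive s 1
    (fun s => omega_prim (s + d) - omega_prim s)
    (omega (1 - al) (s + d) - omega (1 - al) s).
  rewrite in_itv/= => /andP[xs _]; have s0 := lt_le_trans x0 xs.
  have D1 := is_derive_omega_prim s0.
  have D2 : is_derive (s + d) 1 omega_prim (omega (1 - al) (s + d)).
    by apply: is_derive_omega_prim; rewrite ltr_pwDl.
  have D3 : is_derive s 1 (fun s => omega_prim (s + d)) (omega (1 - al) (s + d)).
    rewrite -[X in is_derive _ _ _ X]mulr1.
    apply: (@is_derive1_comp R omega_prim (fun s => s + d)).
    by rewrite -[X in is_derive _ _ _ X]addr0; exact: is_deriveD.
  exact: is_deriveB.
have [c cI E] := MVT_segment xy (fun s sI => D s (subset_itv_oo_cc sI))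
  (is_derive_within_continuous D).
rewrite -subr_le0 E mulr_le0_ge0 ?subr_ge0// subr_le0.
move: cI; rewrite in_itv/= => /andP[xc _].
by apply: le_omega; [exact: lt_le_trans xc|rewrite lerDl].
Qed.

Lemma omega_prim_cvg0 : omega_prim @ 0^'+ --> (0 : R).
Proof.
rewrite -[X in _ --> X](mul0r (Gamma (2 - al))^-1); apply: cvgMl.
by apply: powR_cvg0; rewrite subr_gt0.
Qed.

Section Shifted.
Variable s0 : R.

Definition omega_s (s : R) : R := omega (1 - al) (s0 - s).

Lemma is_derive_omega_prim_s (s : R) : s < s0 ->
  is_derive s 1 (fun s => - omega_prim (s0 - s)) (omega_s s).
Proof.
move=> ss0; have D : is_derive (s0 - s) 1 omega_prim (omega_s s).
  by apply: is_derive_omega_prim; rewrite subr_gt0.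
by rewrite -[X in is_derive _ _ _ X]opprK; apply: is_deriveN; exact: is_derive_comp_subl D.
Qed.

Lemma is_derive_omega_s (s : R) : s < s0 ->
  is_derive s 1 omega_s (omega_slope (s0 - s)).
Proof.
move=> ss0; have D : is_derive (s0 - s) 1 (omega (1 - al)) (- omega_slope (s0 - s)).
  by apply: is_derive_omega; rewrite subr_gt0.
by rewrite -[X in is_derive _ _ _ X]opprK; exact: is_derive_comp_subl D.
Qed.

Lemma omega_s_ge0 (s : R) : 0 <= omega_s s.
Proof. exact: omega_ge0. Qed.

Lemma le_omega_s (s r : R) : r < s0 -> s <= r -> omega_s s <= omega_s r.
Proof. by move=> rs0 sr; apply: le_omega; [rewrite subr_gt0|rewrite lerB]. Qed.

Lemma continuous_omega_s (s : R) : s < s0 -> {for s, continuous omega_s}.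
Proof. by move=> /is_derive_omega_s; exact: is_derive_continuous. Qed.

Lemma within_continuous_omega_s (a b : R) : b < s0 ->
  {within `[a, b], continuous omega_s}.
Proof.
move=> bs; apply: continuous_in_subspaceT => x /[!inE]/=; rewrite in_itv/= => /andP[_ xb].
exact/continuous_omega_s/(le_lt_trans xb).
Qed.

(** The case [b = s0], where the kernel is singular, is the one needed on the last cell; hence the
    improper form of the fundamental theorem. *)
Lemma omega_s_integral (a b : R) : a <= b -> b <= s0 ->
  mu.-integrable `[a, b] (EFin \o omega_s) /\
  \int[mu]_(s in `[a, b]) omega_s s = omega_prim (s0 - a) - omega_prim (s0 - b).
Proof.
move=> ab bs.
have [->|ab'] := eqVneq a b.
  rewrite set_itv1 Rintegral_set1 subrr; split=> //.
  apply/integrableP; split; first exact: measurable_fun_set1.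
  by rewrite integral_set1.
have {}ab : a < b by rewrite lt_neqAle ab'.
have lts (x : R) : x \in `]a, b[ -> x < s0.
  by rewrite in_itv/= => /andP[_ /lt_le_trans]; apply.
have [] := @improper_FTC_integrable R omega_s (fun s => - omega_prim (s0 - s)) a b ab.
- by move=> x /lts; exact: is_derive_omega_prim_s.
- by move=> x /lts; exact: continuous_omega_s.
- by move=> x _; exact: omega_s_ge0.
- apply: cvg_at_right_filter; apply: (is_derive_continuous (is_derive_omega_prim_s _)).
  exact: lt_le_trans bs.
- move: bs; rewrite le_eqVlt => /predU1P[bs|bs]; last first.
    by apply: cvg_at_left_filter; apply: (is_derive_continuous (is_derive_omega_prim_s _)).
  rewrite bs subrr omega_prim0 oppr0 -[X in _ --> X]oppr0; apply: cvgN.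
  apply: (@cvg_comp _ _ _ (fun s => s0 - s) omega_prim _ (0^'+)); last exact: omega_prim_cvg0.
  move=> A [e /= e0 eA]; exists e => //= x /= xe xs0.
  by apply: eA => /=; rewrite ?subr_gt0// sub0r normrN.
move=> Io Eo.
have mo : measurable_fun [set: R] omega_s.
  rewrite (_ : omega_s = fun s => (s0 - s) `^ (- al) / Gamma (1 - al)); last first.
    by apply/funext => s; rewrite /omega_s omegaE.
  apply: measurable_funM => //; apply: measurableT_comp (measurable_powR _) _.
  exact: measurable_funB.
have mo' (D : set R) : measurable D -> measurable_fun D (EFin \o omega_s).
  by move=> mD; apply/measurable_EFinP; exact: measurable_funS mo.
(* The two end points are null sets, so the value given to the kernel at [s0] does not matter. *)
have Eco : (\int[mu]_(x in `]a, b[) (EFin \o omega_s) x = \int[mu]_(x in `[a, b]) (EFin \o omega_s) x)%E.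
  rewrite integral_itv_bndo_bndc; last exact: mo'.
  by rewrite integral_itv_obnd_cbnd//; exact: mo'.
split; last by rewrite /Rintegral -[in LHS]Eco -/(Rintegral _ _ _) Eo; ring.
apply/integrableP; split; first exact: mo'.
have /integrableP[_] := Io.
congr (_ < _)%E.
transitivity (\int[mu]_(x in `]a, b[) (EFin \o omega_s) x)%E.
  by apply: eq_integral => x _; rewrite /= ger0_norm// omega_s_ge0.
by rewrite Eco; apply: eq_integral => x _; rewrite /= ger0_norm// omega_s_ge0.
Qed.

End Shifted.
End Kernel.

(** * Moments of a monotone weight on one cell *)

Section CellMoments.
Context {R : realType}.
Notation mu := (@lebesgue_measure R).
Variables (a b : R).
Hypothesis ab : a <= b.

Lemma within_continuousM (f g : R -> R) :
  {within `[a, b], continuous f} -> {within `[a, b], continuous g} ->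
  {within `[a, b], continuous (fun s => f s * g s)}.
Proof. by move=> cf cg x; apply: continuousM; [exact: cf|exact: cg]. Qed.

Lemma within_continuousB (f g : R -> R) :
  {within `[a, b], continuous f} -> {within `[a, b], continuous g} ->
  {within `[a, b], continuous (fun s => f s - g s)}.
Proof. by move=> cf cg x; apply: continuousB; [exact: cf|exact: cg]. Qed.

Lemma within_continuous_cst (c : R) : {within `[a, b], continuous (fun=> c : R)}.
Proof. by move=> x; exact: cst_continuous. Qed.

Lemma within_continuous_id : {within `[a, b], continuous (fun s : R => s)}.
Proof. by apply: continuous_subspaceT => x; exact. Qed.

Variable g : R -> R.
Hypothesis cg : {within `[a, b], continuous g}.
Hypothesis g_nd : forall s r, s \in `[a, b] -> r \in `[a, b] -> s <= r -> g s <= g r.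

Let ca : a \in `[a, b]. Proof. by rewrite in_itv/= lexx ab. Qed.
Let cb : b \in `[a, b]. Proof. by rewrite in_itv/= lexx ab. Qed.

Lemma cell_average_ge : g a * (b - a) <= \int[mu]_(s in `[a, b]) g s.
Proof.
rewrite -Rintegral_cst_itv//; apply: le_Rintegral => //.
- exact/continuous_itv_integrable/within_continuous_cst.
- exact: continuous_itv_integrable.
- by move=> x /= xab; apply: g_nd => //; move: xab; rewrite in_itv/= => /andP[].
Qed.

Lemma cell_average_le : \int[mu]_(s in `[a, b]) g s <= g b * (b - a).
Proof.
rewrite -Rintegral_cst_itv//; apply: le_Rintegral => //.
- exact: continuous_itv_integrable.
- exact/continuous_itv_integrable/within_continuous_cst.
- by move=> x /= xab; apply: g_nd => //; move: xab; rewrite in_itv/= => /andP[].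
Qed.

(** As [h] has mean zero, [g] may be replaced by [g - g a], which is nonnegative. Thus only the
    variation of the weight over the cell enters, not its size, and variations telescope when summed
    over cells. *)
Lemma cell_covariance (h : R -> R) (c : R) :
  {within `[a, b], continuous h} -> \int[mu]_(s in `[a, b]) h s = 0 ->
  (forall s, s \in `[a, b] -> `|h s| <= c) ->
  `|\int[mu]_(s in `[a, b]) (g s * h s)| <=
    c * (\int[mu]_(s in `[a, b]) g s - g a * (b - a)).
Proof.
move=> ch h0 hc.
have -> : \int[mu]_(s in `[a, b]) (g s * h s) =
    \int[mu]_(s in `[a, b]) ((g s - g a) * h s).
  have -> : \int[mu]_(s in `[a, b]) (g s * h s) =
     \int[mu]_(s in `[a, b]) (g s * h s) - g a * \int[mu]_(s in `[a, b]) h s.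
    by rewrite h0 mulr0 subr0.
  rewrite -RintegralZl//; last exact: continuous_itv_integrable.
  rewrite -RintegralB//; last 2 first.
  - exact/continuous_itv_integrable/within_continuousM.
  - exact/continuous_itv_integrable/within_continuousM/ch/within_continuous_cst.
  by apply: eq_Rintegral => x _; rewrite mulrBl.
have cgB : {within `[a, b], continuous (fun s => g s - g a)}.
  exact/within_continuousB/within_continuous_cst.
have iM : mu.-integrable `[a, b] (EFin \o (fun s => (g s - g a) * h s)).
  exact/continuous_itv_integrable/within_continuousM.
apply: le_trans (le_normr_Rintegral _ iM) _ => //.
rewrite -Rintegral_cst_itv// -RintegralB//; last 2 first.
- exact: continuous_itv_integrable.
- exact/continuous_itv_integrable/within_continuous_cst.
rewrite -RintegralZl//; last exact: continuous_itv_integrable.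
apply: le_Rintegral => //.
- exact: integrable_norm iM.
- exact/continuous_itv_integrable/within_continuousM/cgB/within_continuous_cst.
- move=> x /= xab; have xa : 0 <= g x - g a.
    by rewrite subr_ge0 g_nd//; move: xab; rewrite in_itv/= => /andP[].
  by rewrite normrM (ger0_norm xa) mulrC; apply: ler_wpM2r => //; exact: hc.
Qed.

Let m := (b + a) / 2.

Lemma cell_midpoint : \int[mu]_(s in `[a, b]) (s - m) = 0.
Proof.
apply: (@Rintegral_FTC_eq R _ (fun s => (s - m) ^+ 2 / 2)) => //.
- by rewrite /m; field.
- by move=> x _; apply: is_derive_eq; rewrite /GRing.scale/=; field.
- by apply: within_continuousB; [exact: within_continuous_id|exact: within_continuous_cst].
Qed.

Let cm : m \in `[a, b].
Proof. by rewrite in_itv/= /m; move: ab; lra. Qed.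

Let csm : {within `[a, b], continuous (fun s => s - m)}.
Proof. by apply: within_continuousB; [exact: within_continuous_id|exact: within_continuous_cst]. Qed.

Let momentE : \int[mu]_(s in `[a, b]) ((s - m) * g s) =
  \int[mu]_(s in `[a, b]) ((s - m) * (g s - g m)).
Proof.
have -> : \int[mu]_(s in `[a, b]) ((s - m) * g s) =
   \int[mu]_(s in `[a, b]) ((s - m) * g s) - \int[mu]_(s in `[a, b]) (s - m) * g m.
  by rewrite cell_midpoint mul0r subr0.
rewrite -RintegralZr//; last exact: continuous_itv_integrable.
rewrite -RintegralB//; last 2 first.
- exact/continuous_itv_integrable/within_continuousM.
- exact/continuous_itv_integrable/within_continuousM/within_continuous_cst.
by apply: eq_Rintegral => x _; rewrite mulrBr.
Qed.

(** Subtracting [g m] changes nothing because [s - m] has mean zero, and afterwards both factors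
    have the same sign. *)
Lemma cell_moment_ge0 : 0 <= \int[mu]_(s in `[a, b]) ((s - m) * g s).
Proof.
rewrite momentE; apply: Rintegral_ge0 => s /= sab.
have [ms|/ltW sm] := leP m s.
  by rewrite mulr_ge0 ?subr_ge0// g_nd.
by rewrite -mulrNN mulr_ge0// oppr_ge0 subr_le0 ?g_nd.
Qed.

Lemma cell_moment_le (p : R) :
  (forall s r, s \in `[a, b] -> r \in `[a, b] -> s <= r -> g r - g s <= p * (r - s)) ->
  \int[mu]_(s in `[a, b]) ((s - m) * g s) <= p * (b - a) ^+ 3 / 12.
Proof.
move=> gp; rewrite momentE.
have <- : \int[mu]_(s in `[a, b]) (p * (s - m) ^+ 2) = p * (b - a) ^+ 3 / 12.
  apply: (@Rintegral_FTC_eq R _ (fun s => p * (s - m) ^+ 3 / 3)) => //.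
  - by rewrite /m; field.
  - by move=> x _; apply: is_derive_eq; rewrite /GRing.scale/=; field.
  - rewrite (_ : (fun s => _) = fun s => p * ((s - m) * (s - m))); last by apply/funext.
    by apply: within_continuousM (within_continuousM csm csm); exact: within_continuous_cst.
apply: le_Rintegral => //.
- apply/continuous_itv_integrable/within_continuousM => //.
  exact/within_continuousB/within_continuous_cst.
- rewrite (_ : (fun s => _) = fun s => p * ((s - m) * (s - m))); last by apply/funext.
  by apply/continuous_itv_integrable/within_continuousM/within_continuousM; first exact: within_continuous_cst.
move=> s /= sab; rewrite expr2 mulrCA; have [ms|/ltW sm] := leP m s.
  by rewrite ler_wpM2l ?subr_ge0// gp.
rewrite -subr_ge0 (_ : _ - _ = (m - s) * (p * (m - s) - (g m - g s))); last by ring.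
by rewrite mulr_ge0 ?subr_ge0// gp.
Qed.

Lemma cell_average_le_slope (p : R) :
  (forall s, s \in `[a, b] -> p * (b - s) <= g b - g s) ->
  \int[mu]_(s in `[a, b]) g s <= g b * (b - a) - p * (b - a) ^+ 2 / 2.
Proof.
move=> gp.
have cl : {within `[a, b], continuous (fun s => g b - p * (b - s))}.
  apply: within_continuousB; first exact: within_continuous_cst.
  apply: within_continuousM; first exact: within_continuous_cst.
  by apply: within_continuousB; [exact: within_continuous_cst|exact: within_continuous_id].
have <- : \int[mu]_(s in `[a, b]) (g b - p * (b - s)) = g b * (b - a) - p * (b - a) ^+ 2 / 2.
  apply: (@Rintegral_FTC_eq R _ (fun s => g b * s + p * (b - s) ^+ 2 / 2)) => //.
  - by field.
  - by move=> x _; apply: is_derive_eq; rewrite /GRing.scale/=; field.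
apply: le_Rintegral => //; try exact: continuous_itv_integrable.
by move=> s /= /gp; lra.
Qed.

End CellMoments.

(** * Coefficients of the Alikhanov formula *)

Ltac pos := solve [repeat first
  [ done | assumption | by apply: ltW | rewrite subr_ge0 | rewrite subr_gt0
  | apply: mulr_gt0 | apply: mulr_ge0 | apply: divr_gt0 | apply: divr_ge0
  | apply: addr_gt0 | apply: addr_ge0 | apply: exprn_gt0 | apply: exprn_ge0
  | apply: powR_gt0 | apply: powR_ge0 | apply: expR_gt0 | apply: expR_ge0
  | rewrite invr_ge0 | rewrite invr_gt0 ]].

(** What the analysis in time takes from the graded mesh: steps that do not decrease, of size at
    most G t_k / k, and consecutive nodes that are comparable from the first positive one on. One
    constant serves for all, and [graded_mesh_regular] supplies it. *)
Record regular_mesh (R : realType) (t : nat -> R) (N : nat) (G : R) : Prop :=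
  RegularMesh {
  mesh_ge1 : 1 <= G;
  mesh0 : t 0%N = 0;
  mesh_step_gt0 : forall k, (1 <= k <= N)%N -> 0 < step t k;
  mesh_step_nd : forall k, (1 <= k < N)%N -> step t k <= step t k.+1;
  mesh_step_le : forall k, (1 <= k <= N)%N -> step t k <= G * t k / k%:R;
  mesh_node_le : forall k, (2 <= k <= N)%N -> t k <= G * t k.-1 }.

Section Mesh.
Context {R : realType}.
Variables (t : nat -> R) (N : nat) (G : R).
Hypothesis mesh : regular_mesh t N G.

Lemma stepE k : t k.+1 = t k + step t k.+1.
Proof. by rewrite /step/=; ring. Qed.

Lemma node_lt k l : (k < l <= N)%N -> t k < t l.
Proof.
elim: l => // l IH /andP[kl lN].
have tl : t l < t l.+1 by rewrite stepE ltrDl (mesh_step_gt0 mesh)// lN.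
move: kl; rewrite ltnS leq_eqVlt => /predU1P[->//|kl].
by apply: lt_trans tl; rewrite IH// kl ltnW.
Qed.

Lemma node_le k l : (k <= l <= N)%N -> t k <= t l.
Proof.
by rewrite leq_eqVlt => /andP[/predU1P[->//|kl] lN]; rewrite ltW// node_lt// kl.
Qed.

Lemma node_ge0 k : (k <= N)%N -> 0 <= t k.
Proof. by move=> kN; rewrite -(mesh0 mesh) node_le. Qed.

Lemma node_gt0 k : (1 <= k <= N)%N -> 0 < t k.
Proof. by move=> kN; rewrite -(mesh0 mesh) node_lt. Qed.

Lemma step_le k l : (1 <= k <= l)%N -> (l <= N)%N -> step t k <= step t l.
Proof.
elim: l => [|l IH] /andP[k1 kl] lN; first by move: k1 kl; case: k.
move: kl; rewrite leq_eqVlt => /predU1P[->//|kl].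
rewrite (le_trans (IH _ _)) ?k1// ?(ltnW lN)// (mesh_step_nd mesh)// lN andbT.
by lia.
Qed.

Lemma node_le_step k l : (k <= l)%N -> (l <= N)%N -> t k <= k%:R * step t l.
Proof.
elim: k => [|k IH] kl lN; first by rewrite (mesh0 mesh) mul0r.
rewrite stepE -natr1 mulrDl mul1r; apply: lerD; first by apply: IH => //; exact: ltnW.
by apply: step_le => //; rewrite kl.
Qed.

End Mesh.

Section Coefficients.
Context {R : realType}.
Notation mu := (@lebesgue_measure R).
Variables (t : nat -> R) (N : nat) (G al : R).
Hypothesis mesh : regular_mesh t N G.
Hypothesis al01 : 0 < al < 1.
Let th := al / 2.
Variable n : nat.
Hypothesis nN : (1 <= n <= N)%N.

Let n1 : (1 <= n)%N. Proof. by case/andP: nN. Qed.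
Let nleN : (n <= N)%N. Proof. by case/andP: nN. Qed.

Let sg := t_theta t th n.
Let g := omega_s al sg.
Let a := a_coef t al th n.
Let b := b_coef t al th n.
Let A := A_coef t al th n.

Lemma t_thetaE : sg - t n.-1 = (1 - th) * step t n.
Proof. by rewrite /sg /t_theta /step; ring. Qed.

Let step_n_gt0 : 0 < step t n. Proof. exact: (mesh_step_gt0 mesh). Qed.

Lemma t_theta_gt k : (k < n)%N -> t k < sg.
Proof.
move=> kn; apply: (@le_lt_trans _ _ (t n.-1)).
  apply: (node_le mesh); rewrite (leq_trans (leq_pred n) nleN) andbT.
  by rewrite -ltnS prednK.
by rewrite -subr_gt0 t_thetaE mulr_gt0// /th; move: al01; lra.
Qed.

Lemma t_theta_lt : sg < t n.
Proof.
rewrite -subr_gt0 (_ : _ - _ = th * step t n); last by rewrite /sg /t_theta /step; ring.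
by rewrite mulr_gt0// /th; move: al01; lra.
Qed.

Section Cell.
Variable k : nat.
Hypothesis k1n : (1 <= k < n)%N.

Let k1 : (1 <= k)%N. Proof. by case/andP: k1n. Qed.
Let kn : (k < n)%N. Proof. by case/andP: k1n. Qed.
Let kN : (1 <= k <= N)%N. Proof. by rewrite k1 (leq_trans (ltnW kn)). Qed.

Let step_k_gt0 : 0 < step t k. Proof. exact: (mesh_step_gt0 mesh). Qed.
Let tk : t k.-1 <= t k. Proof. by rewrite -subr_ge0 ltW. Qed.

Let cg : {within `[t k.-1, t k], continuous g}.
Proof. by apply: within_continuous_omega_s => //; exact: t_theta_gt. Qed.

Let g_nd s r : s \in `[t k.-1, t k] -> r \in `[t k.-1, t k] -> s <= r -> g s <= g r.
Proof.
rewrite !in_itv/= => /andP[s1 s2] /andP[r1 r2] sr.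
by apply: le_omega_s => //; exact: le_lt_trans r2 (t_theta_gt kn).
Qed.

Let aE : a k = (step t k)^-1 * \int[mu]_(s in `[t k.-1, t k]) g s.
Proof. by rewrite /a /a_coef min_l// ltW// t_theta_gt. Qed.

Lemma a_coef_primE : a k * step t k = omega_prim al (sg - t k.-1) - omega_prim al (sg - t k).
Proof.
rewrite aE mulrAC mulVf ?gt_eqF// mul1r.
by apply: (omega_s_integral al01 tk _).2; rewrite ltW// t_theta_gt.
Qed.

Lemma a_coef_ge : g (t k.-1) <= a k.
Proof. by rewrite aE ler_pdivlMl// mulrC; exact: cell_average_ge. Qed.

Lemma a_coef_le : a k <= g (t k).
Proof. by rewrite aE ler_pdivrMl// mulrC; exact: cell_average_le. Qed.

Let stepS_ge0 : 0 <= step t k.+1.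
Proof. by apply: ltW; apply: (mesh_step_gt0 mesh); rewrite (leq_trans kn). Qed.

Let stepS_ge : step t k <= step t k.+1.
Proof. by apply: (mesh_step_nd mesh); rewrite k1 (leq_trans kn). Qed.

Let bE : b k = 2 / (step t k * (step t k + step t k.+1)) *
  \int[mu]_(s in `[t k.-1, t k]) ((s - (t k + t k.-1) / 2) * g s).
Proof. by []. Qed.

Lemma b_coef_ge0 : 0 <= b k.
Proof.
rewrite bE mulr_ge0 ?cell_moment_ge0//.
by pos.
Qed.

Let moment_ge0 : 0 <= \int[mu]_(s in `[t k.-1, t k]) ((s - (t k + t k.-1) / 2) * g s).
Proof. exact: cell_moment_ge0. Qed.

(** [s] minus the midpoint has mean zero and modulus at most half the step, so [cell_covariance]
    applies; the steps do not decrease, hence the denominator is at least twice the square of the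
    step. *)
Lemma b_coef_le : b k <= (a k - g (t k.-1)) / 2.
Proof.
have I0 := moment_ge0; move: I0 bE.
set I' := \int[mu]_(s in _) _ => I0 ->.
have H : I' <= step t k / 2 * (step t k * (a k - g (t k.-1))).
  rewrite mulrBr aE mulrA mulfV ?gt_eqF// mul1r [step t k * g _]mulrC.
  have -> : I' = \int[mu]_(s in `[t k.-1, t k]) (g s * (s - (t k + t k.-1) / 2)).
    by apply: eq_Rintegral => s _; rewrite mulrC.
  apply: le_trans (ler_norm _) _; apply: cell_covariance => //.
  - by apply: within_continuousB; [exact: within_continuous_id|exact: within_continuous_cst].
  - exact: cell_midpoint.
  - by move=> s; rewrite in_itv/= ler_norml /step => /andP[]; lra.
rewrite mulrAC ler_pdivrMr; last by rewrite mulr_gt0// ltr_wpDr.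
apply: (@le_trans _ _ (2 * (step t k / 2 * (step t k * (a k - g (t k.-1)))))).
  by rewrite ler_pM2l.
have := a_coef_ge; rewrite -subr_ge0; set d := a k - _ => d0.
have : 0 <= step t k * d * (step t k.+1 - step t k).
  by pos.
by lra.
Qed.

Lemma b_coef_le_slope : b k * (step t k * (step t k + step t k.+1)) <=
  omega_slope al (sg - t k) * step t k ^+ 3 / 6.
Proof.
rewrite bE mulrAC divfK; last first.
  by rewrite mulf_neq0// gt_eqF// ltr_wpDr.
rewrite (_ : _ / 6 = 2 * (omega_slope al (sg - t k) * step t k ^+ 3 / 12)); last by field.
rewrite ler_pM2l//; apply: cell_moment_le => // s r; rewrite !in_itv/= => /andP[s1 s2] /andP[r1 r2] sr.
have D x : x \in `[s, r] -> is_derive x 1 g (omega_slope al (sg - x)).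
  rewrite in_itv/= => /andP[_ xr]; apply: is_derive_omega_s => //.
  exact: le_lt_trans (le_trans xr r2) (t_theta_gt kn).
have [c cI ->] := MVT_segment sr (fun s sI => D s (subset_itv_oo_cc sI))
  (is_derive_within_continuous D).
rewrite ler_wpM2r ?subr_ge0//; apply: le_omega_slope => //.
  by rewrite subr_gt0 t_theta_gt.
by move: cI; rewrite in_itv/= => /andP[_ cr]; rewrite lerB// (le_trans cr).
Qed.

Lemma a_coef_le_slope :
  a k <= g (t k) - omega_slope al (sg - t k.-1) * step t k / 2.
Proof.
rewrite aE ler_pdivrMl//.
rewrite [leRHS](_ : _ = g (t k) * step t k - omega_slope al (sg - t k.-1) * step t k ^+ 2 / 2); last by field.
apply: cell_average_le_slope => // s; rewrite in_itv/= => /andP[s1 s2].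
have D x : x \in `[s, t k] -> is_derive x 1 g (omega_slope al (sg - x)).
  rewrite in_itv/= => /andP[_ xr]; apply: is_derive_omega_s => //.
  exact: le_lt_trans xr (t_theta_gt kn).
have [c cI ->] := MVT_segment s2 (fun s sI => D s (subset_itv_oo_cc sI))
  (is_derive_within_continuous D).
rewrite ler_wpM2r ?subr_ge0//; apply: le_omega_slope => //.
  rewrite subr_gt0; move: cI; rewrite in_itv/= => /andP[_ cr].
  exact: le_lt_trans cr (t_theta_gt kn).
by move: cI; rewrite in_itv/= => /andP[cr _]; rewrite lerB// (le_trans s1).
Qed.

End Cell.

Let step_gt0 k : (1 <= k <= n)%N -> 0 < step t k.
Proof. by move=> /andP[k1 kn]; apply: (mesh_step_gt0 mesh); rewrite k1 (leq_trans kn). Qed.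

Let b_ratio k : (1 <= k < n)%N -> b k / Defs.ratio t k.+1 = b k * step t k / step t k.+1.
Proof. by move=> k1; rewrite /Defs.ratio/= invfM invrK mulrA mulrAC. Qed.

Lemma b_coef_ratio_ge0 k : (1 <= k < n)%N -> 0 <= b k / Defs.ratio t k.+1.
Proof.
move=> kn; rewrite b_ratio//.
have s1 : 0 < step t k by apply: step_gt0; lia.
have s2 : 0 < step t k.+1 by apply: step_gt0; lia.
by have b0 := b_coef_ge0 kn; pos.
Qed.

(** Convexity of the kernel: its slope at the common node t_k is the largest on cell k and the
    smallest on cell k+1. Both sides are compared with a quarter of this slope times the step
    k+1. *)
Lemma b_coef_ratio_le k : (1 <= k)%N -> (k.+1 < n)%N ->
  b k / Defs.ratio t k.+1 <= (g (t k.+1) - a k.+1) / 2.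
Proof.
move=> k1 kn; rewrite b_ratio; last by rewrite k1 ltnW.
have s1 : 0 < step t k by apply: step_gt0; lia.
have s2 : 0 < step t k.+1 by apply: step_gt0; lia.
have s12 : step t k <= step t k.+1 by apply: (mesh_step_nd mesh); lia.
have k1n : (1 <= k < n)%N by rewrite k1 ltnW.
have := b_coef_le_slope k1n; have := @a_coef_le_slope k.+1 kn => /=.
set p := omega_slope _ _; have p0 : 0 <= p by apply: omega_slope_ge0.
set x := step t k in s1 s12 *; set y := step t k.+1 in s2 s12 * => H1 H2.
apply: (@le_trans _ _ (p * y / 4)); last by lra.
rewrite ler_pdivrMr//.
have xy : 0 < x + y by rewrite addr_gt0.
suff : b k * (x * (x + y)) <= p * y / 4 * y * (x + y) by rewrite mulrA ler_pM2r.
apply: le_trans H2 _.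
have : 0 <= p * (y ^+ 3 - x ^+ 3).
  by rewrite mulr_ge0// subr_ge0 lerXn2r// nnegrE ltW.
have : 0 <= p * (y ^+ 2 * x) by pos.
have : 0 <= p * y ^+ 3 by pos.
by lra.
Qed.

(** With [A_coef_le] this places each weight between the values of the kernel at the two ends of its
    own cell. Monotonicity of the weights is then immediate, the values of neighbouring cells being
    interlaced. *)
Lemma A_coef_ge k : (1 <= k < n)%N -> (a k + g (t k.-1)) / 2 <= A k.
Proof.
move=> k1n; have [k1 kn] := andP k1n.
rewrite /A /A_coef -/(b k) -/(a k).
have -> : n == 1%N = false by lia.
have -> : k == n = false by lia.
have H := b_coef_le k1n.
case: eqP => [k_1|k_1]; first by rewrite k_1 in H *; rewrite /a /b in H; rewrite -/a -/b in H *; lra.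
have H2 := @b_coef_ratio_ge0 k.-1 _.
by rewrite prednK// in H2; have {}H2 := H2 ltac:(lia); rewrite /b in H2; lra.
Qed.

Lemma A_coef_le k : (1 <= k < n)%N -> A k <= g (t k).
Proof.
move=> k1n; have [k1 kn] := andP k1n.
rewrite /A /A_coef -/(b k) -/(a k).
have -> : n == 1%N = false by lia.
have -> : k == n = false by lia.
have H := b_coef_ge0 k1n; have H' := a_coef_le k1n.
case: eqP => [k_1|k_1].
  by rewrite k_1 in H H' *; rewrite /a /b in H H' *; lra.
have H2 := @b_coef_ratio_le k.-1 _ _.
rewrite prednK// in H2; have {}H2 := H2 ltac:(lia) ltac:(lia).
by rewrite /a /b in H H' H2 *; lra.
Qed.

Lemma A_coef_last_ge : a n <= A n.
Proof.
rewrite /A /A_coef eqxx -/(a n); case: eqP => [->//|n_1].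
have H2 := @b_coef_ratio_ge0 n.-1 _.
rewrite prednK// in H2; have {}H2 := H2 ltac:(lia).
by rewrite /b in H2; rewrite lerDl.
Qed.

Lemma a_coef_lastE : a n * step t n = omega_prim al ((1 - th) * step t n).
Proof.
rewrite /a /a_coef min_r ?(ltW t_theta_lt)// mulrAC mulVf ?gt_eqF// mul1r -t_thetaE.
have := (@omega_s_integral _ _ al01 sg (t n.-1) sg _ _).2.
rewrite subrr omega_prim0// subr0; apply => //.
by apply/ltW/t_theta_gt; rewrite prednK.
Qed.

Lemma a_coef_lastE' : a n = (1 - th) `^ (1 - al) * step t n `^ (- al) / Gamma (2 - al).
Proof.
have th1 : 0 <= 1 - th by rewrite /th; move: al01; lra.
apply: (mulIf (lt0r_neq0 step_n_gt0)); rewrite a_coef_lastE /omega_prim powRM ?(ltW step_n_gt0)//.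
rewrite -mulrA mulrAC -!mulrA; congr (_ * _); rewrite [in RHS]mulrCA mulrA; congr (_ / _).
rewrite -(mulr_powRB1 (ltW step_n_gt0)) ?subr_gt0//; last by case/andP: al01.
by congr (_ * _ `^ _); ring.
Qed.

(* [sg] is chosen so that g (t n.-1) is a fixed fraction of the last average. *)
Lemma omega_last : g (t n.-1) = (1 - al) / (1 - th) * a n.
Proof.
have th1 : 0 < 1 - th by rewrite /th; move: al01; lra.
have al1 : 0 < 1 - al by rewrite subr_gt0; case/andP: al01.
rewrite /g /omega_s omegaE// a_coef_lastE' t_thetaE powRM ?ltW//.
rewrite Gamma2BE// -(mulr_powRB1 (ltW th1) al1).
rewrite (_ : 1 - al - 1 = - al); last by ring.
have : Gamma (1 - al) != 0 :> R by rewrite gt_eqF// Gamma1B_gt0.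
move: (gt_eqF al1) (gt_eqF th1) => /negbT ? /negbT ? ?; field.
by apply/and3P; split.
Qed.

End Coefficients.

Lemma pred_bounds (m : nat) : (1 <= m)%N -> m <> 1%N -> (1 <= m.-1 < m)%N.
Proof. lia. Qed.

Section DiscreteDerivative.
Context {R : realType}.
Variables (t : nat -> R) (N : nat) (G al : R).
Hypothesis mesh : regular_mesh t N G.
Hypothesis al01 : 0 < al < 1.
Let th := al / 2.
Variable n : nat.
Hypothesis nN : (1 <= n <= N)%N.

Let A := A_coef t al th n.
Let a := a_coef t al th n.
Let sg := t_theta t th n.

Let n1 : (1 <= n)%N. Proof. by case/andP: nN. Qed.
Let al_gt0 : 0 < al. Proof. by case/andP: al01. Qed.
Let al_lt1 : al < 1. Proof. by case/andP: al01. Qed.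
Let step_n_gt0 : 0 < step t n. Proof. exact: (mesh_step_gt0 mesh). Qed.

Lemma powR1B_ge_half (x : R) : 2^-1 <= x <= 1 -> 2^-1 <= x `^ (1 - al).
Proof.
move=> /andP[x1 x2]; have x0 : 0 < x by lra.
apply: le_trans x1 _.
by rewrite -{1}(powRr1 (ltW x0)) ger_powR ?x0// gerBl ltW.
Qed.

Let th_half : 2^-1 <= 1 - th <= 1.
Proof. by rewrite /th; apply/andP; split; move: al01; lra. Qed.

Lemma a_coef_last_ge : 2^-1 * step t n `^ (- al) / Gamma (2 - al) <= a n.
Proof.
rewrite /a (a_coef_lastE' mesh al01 nN) ler_pM2r ?invr_gt0 ?Gamma2B_gt0//.
by rewrite ler_pM2r ?powR_gt0// powR1B_ge_half.
Qed.

Lemma A_coef_gt0 k : (1 <= k <= n)%N -> 0 < A k.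
Proof.
move=> /andP[k1]; rewrite leq_eqVlt => /predU1P[->|kn].
  apply: lt_le_trans (A_coef_last_ge mesh al01 nN).
  apply: lt_le_trans a_coef_last_ge.
  by have := Gamma2B_gt0 al01 => ?; pos.
have k1n : (1 <= k < n)%N by rewrite k1.
apply: lt_le_trans (A_coef_ge mesh al01 nN k1n).
rewrite divr_gt0// ltr_pwDl ?omega_s_ge0//.
apply: lt_le_trans (a_coef_ge mesh al01 nN k1n).
apply: omega_gt0 => //; rewrite subr_gt0; apply: (t_theta_gt mesh al01 nN); lia.
Qed.

(** The kernel value at t_k separates the two weights; before the last level this is the interlacing
    just proved, at the last level it is [omega_last] together with 1 - al <= 1 - theta. *)
Lemma A_coef_nd k : (1 <= k < n)%N -> A k <= A k.+1.
Proof.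
move=> k1n; apply: le_trans (A_coef_le mesh al01 nN k1n) _.
have [kn|] := ltnP k.+1 n.
  have kn' : (1 <= k.+1 < n)%N by [].
  apply: le_trans (A_coef_ge mesh al01 nN kn').
  by have := a_coef_ge mesh al01 nN kn' => /=; lra.
move=> nk; have {nk}nk : n = k.+1 by lia.
apply: (@le_trans _ _ (a n)); last by rewrite nk; have := A_coef_last_ge mesh al01 nN; rewrite /A /a nk.
have -> : k = n.-1 by rewrite nk.
rewrite (omega_last mesh al01 nN) -/th ler_piMl//.
  apply: le_trans a_coef_last_ge.
  by have := Gamma2B_gt0 al01 => ?; pos.
rewrite ler_pdivrMr; last by move: th_half; lra.
by rewrite /th; move: al01; lra.
Qed.

Section Gap.
Variable K : R.
Hypothesis K0 : 0 <= K.
Hypothesis cfl : step t n `^ al * (11 * (1 - th) * K * Gamma (2 - al)) <= 4.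

Let a_last_K : 2^-1 * (11 / 4) * (1 - th) * K <= a n.
Proof.
apply: le_trans a_coef_last_ge.
have G0 := Gamma2B_gt0 al01.
have s0 : 0 < step t n `^ al by rewrite powR_gt0.
rewrite ler_pdivlMr// powRN ler_pdivlMr//.
move: cfl; lra.
Qed.

(** By [omega_last] the jump a_n - g(t_(n-1)) is exactly theta / (1 - theta) times a_n, and the step
    restriction makes a_n larger than (1 - theta) K. So the gap carries the same factor theta as the
    explicit part of [phi_bar], which it has to absorb even when al is small. *)
Lemma A_coef_gap : th * K <= A n - (if n == 1%N then 0 else A n.-1).
Proof.
have th1 : 0 < 1 - th by move: th_half; lra.
have th0 : 0 < th by rewrite /th; move: al01; lra.
apply: (@le_trans _ _ (th / (1 - th) * a n)).
  rewrite -mulrA ler_pM2l// mulrC ler_pdivlMr//; apply: le_trans a_last_K.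
  have : 0 <= K * (1 - th) by pos.
  by lra.
have a0 : 0 <= a n by apply: le_trans a_last_K; pos.
have Aa := A_coef_last_ge mesh al01 nN; rewrite -/A -/a in Aa.
case: eqP => [_|n_1].
  rewrite subr0; apply: le_trans Aa; rewrite ler_piMl// ler_pdivrMr//.
  by move: th_half; lra.
have nn := pred_bounds n1 n_1.
have := A_coef_le mesh al01 nN nn; rewrite (omega_last mesh al01 nN) -/th -/a -/A => H.
have <- : a n - (1 - al) / (1 - th) * a n = th / (1 - th) * a n.
  by rewrite /th in th1 *; field; rewrite gt_eqF//; move: th1; lra.
lra.
Qed.

End Gap.

(** Summation by parts: the weights increase and [z] is nonpositive before level n, so the levels
    below n-1 contribute nonnegative terms and are dropped. Level n-1 is kept, with the gap as its
    coefficient; at n = 1 there is no earlier weight and the gap is the whole of A_1. *)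
Lemma D_tau_ge (z : nat -> R) : (forall k, (k < n)%N -> z k <= 0) ->
  A n * z n - (A n - (if n == 1%N then 0 else A n.-1)) * z n.-1 <= D_tau t al th z n.
Proof.
move=> z0; rewrite /D_tau -/A.
have S j : (1 <= j < n)%N -> A j * z j <= \sum_(1 <= k < j.+1) A k * (z k - z k.-1).
  elim: j => // j IH jn; rewrite big_nat_recr//=.
  case: j => [|j] in IH jn *.
    rewrite big_geq// add0r mulrBr lerBrDr gerDl mulr_ge0_le0 ?z0//.
    by rewrite ltW// A_coef_gt0// ltnW.
  have {}IH := IH ltac:(lia).
  apply: (@le_trans _ _ (A j.+1 * z j.+1 + A j.+2 * (z j.+2 - z j.+1))); last by rewrite lerD2r.
  have : (A j.+2 - A j.+1) * z j.+1 <= 0.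
    by rewrite mulr_ge0_le0 ?subr_ge0 ?A_coef_nd ?z0//; lia.
  lra.
rewrite big_nat_recr//=.
case: eqP => [n_1|n_1].
  by rewrite n_1 big_geq//= subr0 add0r mulrBr.
have := S n.-1 ltac:(lia); rewrite prednK//; lra.
Qed.

Lemma D_tauB (u v : nat -> R) :
  D_tau t al th (fun k => u k - v k) n = D_tau t al th u n - D_tau t al th v n.
Proof. by rewrite /D_tau -sumrB; apply: eq_bigr => k _; ring. Qed.

Lemma D_tauZ (c : R) (u : nat -> R) :
  D_tau t al th (fun k => c * u k) n = c * D_tau t al th u n.
Proof. by rewrite /D_tau mulr_sumr; apply: eq_bigr => k _; ring. Qed.

Lemma D_tauD (u v : nat -> R) :
  D_tau t al th (fun k => u k + v k) n = D_tau t al th u n + D_tau t al th v n.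
Proof. by rewrite /D_tau -big_split; apply: eq_bigr => k _; rewrite /=; ring. Qed.

(** Before the last cell A_k >= a_k / 2, and concavity moves the base point from t_(n-theta) to t_n;
    on the last cell the loss is (1 - theta)^(1 - al) >= 1/2. *)
Lemma A_coef_step_ge k : (1 <= k <= n)%N ->
  2^-1 * (omega_prim al (t n - t k.-1) - omega_prim al (t n - t k)) <= A k * step t k.
Proof.
move=> /andP[k1]; rewrite leq_eqVlt => /predU1P[->|kn].
  apply: (@le_trans _ _ (a n * step t n)); last first.
    by rewrite ler_pM2r// (A_coef_last_ge mesh al01 nN).
  rewrite subrr omega_prim0// subr0 /a (a_coef_lastE mesh al01 nN) -/th -/(step t n).
  rewrite /omega_prim powRM ?(ltW step_n_gt0)//; last by move: th_half; lra.
  rewrite -!mulrA ler_pM2r; last by have := Gamma2B_gt0 al01 => ?; pos.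
  exact: powR1B_ge_half.
have k1n : (1 <= k < n)%N by rewrite k1.
have sk : 0 < step t k by apply: (mesh_step_gt0 mesh); lia.
apply: (@le_trans _ _ (2^-1 * (a k * step t k))).
  rewrite ler_pM2l// /a (a_coef_primE mesh al01 nN k1n) -/sg.
  have tk := t_theta_gt mesh al01 nN kn; have tn := t_theta_lt mesh al01 nN.
  have := @omega_prim_incr R al al01 (sg - t k) (t n - t k) (step t k).
  rewrite (_ : t n - t k + step t k = t n - t k.-1); last by rewrite /step; ring.
  rewrite (_ : sg - t k + step t k = sg - t k.-1); last by rewrite /step; ring.
  by apply; rewrite ?subr_gt0// ?lerB// ltW.
rewrite mulrA ler_pM2r//; have := A_coef_ge mesh al01 nN k1n.
have := @omega_s_ge0 R al al01 sg (t k.-1); rewrite -/a -/A; lra.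
Qed.

(** A discrete stand-in for integrating the kernel over [t_j, t_n], by telescoping. Every lower
    bound for a barrier with controlled slope rests on it. *)
Lemma A_coef_window j : (j <= n)%N ->
  2^-1 * omega_prim al (t n - t j) <= \sum_(j.+1 <= k < n.+1) A k * step t k.
Proof.
move=> jn.
have -> : omega_prim al (t n - t j) =
    \sum_(j.+1 <= k < n.+1) (omega_prim al (t n - t k.-1) - omega_prim al (t n - t k)).
  have T := telescope_sumr (fun k => omega_prim al (t n - t k)) jn.
  rewrite subrr omega_prim0// sub0r in T; apply: oppr_inj; rewrite -T big_add1/= -sumrN.
  by apply: eq_bigr => k _; rewrite opprB.
rewrite mulr_sumr big_nat_cond [leRHS]big_nat_cond; apply: ler_sum => k.
by rewrite andbT => /andP[k1 k2]; apply: A_coef_step_ge; lia.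
Qed.

Lemma A_coef1_ge : 2^-1 * omega (1 - al) (t n) <= A 1%N.
Proof.
have [n_1|n_1] := eqVneq n 1%N.
  have -> : A 1%N = a n by rewrite /A /a /A_coef n_1.
  apply: le_trans a_coef_last_ge.
  have -> : step t n = t n by rewrite /step n_1/= (mesh0 mesh) subr0.
  rewrite omegaE// -mulrA ler_pM2l//.
  apply: ler_wpM2l; first exact: powR_ge0.
  have G1 := Gamma1B_gt0 al01.
  rewrite (Gamma2BE al01) invfM ler_peMl ?invr_ge0 ?(ltW G1)// invf_ge1 ?subr_gt0//; move: al01; lra.
have n2 : (1 <= 1 < n)%N by lia.
apply: le_trans (A_coef_ge mesh al01 nN n2).
have := a_coef_ge mesh al01 nN n2; rewrite /= (mesh0 mesh).
have : omega (1 - al) (t n) <= omega_s al sg 0.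
  apply: le_omega => //; rewrite subr0; last by rewrite ltW// (t_theta_lt mesh al01 nN).
  by rewrite -(mesh0 mesh) (t_theta_gt mesh al01 nN).
have := @omega_s_ge0 R al al01 sg 0; rewrite -/sg; lra.
Qed.

End DiscreteDerivative.

(** * Discrete comparison principle *)

Section Grid.
Context {R : realType}.
Variable M : nat.
Hypothesis M0 : (0 < M)%N.

Lemma Vh_addMz (v : gridfun) (i j : int) (p q : nat) : @Vh R M v ->
  v (i + (p * M)%:Z) (j + (q * M)%:Z) = v i j.
Proof.
move=> vM; have H1 i' j' : v (i' + (p * M)%:Z) j' = v i' j'.
  elim: p i' j' => [|p IH] i' j'; first by rewrite mul0n addr0.
  by rewrite mulSn PoszD addrA IH (vM i' j').1.
have H2 i' j' : v i' (j' + (q * M)%:Z) = v i' j'.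
  elim: q i' j' => [|q IH] i' j'; first by rewrite mul0n addr0.
  by rewrite mulSn PoszD addrA IH (vM i' j').2.
by rewrite H1 H2.
Qed.

(** Periodicity is available for shifts by natural multiples of M, so multiples are added on both
    sides to treat negative indices as well. *)
Let rep (i : int) : exists (k : 'I_M) (p q : nat), i + (p * M)%:Z = (k : nat)%:Z + (q * M)%:Z.
Proof.
have MZ : (M%:Z != 0)%R by rewrite eqz_nat -lt0n.
have lt : (`|(i %% M%:Z)%Z| < M)%N.
  by rewrite -ltz_nat gez0_abs ?modz_ge0// ltz_mod.
exists (Ordinal lt) => /=.
have /= E := divz_eq i M%:Z; rewrite gez0_abs ?modz_ge0//.
case: (lerP 0 (i %/ M%:Z)%Z) => q0.
  by exists 0%N, `|(i %/ M%:Z)%Z|%N; rewrite mul0n addr0 PoszM gez0_abs// addrC -E.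
exists `|(i %/ M%:Z)%Z|%N, 0%N; rewrite mul0n addr0 PoszM ltz0_abs// {1}E; ring.
Qed.

Lemma Vh_ord (v : gridfun) (i j : int) : @Vh R M v ->
  exists k l : 'I_M, v i j = v (k : nat)%:Z (l : nat)%:Z.
Proof.
move=> vM; have [k [p [q E]]] := rep i; have [l [p' [q' E']]] := rep j.
by exists k, l; rewrite -(Vh_addMz i j p p' vM) E E' Vh_addMz.
Qed.

Lemma Vh_max (v : gridfun) : @Vh R M v -> exists i0 j0, forall i j, v i j <= v i0 j0.
Proof.
move=> vM; pose o : 'I_M := Ordinal M0.
pose k := [arg max_(k > (o, o)) v ((k.1 : 'I_M) : nat)%:Z ((k.2 : 'I_M) : nat)%:Z]%O.
exists (k.1 : nat)%:Z, (k.2 : nat)%:Z => i j.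
have [p [q ->]] := Vh_ord i j vM; rewrite /k.
by case: arg_maxP => //= m _ /(_ (p, q) isT).
Qed.

Lemma grid_norm_le (v : gridfun) (c : R) : 0 <= c ->
  (forall i j, `|v i j| <= c) -> grid_norm M v <= c.
Proof.
move=> c0 vc; rewrite /grid_norm; elim/big_rec: _ => // i x _ xc.
rewrite ge_max xc andbT; elim/big_rec: _ => // j y _ yc.
by rewrite ge_max yc andbT.
Qed.

Variables (t : nat -> R) (N : nat) (G al : R).
Hypothesis mesh : regular_mesh t N G.
Hypothesis al01 : 0 < al < 1.
Let th := al / 2.
Variables (h eps kappa : R).
Hypothesis h0 : 0 < h.
Hypothesis kappa0 : 0 <= kappa.

(** Suppose w^n exceeds B^n at a grid maximum. There the implicit part of the Laplacian is
    nonpositive and the implicit stabilization has the good sign. As B is constant in space, the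
    explicit parts are at most -theta (4 eps^2 / h^2 + kappa) z^(n-1) with z = w - B, and
    [A_coef_gap] absorbs them. What remains is A_n z^n <= 0, a contradiction. *)
Lemma comparison_step (n : nat) (w : nat -> gridfun) (B : nat -> R) :
  (1 <= n <= N)%N ->
  step t n `^ al *
    (11 * (1 - th) * (4 * eps ^+ 2 / h ^+ 2 + kappa) * Gamma (2 - al)) <= 4 ->
  Vh M (w n) -> (forall k, 0 <= B k) ->
  (forall k, (k < n)%N -> forall i j, w k i j <= B k) ->
  (forall i j, D_tau t al th (fun k => w k i j) n <=
     eps ^+ 2 * lap_h h (phi_bar th w n) i j - kappa * phi_bar th w n i j
     + D_tau t al th B n) ->
  forall i j, w n i j <= B n.
Proof.
move=> nN cfl wM B0 wB Dw.
have [i0 [j0 wmax]] := Vh_max wM.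
suff H : w n i0 j0 <= B n by move=> i j; exact: le_trans H.
rewrite leNgt; apply/negP => wBn.
pose z k := w k i0 j0 - B k.
have zn : 0 < z n by rewrite subr_gt0.
have n1 : (n.-1 < n)%N by rewrite prednK//; case/andP: nN.
have z0 k : (k < n)%N -> z k <= 0 by move=> kn; rewrite subr_le0 wB.
have eh0 : 0 <= eps ^+ 2 / h ^+ 2 by rewrite divr_ge0 ?sqr_ge0.
have K0 : 0 <= 4 * eps ^+ 2 / h ^+ 2 + kappa.
  by rewrite -mulrA addr_ge0// mulr_ge0.
have := D_tau_ge mesh al01 nN z0.
have gap := A_coef_gap mesh al01 nN K0 cfl.
rewrite /z D_tauB -/(z n) -/(z n.-1); set An := A_coef _ _ _ _ _; set Ap := if _ then _ else _.
have An0 : 0 < An by apply: (A_coef_gt0 mesh al01 nN); case/andP: nN => -> _; rewrite leqnn.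
rewrite -/An -/Ap -/th in gap.
have := Dw i0 j0.
set D := D_tau _ _ _ _ _; set D' := D_tau _ _ _ B _ => H1 H2.
have {H1 H2} H : An * z n - (An - Ap) * z n.-1 <=
  eps ^+ 2 * lap_h h (phi_bar th w n) i0 j0 - kappa * phi_bar th w n i0 j0 by lra.
have th01 : 0 <= th <= 1 by rewrite /th; move: al01; lra.
have lap : eps ^+ 2 * lap_h h (phi_bar th w n) i0 j0 <= - (th * (4 * eps ^+ 2 / h ^+ 2) * z n.-1).
  rewrite /lap_h [leRHS](_ : _ = eps ^+ 2 * (h ^- 2 * (th * (- 4 * z n.-1)))); last by ring.
  apply: ler_wpM2l; first exact: sqr_ge0.
  apply: ler_wpM2l; first by rewrite invr_ge0 sqr_ge0.
  rewrite /phi_bar.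
  have a1 := wmax (i0 + 1) j0; have a2 := wmax (i0 - 1) j0.
  have a3 := wmax i0 (j0 + 1); have a4 := wmax i0 (j0 - 1).
  have b1 := wB _ n1 (i0 + 1) j0; have b2 := wB _ n1 (i0 - 1) j0.
  have b3 := wB _ n1 i0 (j0 + 1); have b4 := wB _ n1 i0 (j0 - 1).
  have th0 : 0 <= th by case/andP: th01.
  have th1 : 0 <= 1 - th by rewrite subr_ge0; case/andP: th01.
  have := ler_wpM2l th0 b1; have := ler_wpM2l th0 b2.
  have := ler_wpM2l th0 b3; have := ler_wpM2l th0 b4.
  have := ler_wpM2l th1 a1; have := ler_wpM2l th1 a2.
  have := ler_wpM2l th1 a3; have := ler_wpM2l th1 a4.
  by rewrite /z; lra.
have kap : - (kappa * phi_bar th w n i0 j0) <= - (kappa * th * z n.-1).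
  rewrite lerN2 -mulrA ler_wpM2l// /phi_bar.
  have : 0 <= (1 - th) * w n i0 j0.
    by rewrite mulr_ge0 ?subr_ge0; [|case/andP: th01|rewrite (le_trans (B0 n))// ltW].
  have : 0 <= th * B n.-1 by rewrite mulr_ge0//; case/andP: th01.
  by rewrite /z; lra.
have P : 0 < An * z n by rewrite mulr_gt0.
have : (An - Ap - th * (4 * eps ^+ 2 / h ^+ 2 + kappa)) * z n.-1 <= 0.
  by rewrite mulr_ge0_le0 ?subr_ge0 ?z0.
lra.
Qed.

End Grid.

(** * Barriers *)

Section PowerInequalities.
Context {R : realType}.

Lemma powRD_gt0 (x r s : R) : 0 < x -> x `^ (r + s) = x `^ r * x `^ s.
Proof. by move=> x0; rewrite powRD// (gt_eqF x0) implybT. Qed.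

Lemma powR_invl (a x : R) : 0 <= x -> x^-1 `^ a = x `^ (- a).
Proof. by move=> x0; rewrite -powR_inv1// -powRrM mulN1r. Qed.

(** Multiply by n and use n^(al-1) >= 1 - (1 - al) ln n with ln n <= n. The two terms on the right
    are what the first and the last jump of the harmonic barrier provide, neither being enough alone
    for all al and n. *)
Lemma powR_add_nat_ge (al : R) (n : nat) : 0 < al < 1 -> (1 <= n)%N ->
  n%:R^-1 <= (1 - al) + n%:R `^ (al - 2).
Proof.
move=> al01 n1; have n0 : 0 < n%:R :> R by rewrite ltr0n.
have -> : (n%:R : R) `^ (al - 2) = n%:R^-1 * n%:R `^ (al - 1).
  by rewrite -(powR_inv1 (ltW n0)) -powRD_gt0//; congr (_ `^ _); ring.
have : 1 + (al - 1) * ln n%:R <= n%:R `^ (al - 1).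
  by rewrite /powR gt_eqF// expR_ge1Dx.
have ln_le : ln n%:R <= n%:R :> R by rewrite ltW// ln_sublinear.
have : 0 <= (1 - al) * (n%:R - ln n%:R).
  by rewrite mulr_ge0 ?subr_ge0//; move: al01; lra.
set P := _ `^ _; set l := ln _ => H1 H2.
rewrite -(ler_pM2l n0) mulfV ?gt_eqF// mulrDr mulrA mulfV ?gt_eqF// mul1r.
lra.
Qed.

Lemma powR_sub_ge (al x y : R) : 0 < al < 1 -> 0 <= x -> x <= y ->
  al * y `^ (al - 1) * (y - x) <= y `^ al - x `^ al.
Proof.
move=> al01; have [al0 al1] := andP al01; rewrite le_eqVlt => /predU1P[<- y0|x0 xy].
  rewrite powR0 ?gt_eqF// !subr0 -mulrA [_ * y]mulrC mulr_powRB1//.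
  by rewrite ler_piMl ?powR_ge0// ltW.
have D s : s \in `[x, y] -> is_derive s 1 (fun s : R => s `^ al) (al * s `^ (al - 1)).
  by rewrite in_itv/= => /andP[xs _]; apply: is_derive1_powR; exact: lt_le_trans xs.
have [c cI ->] := MVT_segment xy (fun s sI => D s (subset_itv_oo_cc sI))
  (is_derive_within_continuous D).
rewrite ler_wpM2r ?subr_ge0// ler_wpM2l ?(ltW al0)//.
move: cI; rewrite in_itv/= => /andP[xc cy].
rewrite -opprB !powRN lef_pV2 ?posrE ?powR_gt0 ?(lt_le_trans x0)//.
by apply: le_powRl => //; rewrite ?subr_ge0 ltW// (lt_le_trans x0).
Qed.

Lemma powR_le1D (al x : R) : 0 < al < 1 -> 0 <= x -> x `^ al <= 1 + x.
Proof.
move=> /andP[al0 al1] x0; have [x1|x1] := leP 1 x.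
  by apply: (@le_trans _ _ x); [rewrite ler1_powR// ltW|rewrite lerDr].
apply: (@le_trans _ _ 1); last by rewrite lerDl.
have <- : (1 : R) `^ al = 1 by rewrite powR1.
by apply: le_powRl => //; exact: ltW.
Qed.

End PowerInequalities.

Lemma inv_nat_diff (R : realType) (m : nat) :
  2 - m.+2%:R^-1 - (2 - m.+1%:R^-1) = m.+2%:R^-1 * m.+1%:R^-1 :> R.
Proof.
have : (0 : R) < m.+1%:R by [].
rewrite -(natr1 m.+1); move: (m.+1%:R) => x x0; field.
by rewrite !gt_eqF// addr_gt0.
Qed.

Lemma tail_bounds (j k n : nat) : (j < k <= n)%N -> (1 <= k <= n)%N.
Proof. lia. Qed.

Lemma tail_node_bounds (j k n N : nat) :
  (j < k <= n)%N -> (1 <= n <= N)%N -> (j <= k.-1 <= N)%N.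
Proof. lia. Qed.

Lemma pred_lt (j n : nat) : (j < n.-1)%N -> (j.+1 < n)%N.
Proof. lia. Qed.

Lemma pred_eq (j n : nat) : (j < n)%N -> (n.-1 <= j)%N -> j = n.-1.
Proof. lia. Qed.

Lemma pred_leN (n N : nat) : (1 <= n <= N)%N -> (n.-1 <= N)%N.
Proof. lia. Qed.

Lemma inner_bounds (k n : nat) : (2 <= k < n)%N -> (1 <= k <= n)%N.
Proof. lia. Qed.

Section Increments.
Context {R : realType}.
Variables (t : nat -> R) (N : nat) (G al : R).
Hypothesis mesh : regular_mesh t N G.
Hypothesis al01 : 0 < al < 1.
Let th := al / 2.
Variable n : nat.
Hypothesis nN : (1 <= n <= N)%N.

Let A := A_coef t al th n.
Let D B := D_tau t al th B n.

Let n1 : (1 <= n)%N. Proof. by case/andP: nN. Qed.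
Let al_gt0 : 0 < al. Proof. by case/andP: al01. Qed.
Let step_n_gt0 : 0 < step t n. Proof. exact: (mesh_step_gt0 mesh). Qed.
Let t_n_gt0 : 0 < t n. Proof. exact: (node_gt0 mesh). Qed.

Lemma D_tau_ge_tail (B : nat -> R) (j : nat) : (j <= n)%N ->
  (forall k, (1 <= k <= n)%N -> B k.-1 <= B k) ->
  \sum_(j.+1 <= k < n.+1) A k * (B k - B k.-1) <= D B.
Proof.
move=> jn Bnd; rewrite /D /D_tau [leRHS](@big_cat_nat _ _ _ j.+1)//= lerDr.
rewrite big_nat_cond; apply: sumr_ge0 => k; rewrite andbT => kj.
rewrite mulr_ge0 ?subr_ge0 ?Bnd//; last by lia.
by rewrite ltW// (A_coef_gt0 mesh al01 nN)//; lia.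
Qed.

Lemma D_tau_ge_slope (B : nat -> R) (j : nat) (c : R) : (j <= n)%N ->
  (forall k, (1 <= k <= n)%N -> B k.-1 <= B k) -> 0 <= c ->
  (forall k, (j < k <= n)%N -> c * step t k <= B k - B k.-1) ->
  c * (2^-1 * omega_prim al (t n - t j)) <= D B.
Proof.
move=> jn Bnd c0 Bc; apply: le_trans (D_tau_ge_tail jn Bnd).
apply: le_trans (ler_wpM2l c0 (A_coef_window mesh al01 nN jn)) _.
rewrite mulr_sumr big_nat_cond [leRHS]big_nat_cond; apply: ler_sum => k.
rewrite andbT => kj; rewrite mulrCA; apply: ler_wpM2l; last by apply: Bc; lia.
by rewrite ltW// (A_coef_gt0 mesh al01 nN)//; lia.
Qed.

Let node_nd k : (1 <= k <= n)%N -> t k.-1 <= t k.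
Proof. by move=> kn; apply: (node_le mesh); lia. Qed.

Let node0 k : (k <= n)%N -> 0 <= t k.
Proof. by move=> kn; apply: (node_ge0 mesh); lia. Qed.

(** The slope of t^al on [0, t_n] is at least al t_n^(al-1), while the full window contributes
    t_n^(1-al) / (2 Gamma (2 - al)). The powers cancel and leave a constant, with Gamma (2 - al) <=
    2. *)
Lemma D_tau_power : al / 4 <= D (fun k => t k `^ al).
Proof.
have G0 := Gamma2B_gt0 al01; have /andP[_ G2] := Gamma2B_bounds al01.
have -> : al / 4 = al * t n `^ (al - 1) * (2^-1 * (t n `^ (1 - al) / 2)).
  rewrite -opprB powRN; field; rewrite gt_eqF// powR_gt0//.
apply: (@le_trans _ _ (al * t n `^ (al - 1) * (2^-1 * omega_prim al (t n - t 0%N)))).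
  apply: ler_wpM2l; first by pos.
  rewrite ler_pM2l// (mesh0 mesh) subr0 /omega_prim ler_wpM2l ?powR_ge0//.
  by rewrite lef_pV2 ?posrE.
apply: D_tau_ge_slope => //; last first.
- move=> k kn; have k1 : (1 <= k <= n)%N by lia.
  apply: le_trans (powR_sub_ge al01 _ (node_nd k1)); last by apply: node0; lia.
  have sk : 0 < step t k by apply: (mesh_step_gt0 mesh); lia.
  rewrite ler_pM2r// ler_pM2l// -opprB !powRN.
  have tk : 0 < t k by apply: (node_gt0 mesh); lia.
  rewrite lef_pV2 ?posrE ?powR_gt0//; apply: le_powRl; rewrite ?(ltW tk)//.
    by rewrite subr_ge0; move: al01; lra.
  by apply: (node_le mesh); lia.
- by pos.
- move=> k kn; apply: le_powRl; [exact: ltW|by apply: node0; lia|exact: node_nd].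
Qed.

(** A jump of 1 at the first level, then jumps 1 / (k (k-1)), with finite total. Level 0 is treated
    apart since the inverse of 0 is 0 and would give the value 2. *)
Definition harmonic_barrier (k : nat) : R := if k == 0%N then 0 else 2 - k%:R^-1.

Lemma harmonic_barrier_nd k : harmonic_barrier k.-1 <= harmonic_barrier k.
Proof.
case: k => [|[|k]]//=; rewrite /harmonic_barrier/=; first by lra.
by rewrite lerD2l lerN2 lef_pV2 ?posrE// ler_nat.
Qed.

Lemma harmonic_barrier_bounds k : 0 <= harmonic_barrier k <= 2.
Proof.
case: k => [|k]; rewrite /harmonic_barrier/=; first by lra.
have i0 : (0 : R) < k.+1%:R^-1 by rewrite invr_gt0.
have i1 : k.+1%:R^-1 <= 1 :> R by rewrite invf_le1 ?ler1n.
by move: (k.+1%:R^-1) i0 i1 => x *; apply/andP; split; lra.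
Qed.

(** Only the first and the last increment are kept. The first gives omega_(1-al)(t_n) / 2. As tau_n
    <= G t_n / n, the last weight is of order n^al t_n^(-al), and its jump 1 / n^2 leaves n^(al-2)
    t_n^(-al). [powR_add_nat_ge] combines both into t_n^(-al) / n. *)
Lemma D_tau_harmonic : (8 * G)^-1 * (omega (1 - al) (t n) + t n `^ (- al) / n%:R)
  <= D harmonic_barrier.
Proof.
have G1 := mesh_ge1 mesh; have [al0 al1] := andP al01.
have Gam0 := Gamma2B_gt0 al01; have /andP[_ Gam2] := Gamma2B_bounds al01.
have A1 : 2^-1 * omega (1 - al) (t n) <= A 1%N := A_coef1_ge mesh al01 nN.
have w0 : 0 <= omega (1 - al) (t n) by exact: omega_ge0.
have G8 : 0 < 8 * G by lra.
have n0 : 0 < n%:R :> R by rewrite ltr0n.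
have p0 : 0 < t n `^ (- al) by pos.
have An : (2 * G)^-1 * n%:R `^ al * t n `^ (- al) / Gamma (2 - al) <= A n.
  apply: le_trans (A_coef_last_ge mesh al01 nN).
  apply: le_trans (a_coef_last_ge mesh al01 nN).
  rewrite ler_pM2r ?invr_gt0// invfM -!mulrA ler_pM2l//.
  have sle := mesh_step_le mesh nN.
  apply: (@le_trans _ _ ((G * t n / n%:R) `^ (- al))); last exact: le_powRN.
  have G0 : 0 < G by lra.
  have -> : (G * t n / n%:R) `^ (- al) = G `^ (- al) * (n%:R `^ al * t n `^ (- al)).
    rewrite powRM; [|by pos|by pos]; rewrite powRM; [|by pos|by pos].
    rewrite -powR_inv1; last by pos.
    by rewrite -powRrM mulN1r opprK; ring.
  rewrite ler_pM2r; last by pos.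
  by rewrite powRN lef_pV2 ?posrE ?powR_gt0// ler1_powR// ltW.
have wE : omega (1 - al) (t n) = (1 - al) * (t n `^ (- al) / Gamma (2 - al)).
  rewrite omegaE Gamma2BE//; have := Gamma1B_gt0 al01 => Gm.
  by field; rewrite !gt_eqF// subr_gt0.
set p := t n `^ (- al) in p0 An wE *.
have pG : p / 2 <= p / Gamma (2 - al) by rewrite ler_pM2l// lef_pV2 ?posrE.
rewrite -(ler_pM2l G8) mulrA mulfV ?gt_eqF// mul1r.
have D1 := D_tau_ge_tail (leq0n n) (fun k _ => harmonic_barrier_nd k).
have [n_1|n_1] := eqVneq n 1%N.
  apply: le_trans (ler_wpM2l (ltW G8) D1).
  rewrite [in leRHS]n_1 big_nat1 /harmonic_barrier/= subr0 invr1 n_1.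
  have := An; rewrite n_1 powR1 mulr1 => An'.
  have : (2 * G)^-1 * (p / 2) <= A 1%N.
    apply: le_trans An'; rewrite -mulrA ler_pM2l// invr_gt0; lra.
  rewrite -ler_pdivlMl ?invr_gt0; last by lra.
  rewrite invrK => ?.
  have : 8 * A 1%N <= 8 * G * A 1%N by rewrite ler_pM2r ?(A_coef_gt0 mesh al01 nN)//; lra.
  rewrite n_1 in A1 w0 *; lra.
have n2 : (1 < n)%N by rewrite ltn_neqAle eq_sym n_1 n1.
have D2 : A 1%N + A n * (n%:R^-1 * n%:R^-1) <= D harmonic_barrier.
  apply: le_trans D1; rewrite big_ltn//.
  rewrite {1}/harmonic_barrier/= subr0 invr1 (_ : 2 - 1 = 1 :> R); last by ring.
  rewrite mulr1 lerD2l big_nat_recr //=.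
  apply: (@le_trans _ _ (A n * (harmonic_barrier n - harmonic_barrier n.-1))).
    rewrite ler_wpM2l ?(ltW (A_coef_gt0 mesh al01 nN _))//; first by rewrite n1 leqnn.
    have -> : n = n.-2.+2 by case: (n) n2 => [|[|]].
    rewrite /harmonic_barrier/=; set m := n.-2.
    rewrite inv_nat_diff.
    by rewrite ler_wpM2l ?invr_ge0// lef_pV2 ?posrE// ler_nat.
  rewrite lerDr big_nat_cond; apply: sumr_ge0 => k; rewrite andbT => kj.
  rewrite mulr_ge0 ?subr_ge0 ?harmonic_barrier_nd// ltW// (A_coef_gt0 mesh al01 nN)//.
  exact: inner_bounds.
apply: le_trans (ler_wpM2l (ltW G8) D2).
have H := powR_add_nat_ge al01 n1.
have nal : (n%:R : R) `^ (al - 2) = n%:R `^ al * (n%:R^-1 * n%:R^-1).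
  by rewrite powRD_gt0//; congr (_ * _); rewrite -invfM -expr2 -powR_invn ?ltW.
set q := p / Gamma (2 - al) in pG wE An *.
have q0 : 0 <= q by apply: le_trans pG; pos.
have E1 : 4 * (1 - al) * q <= 8 * G * A 1%N.
  have : 8 * A 1%N <= 8 * G * A 1%N.
    by rewrite ler_pM2r ?(A_coef_gt0 mesh al01 nN)//; lra.
  move: A1; rewrite wE; lra.
have E2 : 4 * n%:R `^ (al - 2) * q <= 8 * G * (A n * (n%:R^-1 * n%:R^-1)).
  rewrite nal -(ler_pdivrMl _ _ G8); apply: le_trans (ler_wpM2r _ An); last by pos.
  rewrite /q le_eqVlt; apply/orP; left; apply/eqP; field.
  by rewrite !gt_eqF//; lra.
have E3 : n%:R^-1 * q <= ((1 - al) + n%:R `^ (al - 2)) * q by rewrite ler_wpM2r.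
have n0' : 0 < n%:R^-1 :> R by rewrite invr_gt0.
have E4 : n%:R^-1 * (p / 2) <= n%:R^-1 * q by rewrite ler_pM2l.
have E5 : 0 <= n%:R `^ (al - 2) * q by pos.
have E6 : p / n%:R = n%:R^-1 * p by rewrite mulrC.
have E7 : 0 <= n%:R^-1 * p by rewrite mulr_ge0// ltW.
rewrite mulrDr wE E6.
rewrite mulrDl in E3; lra.
Qed.

(** A window of length about 1/la below t_n produces la times omega_(2-al)(1/la), that is la^al /
    Gamma (2 - al). Comparing with the exponential at level n-1 rather than n keeps the bound valid
    however large la tau_n is. *)
Lemma D_tau_exp (la : R) : 1 <= la -> 1 <= la * t n ->
  expR (- 2) / 4 * la `^ al * expR (la * t n.-1) <= D (fun k => expR (la * t k)).
Proof.
move=> la1 lat; have la0 : 0 < la by lra.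
pose P j := (j < n)%N && (1 <= la * (t n - t j)).
have exP : exists j, P j by exists 0%N; rewrite /P n1 (mesh0 mesh) subr0.
have boundP j : P j -> (j <= n)%N by move=> /andP[/ltnW].
(* The latest node at distance at least 1/la from t_n. Either j = n-1, or t_(j+1) is closer than
   1/la and the step j+1 is no longer than the last one; so t_j is within 2/la of t_(n-1), which
   explains the factor e^(-2). *)
have [j /andP[jn jt] jmax] := ex_maxnP exP boundP.
have Pj1 : (j < n.-1)%N -> la * (t n - t j.+1) < 1.
  move=> jn1; rewrite ltNge; apply/negP => H.
  by have := jmax j.+1; rewrite /P H andbT => /(_ (pred_lt jn1)); rewrite ltnn.
have Ej : expR (- 2) * expR (la * t n.-1) <= expR (la * t j).
  rewrite -expRD ler_expR.
  have [jn1|] := ltnP j n.-1; last by move=> nj; rewrite (pred_eq jn nj); lra.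
  have H1 := Pj1 jn1.
  have s1 : step t j.+1 <= step t n by apply: (step_le mesh) => //; case/andP: nN.
  have s2 : t j.+1 <= t n.-1 by apply: (node_le mesh); rewrite jn1 (pred_leN nN).
  have s3 : 0 <= la * (t n - t j.+1 - step t j.+1).
    by apply: mulr_ge0; [exact: ltW|move: s1 s2; rewrite /step/=; lra].
  have s4 : 0 < la * step t n by pos.
  move: s3 s4 H1; rewrite /step/=; lra.
have Gam0 := Gamma2B_gt0 al01; have /andP[_ Gam2] := Gamma2B_bounds al01.
have laE : la * omega_prim al la^-1 = la `^ al / Gamma (2 - al).
  rewrite /omega_prim mulrA -powR_inv1 ?ltW// -powRrM -{1}(powRr1 (ltW la0)) -powRD_gt0//.
  by congr (_ `^ _ / _); ring.
apply: (@le_trans _ _ (la * expR (la * t j) * (2^-1 * omega_prim al (t n - t j)))).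
  apply: (@le_trans _ _ (expR (la * t j) / 2 * (la * omega_prim al la^-1))).
    rewrite laE [leRHS]mulrA [leLHS](_ : _ = expR (- 2) * expR (la * t n.-1) * (la `^ al / 2 / 2)); last by field.
    rewrite [leRHS](_ : _ = expR (la * t j) * (la `^ al / 2 / Gamma (2 - al))); last by field; rewrite gt_eqF.
    apply: ler_pM => //; try pos.
    by rewrite ler_pM2l; [rewrite lef_pV2 ?posrE|pos].
  rewrite [leRHS](_ : _ = expR (la * t j) / 2 * (la * omega_prim al (t n - t j))); last by field.
  rewrite ler_pM2l ?ler_pM2l ?divr_gt0 ?expR_gt0//.
  apply: le_omega_prim => //; first by rewrite invr_ge0 ltW.
  by rewrite -(ler_pM2l la0) mulfV ?gt_eqF.
apply: D_tau_ge_slope; first exact: ltnW.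
- by move=> k kn; rewrite ler_expR ler_pM2l// node_nd.
- by pos.
- move=> k kn; have k1 := tail_bounds kn.
  have -> : t k = t k.-1 + step t k by rewrite /step; ring.
  rewrite [la * (t k.-1 + _)]mulrDr expRD.
  have := expR_ge1Dx (la * step t k); have := expR_gt0 (la * t k.-1).
  set e := expR (la * t k.-1) => e0 H.
  have H1 : expR (la * t j) <= e.
    by rewrite ler_expR ler_pM2l//; apply: (node_le mesh); exact: tail_node_bounds kn nN.
  have H2 : 0 <= la * step t k.
    by apply: mulr_ge0; [exact: ltW|rewrite subr_ge0 node_nd].
  have H3 := ler_wpM2l H2 H1.
  have H4 := ler_wpM2l (ltW e0) H.
  move: H3 H4; lra.
Qed.

End Increments.

Section Barrier.
Context {R : realType}.

(** The barrier is X times c1 (2 - 1/n) + c2 (exp (la t) + c t^al). The harmonic part yields the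
    weight; being at most 2, its own feedback is at most 2 K c1, which [c2] pays for. The feedback
    of the rest is produced by the exponential once la t_n >= 1 and by the power before that, when
    the exponential is still at most e. *)
Lemma exists_barrier (a0 T G K : R) : 0 < a0 < 1 -> 0 < T -> 1 <= G -> 0 <= K ->
  exists2 C : R, 0 < C & forall (al : R) (t : nat -> R) (N : nat) (X : R),
    a0 <= al < 1 -> regular_mesh t N G -> t N <= T -> 0 <= X ->
    exists B : nat -> R,
    [/\ forall k, 0 <= B k,
        forall k, (1 <= k <= N)%N -> B k.-1 <= B k,
        forall k, (k <= N)%N -> B k <= C * X &
        forall n, (1 <= n <= N)%N ->
          K * B n.-1 + X + X * (omega (1 - al) (t n) + t n `^ (- al) / n%:R)
            <= D_tau t al (al / 2) B n].
Proof.
move=> /andP[a00 a01] T0 G1 K0.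
(* Then c a0 / 4 = 2 (K e + 1): while la t_n < 1, half of what the power yields pays for K e + 1 and
   the other half for K c t_(n-1)^al. *)
pose c : R := 8 * (K * expR 1 + 1) / a0.
(* The summands ensure in turn la >= 1, K / Q <= a0 / 8 for the early regime, and a sufficient la^al
   for the late one. The exponent 1/a0 in [la] gives la^al >= Q for all al >= a0 at once. *)
pose Q : R := 1 + 8 * K / a0 + 4 * expR 2 * (K * (1 + c * (1 + T)) + 1).
pose la := Q `^ a0^-1.
pose c1 := 8 * G; pose c2 := 1 + 2 * K * c1.
have e1 : 0 < expR 1 :> R by exact: expR_gt0.
have e2 : 0 < expR 2 :> R by exact: expR_gt0.
have c0 : 0 <= c by rewrite /c; pos.
have T1 : 0 <= 1 + T by lra.
have x1 : 0 <= 8 * K / a0 by pos.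
have x2 : 0 <= 4 * expR 2 * (K * (1 + c * (1 + T)) + 1) by pos.
have Q1 : 1 <= Q by rewrite /Q; lra.
have Q0 : 0 < Q by lra.
have a0V : 0 < a0^-1 by rewrite invr_gt0.
have la1 : 1 <= la by rewrite /la -(powRr0 Q) ler_powR// ltW.
have la0 : 0 < la by lra.
have c10 : 0 < c1 by rewrite /c1; lra.
have c20 : 1 <= c2 by rewrite /c2 lerDl; pos.
exists (2 * c1 + c2 * (expR (la * T) + c * (1 + T))) => [|al t N X /andP[a0al al1] mesh tN X0].
  have := expR_gt0 (la * T) => eT; apply: addr_gt0; first by pos.
  by apply: mulr_gt0; [lra|apply: ltr_pwDl => //; pos].
have al01 : 0 < al < 1 by rewrite (lt_le_trans a00 a0al).
have al0 : 0 < al by case/andP: al01.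
have lal : Q <= la `^ al.
  rewrite /la -powRrM -{1}(powRr1 (ltW Q0)) ler_powR//.
  by rewrite mulrC ler_pdivlMr// mul1r.
pose S k := expR (la * t k) + c * t k `^ al.
exists (fun k => X * (c1 * harmonic_barrier k + c2 * S k)).
have node_bounds k : (k <= N)%N -> 0 <= t k <= T.
  move=> kN; rewrite (node_ge0 mesh)//= (le_trans _ tN)//.
  by apply: (node_le mesh); rewrite kN leqnn.
have S_ge0 k : 0 <= S k.
  have := expR_gt0 (la * t k) => h; have := powR_ge0 (t k) al => h'; rewrite /S; pos.
have S_le k : (k <= N)%N -> S k <= expR (la * T) + c * (1 + T).
  move=> /node_bounds/andP[tk0 tkT]; rewrite /S; apply: lerD; first by rewrite ler_expR ler_pM2l.
  apply: ler_wpM2l => //; apply: le_trans (powR_le1D al01 tk0) _; lra.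
split.
- move=> k; have /andP[h0 _] := @harmonic_barrier_bounds R k.
  by have := S_ge0 k => h1; rewrite mulr_ge0// addr_ge0// mulr_ge0//; lra.
- move=> k kN; have tk : t k.-1 <= t k by apply: (node_le mesh); rewrite leq_pred; case/andP: kN.
  have tk0 : 0 <= t k.-1 by apply: (node_ge0 mesh); exact: (pred_leN kN).
  apply: ler_wpM2l => //; apply: lerD; apply: ler_wpM2l; try lra.
    exact: harmonic_barrier_nd.
  rewrite /S; apply: lerD; first by rewrite ler_expR ler_pM2l.
  apply: ler_wpM2l => //.
  by apply: le_powRl => //; exact: ltW.
- move=> k kN; rewrite mulrC; apply: ler_wpM2r => //.
  have /andP[_ h2] := @harmonic_barrier_bounds R k.
  have := S_le _ kN; have := ler_wpM2l (ltW c10) h2 => h3 h4.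
  apply: lerD; first by rewrite [2 * c1]mulrC.
  by apply: ler_wpM2l => //; lra.
move=> n nN; have t_n0 : 0 < t n by exact: (node_gt0 mesh).
have n1N := pred_leN nN.
have /andP[_ tnT] := node_bounds n ltac:(by case/andP: nN).
have /andP[tn10 tn1T] := node_bounds _ n1N.
have tn1n : t n.-1 <= t n.
  by apply: (node_le mesh); rewrite leq_pred; case/andP: nN.
have H1 : omega (1 - al) (t n) + t n `^ (- al) / n%:R <=
    D_tau t al (al / 2) (fun k => c1 * harmonic_barrier k) n.
  rewrite D_tauZ -ler_pdivrMl//; exact: (D_tau_harmonic mesh al01 nN).
have DS : D_tau t al (al / 2) S n =
    D_tau t al (al / 2) (fun k => expR (la * t k)) n
    + c * D_tau t al (al / 2) (fun k => t k `^ al) n.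
  by rewrite -D_tauZ -D_tauD.
have DP := D_tau_power mesh al01 nN.
have DE : 0 <= D_tau t al (al / 2) (fun k => expR (la * t k)) n.
  apply: le_trans (@D_tau_ge_tail _ _ _ _ _ mesh al01 _ nN _ n (leqnn n) _).
    by rewrite big_geq.
  move=> k kn; rewrite ler_expR ler_pM2l//; apply: (node_le mesh); rewrite leq_pred.
  by case/andP: kn => _ /leq_trans; apply; case/andP: nN.
have H2 : K * S n.-1 + 1 <= D_tau t al (al / 2) S n.
  rewrite DS; have [lat|lat] := leP 1 (la * t n).
    have HE := D_tau_exp mesh al01 nN la1 lat.
    have E1 : 1 <= expR (la * t n.-1) by rewrite -[X in X <= _]expR0 ler_expR mulr_ge0// ltW.
    have P1 : t n.-1 `^ al <= 1 + T by apply: le_trans (powR_le1D al01 tn10) _; lra.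
    have cP : 0 <= c * D_tau t al (al / 2) (fun k => t k `^ al) n.
      by apply: mulr_ge0 => //; apply: le_trans DP; lra.
    apply: (@le_trans _ _ (expR (- 2) / 4 * la `^ al * expR (la * t n.-1))); last by lra.
    apply: (@le_trans _ _ ((K * (1 + c * (1 + T)) + 1) * expR (la * t n.-1))).
      rewrite /S; set E := expR _ in E1 *; set P := _ `^ al in P1 *.
      have h1 := ler_wpM2l (mulr_ge0 K0 c0) P1.
      have h2 : K * c * (1 + T) * 1 <= K * c * (1 + T) * E by apply: ler_wpM2l => //; pos.
      lra.
    rewrite ler_pM2r ?expR_gt0//.
    rewrite expRN [leRHS](_ : _ = la `^ al / (4 * expR 2)); last by field; rewrite gt_eqF.
    rewrite ler_pdivlMr; last by pos.
    apply: le_trans lal; rewrite /Q; lra.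
  have tn1 : la * t n.-1 <= 1.
    by apply: le_trans (ltW lat); rewrite ler_pM2l.
  have E1 : expR (la * t n.-1) <= expR 1 by rewrite ler_expR.
  have P1 : t n.-1 `^ al <= Q^-1.
    have [->|tn1p] := eqVneq (t n.-1) 0; first by rewrite powR0 ?gt_eqF// invr_ge0 ltW.
    have tn1p' : 0 < t n.-1 by rewrite lt_neqAle eq_sym tn1p.
    apply: (@le_trans _ _ ((la `^ al)^-1)); last by rewrite lef_pV2 ?posrE// powR_gt0.
    rewrite -powRN; apply: (@le_trans _ _ ((la^-1) `^ al)).
      apply: le_powRl => //; first exact: ltW.
      by rewrite -(ler_pM2l la0) mulfV ?gt_eqF.
    by rewrite (powR_invl _ (ltW la0)).
  have KQ : K * Q^-1 <= a0 / 8.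
    rewrite ler_pdivrMr// -ler_pdivrMl ?divr_gt0// invf_div.
    by rewrite mulrAC /Q; lra.
  have h1 : c * (a0 / 4) <= c * D_tau t al (al / 2) (fun k => t k `^ al) n.
    by apply: ler_wpM2l => //; apply: le_trans DP; lra.
  have h2 : K * S n.-1 <= K * expR 1 + c * (a0 / 8).
    rewrite /S mulrDr; apply: lerD; first exact: ler_wpM2l.
    rewrite mulrCA; apply: ler_wpM2l => //; apply: le_trans KQ; exact: ler_wpM2l.
  have cE : c * a0 = 8 * (K * expR 1 + 1) by rewrite /c divfK// gt_eqF.
  lra.
rewrite D_tauZ D_tauD [D_tau _ _ _ (fun k => c2 * S k) _]D_tauZ.
have /andP[h0 h2] := @harmonic_barrier_bounds R n.-1.
have H3 : K * (c1 * harmonic_barrier n.-1 + c2 * S n.-1) + 1 +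
    (omega (1 - al) (t n) + t n `^ (- al) / n%:R) <=
    D_tau t al (al / 2) (fun k => c1 * harmonic_barrier k) n +
    c2 * D_tau t al (al / 2) S n.
  have h3 := ler_wpM2l (ltW (lt_le_trans ltr01 c20)) H2.
  have h4 := ler_wpM2l (mulr_ge0 K0 (ltW c10)) h2.
  have : c2 = 1 + 2 * K * c1 by [].
  lra.
by have := ler_wpM2l X0 H3; lra.
Qed.

End Barrier.

(** * Temporal regularity and truncation error *)

Section TimeRegularity.
Context {R : realType}.
Notation mu := (@lebesgue_measure R).

Lemma powR_subadditive (al x d : R) : 0 < al < 1 -> 0 <= x -> 0 <= d ->
  (x + d) `^ al - x `^ al <= d `^ al.
Proof.
move=> /andP[al0 al1]; rewrite le_eqVlt => /predU1P[<- _|x0].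
  by rewrite add0r powR0 ?gt_eqF// subr0.
rewrite le_eqVlt => /predU1P[<-|d0]; first by rewrite addr0 subrr powR_ge0.
have xd : 0 < x + d by rewrite addr_gt0.
have H (z : R) : 0 < z -> z <= x + d -> z / (x + d) * (x + d) `^ al <= z `^ al.
  move=> z0 zx; have q : 0 < z / (x + d) <= 1 by rewrite divr_gt0// ler_pdivrMr// mul1r.
  have -> : z `^ al = (z / (x + d)) `^ al * (x + d) `^ al.
    by rewrite -powRM ?divfK ?gt_eqF ?(ltW (proj1 (andP q)))// ltW.
  rewrite ler_pM2r ?powR_gt0//; apply: ger1_powR => //; exact: ltW.
have h1 := H x x0 ltac:(by rewrite lerDl ltW).
have h2 := H d d0 ltac:(by rewrite lerDr ltW).
have : x / (x + d) * (x + d) `^ al + d / (x + d) * (x + d) `^ al = (x + d) `^ al.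
  by rewrite -!mulrDl mulfV ?mul1r// gt_eqF.
lra.
Qed.

(** Derivatives are used on the open interval only, where they are two-sided, and continuity up to
    both ends. It will be applied both to the solution at a point and to its discrete Laplacian. *)
Record time_regular (al T C : R) (v v1 v2 v3 : R -> R) : Prop := TimeRegular {
  tr_cont : {within `[0, T], continuous v};
  tr_d1 : forall s, 0 < s < T -> is_derive s 1 v (v1 s);
  tr_d2 : forall s, 0 < s < T -> is_derive s 1 v1 (v2 s);
  tr_d3 : forall s, 0 < s < T -> is_derive s 1 v2 (v3 s);
  tr_b1 : forall s, 0 < s < T -> `|v1 s| <= C * s `^ (al - 1);
  tr_b2 : forall s, 0 < s < T -> `|v2 s| <= C * s `^ (al - 2);
  tr_b3 : forall s, 0 < s < T -> `|v3 s| <= C * s `^ (al - 3) }.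

Variables (al T C : R) (v v1 v2 v3 : R -> R).
Hypothesis al01 : 0 < al < 1.
Hypothesis T0 : 0 < T.
Hypothesis vr : time_regular al T C v v1 v2 v3.

Let al0 : 0 < al. Proof. by case/andP: al01. Qed.

Lemma time_regular_C_ge0 : 0 <= C.
Proof.
have h : 0 < T / 2 < T by move: T0; lra.
have := le_trans (normr_ge0 _) (tr_b1 vr h).
by rewrite pmulr_lge0// powR_gt0//; case/andP: h.
Qed.

Lemma tr_sub_continuous (x y : R) : 0 <= x -> y <= T -> {within `[x, y], continuous v}.
Proof.
move=> x0 yT; apply: continuous_subspaceW (tr_cont vr) => z /=; rewrite !in_itv/=.
by move=> /andP[xz zy]; rewrite (le_trans x0 xz) (le_trans zy yT).
Qed.

Let oo_T (x y s : R) : 0 <= x -> y <= T -> s \in `]x, y[ -> 0 < s < T.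
Proof.
by move=> x0 yT; rewrite in_itv/= => /andP[xs sy]; rewrite (le_lt_trans x0 xs) (lt_le_trans sy yT).
Qed.

Lemma time_MVT (x y : R) : 0 <= x -> x < y -> y <= T ->
  exists2 c, c \in `]x, y[ & v y - v x = v1 c * (y - x).
Proof.
move=> x0 xy yT; apply: MVT => //; last exact: tr_sub_continuous.
by move=> s /(oo_T x0 yT); exact: (tr_d1 vr).
Qed.

(** The derivative of (C / al) s^al dominates that of v and of -v, the factor [e] choosing the sign,
    so the difference is monotone away from 0. The end x = 0 is reached by continuity of v. *)
Lemma time_holder (x y : R) : 0 <= x -> x <= y -> y <= T ->
  `|v y - v x| <= C / al * (y `^ al - x `^ al).
Proof.
have key (z w : R) : 0 < z -> z <= w -> w <= T -> `|v w - v z| <= C / al * (w `^ al - z `^ al).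
  move=> z0 zw wT.
  have P (e : R) : `|e| <= 1 -> e * (v w - v z) <= C / al * (w `^ al - z `^ al).
    move=> e1; pose f s := C / al * s `^ al - e * v s.
    have [->|zw'] := eqVneq z w; first by rewrite !subrr !mulr0.
    have zw2 : z < w by rewrite lt_neqAle zw'.
    have D s : s \in `]z, w[ -> is_derive s 1 f (C / al * (al * s `^ (al - 1)) - e * v1 s).
      move=> sI; have s0T := oo_T (ltW z0) wT sI.
      have D1 := tr_d1 vr s0T; have D2 := is_derive1_powR al (proj1 (andP s0T)).
      exact: is_deriveB.
    have cf : {within `[z, w], continuous f}.
      apply: within_continuousB.
        apply: within_continuousM; first exact: within_continuous_cst.
        apply: continuous_in_subspaceT => s /[!inE]/=; rewrite in_itv/= => /andP[zs _].
        exact: is_derive_continuous (is_derive1_powR al (lt_le_trans z0 zs)).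
      apply: within_continuousM; first exact: within_continuous_cst.
      exact: tr_sub_continuous (ltW z0) wT.
    have [c cI E] := MVT zw2 D cf.
    have cT := oo_T (ltW z0) wT cI.
    have : 0 <= f w - f z.
      rewrite E mulr_ge0 ?subr_ge0// mulrA divfK ?gt_eqF//.
      apply: le_trans (tr_b1 vr cT); apply: le_trans (ler_norm _) _.
      by rewrite normrM ler_piMl.
    by rewrite /f; lra.
  rewrite ler_norml; apply/andP; split.
    by rewrite lerNl -mulN1r; apply: P; rewrite normrN1.
  by rewrite -[X in X <= _]mul1r; apply: P; rewrite normr1.
move=> x0 xy yT; have [x0'|] := ltP 0 x; first exact: key.
move=> xle; have {}x0 : x = 0 by apply/le_anti; rewrite xle x0.
rewrite x0 in xy *.
rewrite powR0 ?gt_eqF// subr0.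
have [->|y0] := eqVneq y 0.
  by rewrite subrr normr0 mulr_ge0 ?powR_ge0// divr_ge0 ?time_regular_C_ge0 ?(ltW al0).
have y0' : 0 < y by rewrite lt_neqAle eq_sym y0.
have [_ cv0 _] := (continuous_within_itvP _ T0).1 (tr_cont vr).
have cv : `|v y - v z| @[z --> 0^'+] --> `|v y - v 0|.
  by apply: cvg_norm; apply: cvgB => //; exact: cvg_cst.
apply: cvgr_to_le cv _; near=> z.
have z0 : 0 < z by [].
have zy : z <= y by near: z; exact: nbhs_right_le.
apply: le_trans (key z y z0 zy yT) _; apply: ler_wpM2l.
  by rewrite divr_ge0 ?time_regular_C_ge0 ?(ltW al0).
by rewrite gerBl powR_ge0.
Unshelve. all: by end_near. Qed.

Lemma time_holder_le (x y : R) : 0 <= x -> x <= y -> y <= T ->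
  `|v y - v x| <= C / al * (y - x) `^ al.
Proof.
move=> x0 xy yT; apply: le_trans (time_holder x0 xy yT) _; apply: ler_wpM2l.
  by rewrite divr_ge0 ?time_regular_C_ge0 ?(ltW al0).
have := @powR_subadditive al x (y - x) al01 x0; rewrite subr_ge0 => /(_ xy).
by rewrite (_ : x + (y - x) = y)//; ring.
Qed.

Lemma v1_lip (x y c d : R) : 0 < x -> x <= c -> c <= y -> x <= d -> d <= y -> y <= T ->
  c < T -> d < T ->
  `|v1 c - v1 d| <= C * x `^ (al - 2) * (y - x).
Proof.
wlog cd : c d / d <= c => [hw x0 xc cy xd dy yT cT dT|].
  by case: (leP d c) => [|/ltW] dc; [exact: hw|rewrite distrC; exact: hw].
move=> x0 xc cy xd dy yT cT dT.
have D s : s \in `[d, c] -> is_derive s 1 v1 (v2 s).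
  rewrite in_itv/= => /andP[ds sc]; apply: (tr_d2 vr).
  by rewrite (lt_le_trans x0 (le_trans xd ds)) (le_lt_trans sc cT).
have [s sI ->] := MVT_segment cd (fun s sI => D s (subset_itv_oo_cc sI))
  (is_derive_within_continuous D).
move: sI; rewrite in_itv/= => /andP[ds sc].
have s0 : 0 < s by rewrite (lt_le_trans x0 (le_trans xd ds)).
have C0 := time_regular_C_ge0.
have cd0 : 0 <= c - d by rewrite subr_ge0.
rewrite normrM (ger0_norm cd0); apply: ler_pM => //; last by lra.
apply: le_trans (tr_b2 vr _) _; first by rewrite s0 (le_lt_trans sc cT).
apply: ler_wpM2l => //; rewrite -opprB !powRN lef_pV2 ?posrE ?powR_gt0//.
apply: le_powRl; first by move: al01; lra.
  exact: ltW.
exact: le_trans xd ds.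
Qed.

Section Origin.
Variable s0 : R.
Hypothesis s0T : s0 <= T.
Let g := omega_s al s0.
Hypothesis gv1 : mu.-integrable `]0, s0[ (EFin \o (fun s => g s * v1 s)).

Lemma powR_integral (b : R) : 0 < b ->
  mu.-integrable `]0, b[ (EFin \o (fun s => s `^ (al - 1))) /\
  \int[mu]_(s in `]0, b[) s `^ (al - 1) = b `^ al / al.
Proof.
move=> b0.
have p0 (x : R) : x \in `]0, b[ -> 0 < x by rewrite in_itv/= => /andP[].
have D (x : R) : 0 < x -> is_derive x 1 (fun s : R => al^-1 * s `^ al) (x `^ (al - 1)).
  move=> x0; have D1 := is_derive1_powR al x0.
  by apply: is_derive_eq; rewrite /GRing.scale/= mulrA mulVf ?mul1r// gt_eqF.
have [] := @improper_FTC_integrable R (fun s => s `^ (al - 1)) (fun s => al^-1 * s `^ al) 0 b b0.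
- by move=> x /p0; exact: D.
- move=> x /p0 x0; exact: is_derive_continuous (is_derive1_powR (al - 1) x0).
- by move=> x _; exact: powR_ge0.
- by rewrite powR0 ?gt_eqF// mulr0 -[X in _ --> X](mulr0 al^-1); apply: cvgMr; exact: powR_cvg0.
- by apply: cvg_at_left_filter; exact: is_derive_continuous (D _ b0).
by move=> h ->; split=> //; rewrite powR0 ?gt_eqF// mulr0 subr0 mulrC.
Qed.

(** Near 0 the derivative of v is merely integrable, so the kernel is bounded by its supremum and
    the power is integrated. *)
Lemma origin_integral_le (b c : R) : 0 < b -> b <= s0 ->
  (forall s, 0 < s -> s < b -> g s <= c) ->
  `|\int[mu]_(s in `]0, b[) (g s * v1 s)| <= c * (C * (b `^ al / al)).
Proof.
move=> b0 bs gc; have C0 := time_regular_C_ge0.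
have [Ip <-] := powR_integral b0.
have Ig : mu.-integrable `]0, b[ (EFin \o (fun s => g s * v1 s)).
  apply: integrableS gv1 => //; apply: subset_itvl.
  by rewrite bnd_simp.
apply: le_trans (le_normr_Rintegral _ Ig) _ => //.
have Ip' : mu.-integrable `]0, b[ (EFin \o (fun s => C * s `^ (al - 1))).
  by apply: eq_integrable (integrableZl _ C Ip).
rewrite -RintegralZl// -RintegralZl//; apply: le_Rintegral => //.
- exact: integrable_norm Ig.
- by apply: eq_integrable (integrableZl _ c Ip').
move=> s /=; rewrite in_itv/= => /andP[s_gt0 sb].
have sT : 0 < s < T by rewrite s_gt0 (lt_le_trans sb)// (le_trans bs).
rewrite normrM; apply: ler_pM => //; last exact: (tr_b1 vr).
by rewrite ger0_norm ?omega_s_ge0// gc.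
Qed.

End Origin.

End TimeRegularity.

Ltac nlia := repeat match goal with
  | H : is_true (@Order.le _ _ _ _) |- _ => clear H
  | H : is_true (@Order.lt _ _ _ _) |- _ => clear H
  | H : is_true (andb (@Order.lt _ _ _ _) _) |- _ => clear H
  | H : @eq (Real.sort _) _ _ |- _ => clear H
  | H : forall _, _ |- _ => clear H
  end; lia.

(** * Kernel values and weighted sums over the mesh *)

Section MeshSums.
Context {R : realType}.
Variables (t : nat -> R) (N : nat) (G al : R).
Hypothesis mesh : regular_mesh t N G.
Hypothesis al01 : 0 < al < 1.
Let th := al / 2.
Variable n : nat.
Hypothesis nN : (1 <= n <= N)%N.

Let sg := t_theta t th n.
Let g := omega_s al sg.
Let nleN : (n <= N)%N. Proof. by case/andP: nN. Qed.
Let n1 : (1 <= n)%N. Proof. by case/andP: nN. Qed.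
Let t_n_gt0 : 0 < t n. Proof. exact: (node_gt0 mesh). Qed.

Lemma node_sub_ge k l : (1 <= k <= l)%N -> (l <= N)%N ->
  (l - k)%:R * step t k <= t l - t k.
Proof.
move=> /andP[k1]; elim: l => [|l IH]; first by case: k k1.
rewrite leq_eqVlt => /predU1P[<- _|kl lN]; first by rewrite subnn mul0r subrr.
rewrite subSn// -natr1 mulrDl mul1r (stepE t) addrAC; apply: lerD.
  by apply: IH => //; exact: ltnW.
by apply: (step_le mesh) => //; rewrite k1 ltnW.
Qed.

Lemma node_convex k : (k <= n)%N -> n%:R * t k <= k%:R * t n.
Proof.
case: k => [|k] kn; first by rewrite (mesh0 mesh) mulr0 mul0r.
have h1 := @node_sub_ge k.+1 n kn nleN.
have h2 := node_le_step mesh (leqnn k.+1) (leq_trans kn nleN).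
have h3 : 0 <= (n - k.+1)%:R :> R by [].
have h4 : n%:R = (n - k.+1)%:R + k.+1%:R :> R by rewrite -natrD subnK.
have h5 := ler_wpM2l h3 h2.
have h6 := ler_wpM2l (ler0n R k.+1) h1.
rewrite h4 mulrDl; lra.
Qed.

(** Steps that do not decrease make the nodes convex in the index, so t_(n-theta) - t_k is at least
    (n - k) / (2n) times t_n. Estimating q^(-al) by 1/q for q <= 1 removes al from the constant. *)
Lemma omega_node_le k : (k < n)%N ->
  (n - k)%:R * g (t k) <= 2 * n%:R * omega (1 - al) (t n).
Proof.
move=> kn; have nk : 0 < (n - k)%:R :> R by rewrite ltr0n subn_gt0.
have n0 : 0 < n%:R :> R by rewrite ltr0n.
set q := (n - k)%:R / (2 * n%:R) : R.
have q0 : 0 < q by rewrite /q; pos.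
have q1 : q <= 1.
  rewrite /q ler_pdivrMr ?mul1r; last by pos.
  by rewrite -natrM ler_nat; nlia.
have dist : q * t n <= sg - t k.
  have := node_convex (ltnW kn); have := t_theta_gt mesh al01 nN kn; rewrite -/sg.
  have h : (t n - t k) / 2 <= sg - t k.
    rewrite /sg /t_theta; have : t k <= t n.-1 by apply: (node_le mesh); nlia.
    have tn : t n.-1 <= t n by apply: (node_le mesh); nlia.
    have : 0 <= (2^-1 - th) * (t n - t n.-1).
      by apply: mulr_ge0; [rewrite /th; move: al01; lra|lra].
    lra.
  move=> _ c; apply: le_trans h.
  rewrite /q natrB; last exact: ltnW.
  rewrite mulrAC ler_pdivrMr; last by pos.
  lra.
have dist0 : 0 < q * t n by pos.
have := le_omega al01 dist0 dist; rewrite -/(omega_s al sg (t k)) -/g.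
rewrite [in X in _ <= X -> _]omegaE// powRM ?(ltW q0) ?(ltW t_n_gt0)//.
rewrite -mulrA -omegaE// => H.
have qal : q `^ (- al) <= q^-1.
  rewrite powRN lef_pV2 ?posrE ?powR_gt0//.
  by rewrite ger1_powR ?q0// ltW//; case/andP: al01.
have w0 := omega_ge0 al01 (t n).
rewrite mulrC -ler_pdivlMr//; apply: le_trans H _.
rewrite [leRHS](_ : _ = q^-1 * omega (1 - al) (t n)).
  exact: ler_wpM2r.
by rewrite /q invf_div; ring.
Qed.

Let g_nd k : (1 <= k < n)%N -> g (t k.-1) <= g (t k).
Proof.
move=> kn; apply: le_omega_s => //; first by apply: (t_theta_gt mesh al01 nN); nlia.
by apply: (node_le mesh); nlia.
Qed.

Lemma omega_node_half k : (k.*2 <= n)%N -> g (t k) <= 4 * omega (1 - al) (t n).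
Proof.
move=> kn; have kn' : (k < n)%N by move: kn n1; rewrite -addnn; nlia.
have := omega_node_le kn'.
have n0 : 0 < n%:R :> R by rewrite ltr0n.
have h : n%:R <= 2 * (n - k)%:R :> R by rewrite -natrM ler_nat; move: kn; rewrite -addnn; nlia.
have g0 : 0 <= g (t k) by exact: omega_s_ge0.
have := ler_wpM2r g0 h => h1 h2.
rewrite -(ler_pM2l n0); lra.
Qed.

(** Split at n/2. Below, 1/k <= 1 and the variation telescopes to a kernel value on the first half
    of the mesh, at most four times that at t_n. Above, 1/k <= 2/n compensates for the factor 2n
    lost at t_(n-1). *)
Lemma weighted_variation : (2 <= n)%N ->
  \sum_(2 <= k < n) k%:R^-1 * (g (t k) - g (t k.-1)) <= 8 * omega (1 - al) (t n).
Proof.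
move=> n2; set m := n./2.+1.
have mn : (2 <= m <= n)%N by rewrite /m; nlia.
have n0 : 0 < n%:R :> R by rewrite ltr0n.
have tel (p q : nat) : (1 <= p <= q)%N -> (q <= n)%N ->
    \sum_(p <= k < q) (g (t k) - g (t k.-1)) = g (t q.-1) - g (t p.-1).
  move=> /andP[p1 pq] qn.
  have -> : p = p.-1.+1 by nlia.
  have -> : q = q.-1.+1 by nlia.
  by rewrite big_add1/= telescope_sumr//; nlia.
have d0 k : (2 <= k < n)%N -> 0 <= g (t k) - g (t k.-1).
  by move=> kn; rewrite subr_ge0 g_nd//; nlia.
have S1 : \sum_(2 <= k < m) k%:R^-1 * (g (t k) - g (t k.-1)) <= g (t m.-1).
  apply: (@le_trans _ _ (\sum_(2 <= k < m) (g (t k) - g (t k.-1)))).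
    rewrite big_nat_cond [leRHS]big_nat_cond; apply: ler_sum => k; rewrite andbT => km.
    rewrite ler_piMl ?d0//; first by nlia.
    by rewrite invf_le1 ?ler1n ?ltr0n; nlia.
  rewrite tel; [|nlia|nlia].
  by rewrite gerBl omega_s_ge0.
have S2 : \sum_(m <= k < n) k%:R^-1 * (g (t k) - g (t k.-1)) <= 2 / n%:R * g (t n.-1).
  apply: (@le_trans _ _ (\sum_(m <= k < n) 2 / n%:R * (g (t k) - g (t k.-1)))).
    rewrite big_nat_cond [leRHS]big_nat_cond; apply: ler_sum => k; rewrite andbT => km.
    rewrite ler_wpM2r ?d0//; first by nlia.
    rewrite ler_pdivlMr// ler_pdivrMl ?ltr0n; last by nlia.
    by rewrite -natrM ler_nat; nlia.
  rewrite -mulr_sumr ler_wpM2l ?divr_ge0// tel; [|nlia|nlia].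
  by rewrite gerBl omega_s_ge0.
rewrite (@big_cat_nat _ _ _ m)//=; try nlia.
have H1 : g (t m.-1) <= 4 * omega (1 - al) (t n).
  by apply: omega_node_half; rewrite /m/=; nlia.
have H2 : 2 / n%:R * g (t n.-1) <= 4 * omega (1 - al) (t n).
  have nn : (n.-1 < n)%N by nlia.
  have := omega_node_le nn.
  rewrite (_ : (n - n.-1)%N = 1%N) ?mul1r; last by nlia.
  by move=> h; rewrite mulrAC ler_pdivrMr//; lra.
lra.
Qed.

(** Both steps are of order t_(k-1) / k, which leaves t_(k-1)^al / k^2; then t_(k-1) <= k tau_n and
    k^al <= k trade one factor 1/k for tau_n^al. The power of G is 2 + 3, from the two steps. *)
Lemma second_difference_bound k : (2 <= k < n)%N ->
  t k.-1 `^ (al - 2) * (2 * step t k * step t k.+1) <=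
    2 * G ^+ 5 * (step t n `^ al / k%:R).
Proof.
move=> kn; have G1 := mesh_ge1 mesh; have G0 : 0 < G by lra.
have k0 : 0 < k%:R :> R by rewrite ltr0n; nlia.
have x0 : 0 < t k.-1 by apply: (node_gt0 mesh); nlia.
have s0 : 0 < step t n by apply: (mesh_step_gt0 mesh).
have sk : 0 < step t k by apply: (mesh_step_gt0 mesh); nlia.
have sk' : 0 < step t k.+1 by apply: (mesh_step_gt0 mesh); nlia.
set x := t k.-1 in x0 *.
have h1 : t k <= G * x by apply: (mesh_node_le mesh); nlia.
have h2 : t k.+1 <= G * t k by apply: (mesh_node_le mesh); nlia.
have h3 : step t k <= G ^+ 2 * x / k%:R.
  apply: le_trans (mesh_step_le mesh _) _; first by nlia.
  rewrite ler_pM2r ?invr_gt0// expr2 -mulrA ler_pM2l//.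
have h4 : step t k.+1 <= G ^+ 3 * x / k%:R.
  apply: le_trans (mesh_step_le mesh _) _; first by nlia.
  have tk0 : 0 <= t k.+1 by apply: (node_ge0 mesh); nlia.
  apply: ler_pM; rewrite ?invr_ge0//; first by rewrite mulr_ge0// ltW.
    rewrite exprS -mulrA ler_pM2l// expr2 -mulrA.
    by apply: le_trans h2 _; rewrite ler_pM2l.
  by rewrite lef_pV2 ?posrE// ler_nat.
have h5 : x `^ al <= k%:R * step t n `^ al.
  have xk : x <= k%:R * step t n.
    have := @node_le_step _ _ _ _ mesh k.-1 n ltac:(nlia) nleN.
    by move/le_trans; apply; rewrite ler_pM2r// ler_nat; nlia.
  apply: (@le_trans _ _ ((k%:R * step t n) `^ al)).
    by apply: le_powRl => //; rewrite ltW//; case/andP: al01.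
  rewrite powRM ?(ltW s0)// ler_pM2r ?powR_gt0//.
  by rewrite ler1_powR ?ler1n; [| nlia|rewrite ltW//; case/andP: al01].
have E : x `^ al = x `^ (al - 2) * x ^+ 2.
  by rewrite -(powR_mulrn 2 (ltW x0)) -powRD_gt0//; congr (_ `^ _); ring.
have p0 : 0 < x `^ (al - 2) by pos.
apply: (@le_trans _ _ (x `^ (al - 2) * (2 * (G ^+ 2 * x / k%:R) * (G ^+ 3 * x / k%:R)))).
  rewrite ler_pM2l//; apply: ler_pM => //; try pos.
  by rewrite ler_pM2l.
rewrite [leLHS](_ : _ = 2 * G ^+ 5 * (x `^ al / k%:R / k%:R)); last first.
  by rewrite E; field; rewrite gt_eqF.
rewrite ler_pM2l; last by pos.
by rewrite ler_pM2r ?invr_gt0// ler_pdivrMr// mulrC.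
Qed.

End MeshSums.

Section Split.
Context {R : realType}.
Variables (t : nat -> R) (al th : R) (m : nat).
Let a := a_coef t al th m.+1.
Let b := b_coef t al th m.+1.

(** Undoes the grouping by levels: the [a] part is the formula with linear interpolation, and each
    [b k] multiplies the second difference that corrects it to quadratic interpolation on cell k. *)
Lemma D_tau_split (w : nat -> R) : D_tau t al th w m.+1 =
  \sum_(1 <= k < m.+1) (a k * (w k - w k.-1)) + a m.+1 * (w m.+1 - w m) +
  \sum_(1 <= k < m.+1) (b k * ((w k.+1 - w k) / Defs.ratio t k.+1 - (w k - w k.-1))).
Proof.
rewrite /D_tau.
have -> : \sum_(1 <= k < m.+2) A_coef t al th m.+1 k * (w k - w k.-1) =
  \sum_(1 <= k < m.+2) (a k * (w k - w k.-1)) +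
  \sum_(1 <= k < m.+2) ((if k == 1%N then 0 else b k.-1 / Defs.ratio t k) * (w k - w k.-1)) -
  \sum_(1 <= k < m.+2) ((if k == m.+1 then 0 else b k) * (w k - w k.-1)).
  rewrite -big_split -sumrB; apply: eq_big_nat => k km /=.
  rewrite -mulrDl -mulrBl; congr (_ * _).
  rewrite /A_coef -/(a k) -/(a m.+1) -/(b k.-1) -/(b k) -/(b m).
  case: (eqVneq m.+1 1%N) => m1.
    have -> : k = 1%N by lia.
    by rewrite /= m1 eqxx addr0 subr0.
  case: (eqVneq k m.+1) => [->|km1].
    by rewrite (negbTE m1) subr0.
  by case: (eqVneq k 1%N) => [->|k1]; rewrite ?addr0.
rewrite [X in X + _ - _]big_nat_recr//=.
rewrite [X in _ + X - _]big_ltn// /= mul0r add0r [X in _ + X - _]big_add1/=.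
rewrite [X in _ - X]big_nat_recr//= eqxx mul0r addr0.
rewrite -addrA; congr (_ + _); rewrite -sumrB; apply: eq_big_nat => k km.
have -> : k == m.+1 = false by lia.
have -> : k.+1 == 1%N = false by lia.
by rewrite mulrBr; ring.
Qed.

End Split.

Lemma Gamma1BV_le (R : realType) (al : R) : 0 < al < 1 ->
  (Gamma (1 - al))^-1 <= (Gamma (2 - al))^-1.
Proof.
move=> al01; have G1 := Gamma1B_gt0 al01.
rewrite (Gamma2BE al01) invfM ler_peMl ?invr_ge0 ?(ltW G1)//.
by rewrite invf_ge1 ?gerBl ?subr_gt0; move: al01 => /andP[/ltW].
Qed.

(** * Truncation error, cell by cell *)

Section Truncation.
Context {R : realType}.
Notation mu := (@lebesgue_measure R).
Variables (t : nat -> R) (N : nat) (G al : R).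
Hypothesis mesh : regular_mesh t N G.
Hypothesis al01 : 0 < al < 1.
Let th := al / 2.
Variable n : nat.
Hypothesis nN : (1 <= n <= N)%N.
Variables (T C : R) (v v1 v2 v3 : R -> R).
Hypothesis tT : t N <= T.
Hypothesis vr : time_regular al T C v v1 v2 v3.

Let sg := t_theta t th n.
Let g := omega_s al sg.
Let a := a_coef t al th n.
Let b := b_coef t al th n.
Let f s := g s * v1 s.

Hypothesis fi : mu.-integrable `]0, sg[ (EFin \o f).

Let nleN : (n <= N)%N. Proof. by case/andP: nN. Qed.
Let n1 : (1 <= n)%N. Proof. by case/andP: nN. Qed.
Let al0 : 0 < al. Proof. by case/andP: al01. Qed.
Let t_n_gt0 : 0 < t n. Proof. exact: (node_gt0 mesh). Qed.
Let tn_T : t n <= T.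
Proof. by apply: le_trans tT; apply: (node_le mesh); rewrite nleN leqnn. Qed.
Let T0 : 0 < T. Proof. exact: lt_le_trans tn_T. Qed.
Let C0 : 0 <= C. Proof. exact: (time_regular_C_ge0 T0 vr). Qed.
Let step_n_gt0 : 0 < step t n. Proof. exact: (mesh_step_gt0 mesh). Qed.
Let sgT : sg <= T. Proof. by rewrite ltW// (lt_le_trans (t_theta_lt mesh al01 nN)). Qed.

Let f_sub (x y : R) (bx by' : bool) : 0 <= x -> y <= sg ->
  (BRight 0 <= BSide bx x)%O -> (BSide by' y <= BLeft sg)%O ->
  mu.-integrable [set` Interval (BSide bx x) (BSide by' y)] (EFin \o f).
Proof.
move=> x0 ys h1 h2; apply: integrableS fi => //.
by apply: subset_itv.
Qed.

Let t_lt k : (k < n)%N -> t k < sg. Proof. exact: (t_theta_gt mesh al01 nN). Qed.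
Let t_ge0 k : (k <= n)%N -> 0 <= t k.
Proof. by move=> kn; apply: (node_ge0 mesh); exact: leq_trans nleN. Qed.

Lemma caputo_split j : (j < n)%N ->
  \int[mu]_(s in `]0, sg[) f s =
  \sum_(1 <= k < j.+1) \int[mu]_(s in `]t k.-1, t k]) f s
  + \int[mu]_(s in `]t j, sg[) f s.
Proof.
elim: j => [|j IH] jn; first by rewrite big_geq// add0r (mesh0 mesh).
rewrite IH; last exact: ltnW.
rewrite [in RHS]big_nat_recr//= -[RHS]addrA; congr (_ + _).
have jj : t j < t j.+1 by apply: (node_lt mesh); rewrite ltnSn (leq_trans (ltnW jn)).
have tj0 : 0 <= t j by apply: t_ge0; exact: ltnW (ltnW jn).
rewrite -(@Rintegral_itvB R f (BRight (t j)) (BLeft sg) (t j.+1)).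
- by rewrite addrC subrK.
- by apply: f_sub => //; rewrite ?bnd_simp.
- by rewrite bnd_simp ltW.
- by rewrite bnd_simp t_lt.
Qed.

Section InteriorCell.
Variable k : nat.
Hypothesis k2n : (2 <= k < n)%N.

Let k1n : (1 <= k < n)%N. Proof. by case/andP: k2n => /ltnW ->. Qed.
Let kn : (k < n)%N. Proof. by case/andP: k2n. Qed.
Let tk1 : 0 < t k.-1. Proof. by apply: (node_gt0 mesh); nlia. Qed.
Let tk : t k.-1 < t k. Proof. by apply: (node_lt mesh); nlia. Qed.
Let tkn : t k < t n. Proof. by apply: (node_lt mesh); nlia. Qed.
Let tkT : t k < T. Proof. exact: lt_le_trans tkn tn_T. Qed.
Let step_gt0 : 0 < step t k. Proof. by apply: (mesh_step_gt0 mesh); nlia. Qed.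
Let step_le : step t k <= step t k.+1. Proof. by apply: (mesh_step_nd mesh); nlia. Qed.

Let S2 := C * t k.-1 `^ (al - 2).
Let S2_ge0 : 0 <= S2. Proof. by rewrite /S2 mulr_ge0 ?powR_ge0. Qed.
Let dg := g (t k) - g (t k.-1).

(** The difference quotient is a value [v1 c], and [v1 c - v1 s] has mean zero on the cell; by
    [cell_covariance] only the variation of the kernel over the cell is paid. *)
Lemma interior_error :
  `|a k * (v (t k) - v (t k.-1)) - \int[mu]_(s in `]t k.-1, t k]) f s| <=
    S2 * step t k ^+ 2 * dg.
Proof.
have [c cI Ec] := time_MVT vr (ltW tk1) tk (ltW tkT).
have Dv1 s : s \in `[t k.-1, t k] -> 0 < s < T.
  by rewrite in_itv/= => /andP[s1 s2]; rewrite (lt_le_trans tk1 s1) (le_lt_trans s2 tkT).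
have cv1 : {within `[t k.-1, t k], continuous v1}.
  by apply: (@is_derive_within_continuous _ v1 v2) => s /Dv1; exact: (tr_d2 vr).
have cg : {within `[t k.-1, t k], continuous g} by apply: within_continuous_omega_s => //; exact: t_lt.
have iv1 : \int[mu]_(s in `[t k.-1, t k]) v1 s = v (t k) - v (t k.-1).
  by apply: Rintegral_FTC => //; [exact: ltW|move=> s /Dv1; exact: (tr_d1 vr)].
have E : a k * (v (t k) - v (t k.-1)) - \int[mu]_(s in `]t k.-1, t k]) f s =
    \int[mu]_(s in `[t k.-1, t k]) (g s * (v1 c - v1 s)).
  rewrite Rintegral_itv_obnd_cbnd; last first.
    have := t_lt kn; by move=> h; apply: f_sub; rewrite ?bnd_simp//; exact: ltW.
  rewrite Ec mulrCA (_ : a k * (t k - t k.-1) = \int[mu]_(s in `[t k.-1, t k]) g s); last first.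
    rewrite -/(step t k) (a_coef_primE mesh al01 nN k1n).
    by rewrite (omega_s_integral al01 (ltW tk) (ltW (t_lt kn))).2.
  rewrite -RintegralZl//; last exact: continuous_itv_integrable.
  rewrite -RintegralB//; last 2 first.
  - exact/continuous_itv_integrable/within_continuousM/cg/within_continuous_cst.
  - exact/continuous_itv_integrable/within_continuousM.
  by apply: eq_Rintegral => s _; rewrite /f; ring.
rewrite E.
have g_nd s r : s \in `[t k.-1, t k] -> r \in `[t k.-1, t k] -> s <= r -> g s <= g r.
  rewrite !in_itv/= => /andP[_ _] /andP[_ r2] sr.
  by apply: le_omega_s => //; exact: le_lt_trans r2 (t_lt kn).
apply: le_trans (cell_covariance (ltW tk) cg g_nd _ _ (c := S2 * step t k) _) _.
- by apply: within_continuousB => //; exact: within_continuous_cst.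
- rewrite RintegralB//; last 2 first.
  + exact/continuous_itv_integrable/within_continuous_cst.
  + exact: continuous_itv_integrable.
  by rewrite iv1 Rintegral_cst_itv ?(ltW tk)// Ec subrr.
- move=> s; rewrite in_itv/= => /andP[s1 s2].
  move: cI; rewrite in_itv/= => /andP[c1 c2].
  by apply: (v1_lip al01 T0 vr) => //; rewrite ?(ltW c1) ?(ltW c2) ?(ltW tkT) ?(lt_trans c2)// (le_lt_trans s2).
rewrite [leRHS](_ : _ = S2 * step t k * (step t k * dg)); last by ring.
apply: ler_wpM2l; first by pos.
have := cell_average_le (ltW tk) cg g_nd; rewrite /dg -/(step t k); lra.
Qed.

Let b_le : b k <= dg / 2.
Proof.
apply: le_trans (b_coef_le mesh al01 nN k1n) _.
by rewrite ler_pM2r// lerD2r (a_coef_le mesh al01 nN k1n).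
Qed.

Lemma interior_error_b :
  `|b k * ((v (t k.+1) - v (t k)) / Defs.ratio t k.+1 - (v (t k) - v (t k.-1)))| <=
    S2 * (step t k * step t k.+1) * dg.
Proof.
have step_gt0' : 0 < step t k.+1 by apply: (mesh_step_gt0 mesh); nlia.
have tk' : t k < t k.+1 by rewrite -subr_gt0.
have tkn' : t k.+1 <= t n by apply: (node_le mesh); nlia.
have [c cI Ec] := time_MVT vr (ltW tk1) tk (ltW tkT).
have [d dI Ed] := time_MVT vr (ltW (lt_trans tk1 tk)) tk' (le_trans tkn' tn_T).
rewrite Ec Ed -/(step t k) -[t k.+1 - t k]/(step t k.+1).
rewrite (_ : _ / Defs.ratio t k.+1 = v1 d * step t k); last first.
  by rewrite /Defs.ratio/=; move: (step t k.+1) (step t k) step_gt0' step_gt0 => p q *; field; rewrite !gt_eqF.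
have b0 : 0 <= b k := b_coef_ge0 mesh al01 nN k1n.
rewrite -mulrBl normrM (ger0_norm b0) normrM (gtr0_norm step_gt0).
move: cI dI; rewrite !in_itv/= => /andP[c1 c2] /andP[d1 d2].
have L : `|v1 d - v1 c| <= S2 * (t k.+1 - t k.-1).
  have tT' := le_trans tkn' tn_T.
  have dT := lt_le_trans d2 tT'; have cT := lt_trans c2 tkT.
  by apply: (v1_lip al01 T0 vr) => //; apply: ltW => //; [exact: lt_trans tk d1|exact: lt_trans c2 tk'].
have L' : `|v1 d - v1 c| <= S2 * (2 * step t k.+1).
  apply: le_trans L _; apply: ler_wpM2l => //.
  by move: step_le; rewrite /step/=; lra.
apply: (@le_trans _ _ (dg / 2 * (S2 * (2 * step t k.+1) * step t k))).
  apply: ler_pM => //; first by rewrite mulr_ge0// ltW.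
  by rewrite ler_pM2r.
lra.
Qed.

Lemma interior_total :
  `|a k * (v (t k) - v (t k.-1)) - \int[mu]_(s in `]t k.-1, t k]) f s| +
  `|b k * ((v (t k.+1) - v (t k)) / Defs.ratio t k.+1 - (v (t k) - v (t k.-1)))| <=
  2 * C * G ^+ 5 * step t n `^ al * (k%:R^-1 * dg).
Proof.
have dg0 : 0 <= dg.
  rewrite subr_ge0; apply: le_omega_s => //; [exact: t_lt|exact: ltW].
have B := second_difference_bound mesh al01 nN k2n.
apply: (@le_trans _ _ (S2 * (2 * step t k * step t k.+1) * dg)).
  have h : S2 * step t k ^+ 2 * dg <= S2 * (step t k * step t k.+1) * dg.
    by rewrite expr2; apply: ler_wpM2r => //; apply: ler_wpM2l => //; rewrite ler_pM2l.
  have := interior_error; have := interior_error_b; lra.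
have := ler_wpM2r dg0 (ler_wpM2l C0 B).
rewrite /S2; lra.
Qed.

End InteriorCell.

Let CA_ge0 : 0 <= C / al. Proof. by rewrite divr_ge0 ?(ltW al0). Qed.

(** Next to 0 second derivatives are of no use. The increment term, the integral and the correction
    each cost one Hoelder bound, hence the 3. *)
Lemma first_total : (2 <= n)%N ->
  `|a 1 * (v (t 1%N) - v (t 0%N)) - \int[mu]_(s in `]t 0%N, t 1%N]) f s| +
  `|b 1 * ((v (t 2%N) - v (t 1%N)) / Defs.ratio t 2 - (v (t 1%N) - v (t 0%N)))| <=
  3 * (C / al) * step t n `^ al * g (t 1%N).
Proof.
move=> n2; have k1n : (1 <= 1 < n)%N by [].
have t1 : 0 < t 1%N by apply: (node_gt0 mesh); nlia.
have st1 : step t 1 = t 1%N by rewrite /step/= (mesh0 mesh) subr0.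
have t1n : t 1%N <= step t n by rewrite -st1; apply: (step_le mesh) => //; nlia.
have t2n : step t 2 <= step t n by apply: (step_le mesh) => //; nlia.
have st12 : step t 1 <= step t 2 by apply: (mesh_step_nd mesh); nlia.
have st2 : 0 < step t 2 by apply: (mesh_step_gt0 mesh); nlia.
have t2T : t 2%N <= T by apply: le_trans tn_T; apply: (node_le mesh); nlia.
have t12 : t 1%N <= t 2%N by rewrite -subr_ge0 ltW.
have t1sg := t_lt n2.
have g1 : 0 <= g (t 1%N) by exact: omega_s_ge0.
have pn (x : R) : 0 <= x -> x <= step t n -> C / al * x `^ al <= C / al * step t n `^ al.
  by move=> x0 xn; apply: ler_wpM2l => //; apply: le_powRl => //; exact: ltW.
have V1 : `|v (t 1%N) - v (t 0%N)| <= C / al * step t n `^ al.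
  rewrite (mesh0 mesh).
  apply: le_trans (time_holder_le al01 T0 vr (lexx 0) (ltW t1) (le_trans t12 t2T)) _.
  by rewrite subr0; apply: pn => //; exact: ltW.
have V2 : `|v (t 2%N) - v (t 1%N)| <= C / al * step t n `^ al.
  apply: le_trans (time_holder_le al01 T0 vr (ltW t1) t12 t2T) _.
  by apply: pn => //; exact: ltW.
have A1 : 0 <= a 1 <= g (t 1%N).
  rewrite (a_coef_le mesh al01 nN k1n) andbT.
  by apply: le_trans (a_coef_ge mesh al01 nN k1n); exact: omega_s_ge0.
have /andP[a0 a1] := A1.
have b0 : 0 <= b 1 := b_coef_ge0 mesh al01 nN k1n.
have b1 : b 1 <= g (t 1%N) / 2.
  apply: le_trans (b_coef_le mesh al01 nN k1n) _; rewrite ler_pM2r//.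
  by apply: le_trans a1; rewrite gerBl omega_s_ge0.
have I1 : `|\int[mu]_(s in `]t 0%N, t 1%N]) f s| <= g (t 1%N) * (C / al * step t n `^ al).
  rewrite (mesh0 mesh) -Rintegral_itv_bndo_bndc; last first.
    by apply: f_sub => //; [exact: ltW|rewrite bnd_simp ltW].
  apply: le_trans (origin_integral_le al01 T0 vr sgT fi t1 (ltW t1sg) (c := g (t 1%N)) _) _.
    by move=> s s0 st; apply: le_omega_s => //; exact: ltW.
  apply: ler_wpM2l => //; apply: le_trans (pn _ (ltW t1) t1n).
  by rewrite le_eqVlt; apply/orP; left; apply/eqP; ring.
have E1 : `|a 1 * (v (t 1%N) - v (t 0%N))| <= g (t 1%N) * (C / al * step t n `^ al).
  by rewrite normrM (ger0_norm a0); apply: ler_pM.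
have r2 : `|(v (t 2%N) - v (t 1%N)) / Defs.ratio t 2| <= C / al * step t n `^ al.
  have r1 : 1 <= Defs.ratio t 2.
    by rewrite /Defs.ratio/= ler_pdivlMr ?mul1r// st1.
  rewrite normrM normfV [`|Defs.ratio _ _|]gtr0_norm ?(lt_le_trans ltr01)//.
  rewrite ler_pdivrMr ?(lt_le_trans ltr01)//; apply: le_trans V2 _.
  by rewrite ler_peMr// mulr_ge0 ?powR_ge0.
have E2 : `|b 1 * ((v (t 2%N) - v (t 1%N)) / Defs.ratio t 2 - (v (t 1%N) - v (t 0%N)))| <=
    g (t 1%N) / 2 * (2 * (C / al * step t n `^ al)).
  rewrite normrM (ger0_norm b0); apply: ler_pM => //.
  by apply: le_trans (ler_normB _ _) _; lra.
have := ler_normB (a 1 * (v (t 1%N) - v (t 0%N))) (\int[mu]_(s in `]t 0%N, t 1%N]) f s).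
lra.
Qed.

Let Y := sg - t n.-1.
Let YE : Y = (1 - th) * step t n. Proof. exact: t_thetaE. Qed.
Let th1 : 0 < 1 - th. Proof. by rewrite /th; move: al01; lra. Qed.
Let Y0 : 0 < Y. Proof. by rewrite YE mulr_gt0. Qed.
Let tn1 : t n.-1 < sg. Proof. by rewrite -subr_gt0. Qed.

Let g_integral := omega_s_integral al01 (ltW tn1) (lexx sg).

Lemma last_integrable (u : R -> R) : {within `[t n.-1, sg], continuous u} ->
  mu.-integrable `[t n.-1, sg] (EFin \o (fun s => g s * u s)).
Proof.
move=> cu.
have bu : [bounded u x | x in `[t n.-1, sg] : set R].
  have [B [Br HB]] := compact_bounded (continuous_compact cu (@segment_compact _ _ _)).
  by exists B; split => // z Bz x xI; apply: (HB z Bz); exists x.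
have /integrableP[/measurable_EFinP mu' _] := continuous_itv_integrable cu.
by apply: eq_integrable (integrableMl _ g_integral.1 mu' bu).
Qed.

Let m := (t n + t n.-1) / 2.

(* Superconvergence: the offset of [sg] makes the midpoint of the last cell the
   centre of mass of the kernel. *)
Lemma last_moment0 : \int[mu]_(s in `[t n.-1, sg]) (g s * (s - m)) = 0.
Proof.
have p2 : 0 < 2 - al by move: al01; lra.
have D (x : R) : x \in `]t n.-1, sg[ -> is_derive x 1
    (fun s => - ((sg - s) `^ (2 - al) / (2 - al) / Gamma (1 - al))) (g x * (sg - x)).
  rewrite in_itv/= => /andP[_ xs]; have y0 : 0 < sg - x by rewrite subr_gt0.
  have D0 := is_derive1_powR (2 - al) y0.
  have D1 : is_derive (sg - x) 1 (fun y : R => ((2 - al) * Gamma (1 - al))^-1 * y `^ (2 - al))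
      (g x * (sg - x)).
    apply: is_derive_eq; rewrite /g /omega_s omegaE// /GRing.scale/=.
    have -> : 2 - al - 1 = - al + 1 by ring.
    rewrite powRD_gt0// powRr1 ?(ltW y0)//.
    have Gm := Gamma1B_gt0 al01; field.
    by rewrite !gt_eqF.
  have D2 := is_derive_comp_subl D1.
  rewrite -[X in is_derive _ _ _ X]opprK.
  have -> : (fun s => - ((sg - s) `^ (2 - al) / (2 - al) / Gamma (1 - al))) =
     - (fun s => ((2 - al) * Gamma (1 - al))^-1 * (sg - s) `^ (2 - al)).
    apply/funext => s /=; rewrite -[RHS]/(- (((2 - al) * Gamma (1 - al))^-1 * (sg - s) `^ (2 - al))).
    by rewrite invfM; ring.
  exact: is_deriveN.
have cid : {within `[t n.-1, sg], continuous (fun s : R => sg - s)}.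
  by apply: within_continuousB; [exact: within_continuous_cst|exact: within_continuous_id].
have Ic := last_integrable cid.
have [||||_ Io] := @improper_FTC_integrable R (fun s => g s * (sg - s)) _ (t n.-1) sg tn1 D.
- move=> x; rewrite in_itv/= => /andP[_ xs]; apply: continuousM.
    exact: continuous_omega_s.
  by apply: continuousB; [exact: cst_continuous|exact].
- by move=> x; rewrite in_itv/= => /andP[_ xs]; rewrite mulr_ge0 ?omega_s_ge0// subr_ge0 ltW.
- apply: cvg_at_right_filter; apply: cvgN; apply: cvgMl; apply: cvgMl.
  have D0 := is_derive1_powR (2 - al) Y0.
  exact: (is_derive_continuous (is_derive_comp_subl D0)).
- rewrite subrr powR0 ?gt_eqF// !mul0r; apply: cvgN.
  rewrite -[X in _ --> X](mul0r (Gamma (1 - al))^-1); apply: cvgMl.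
  rewrite -[X in _ --> X](mul0r (2 - al)^-1); apply: cvgMl.
  apply: (@cvg_comp _ _ _ (fun s => sg - s) (fun y : R => y `^ (2 - al)) _ (0^'+)); last exact: powR_cvg0.
  move=> A [e /= e0 eA]; exists e => //= x /= xe xs0.
  by apply: eA => /=; rewrite ?subr_gt0// sub0r normrN.
have E : \int[mu]_(s in `[t n.-1, sg]) (g s * (sg - s)) =
    Y `^ (2 - al) / (2 - al) / Gamma (1 - al).
  rewrite -Rintegral_itv_obnd_cbnd; last first.
    by apply: integrableS Ic => //; apply: subset_itv; rewrite ?bnd_simp.
  rewrite -Rintegral_itv_bndo_bndc; last first.
    by apply: integrableS Ic => //; apply: subset_itv; rewrite ?bnd_simp.
  by rewrite Io subrr powR0 ?gt_eqF// !mul0r oppr0 sub0r opprK.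
have -> : \int[mu]_(s in `[t n.-1, sg]) (g s * (s - m)) =
   (sg - m) * \int[mu]_(s in `[t n.-1, sg]) g s - \int[mu]_(s in `[t n.-1, sg]) (g s * (sg - s)).
  rewrite -RintegralZl//; last exact: g_integral.1.
  rewrite -RintegralB//; first by apply: eq_Rintegral => s _; ring.
  by apply: eq_integrable (integrableZl _ (sg - m) g_integral.1).
rewrite E g_integral.2 subrr omega_prim0// subr0 -/Y /omega_prim Gamma2BE//.
(* Here theta = al / 2 enters: (1 - al) / (2 - al) times Y is the distance from t_(n-theta) to the
   centre of mass of the kernel on the truncated cell. *)
have -> : sg - m = (1 - al) / (2 - al) * Y.
  by rewrite YE /m /sg /t_theta /step /th; field; rewrite gt_eqF.
have -> : Y `^ (2 - al) = Y * Y `^ (1 - al).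
  by rewrite -{2}(powRr1 (ltW Y0)) -powRD_gt0//; congr (_ `^ _); ring.
have Gm := Gamma1B_gt0 al01; have al1 : 0 < 1 - al by move: al01; lra.
by field; rewrite !gt_eqF.
Qed.

Let Gam0 : 0 < Gamma (2 - al). Proof. exact: Gamma2B_gt0. Qed.

Let GamV : (Gamma (2 - al))^-1 <= 2 * expR 2.
Proof.
have /andP[h _] := Gamma2B_bounds al01.
have e : 0 < 2 * expR 2 :> R by rewrite mulr_gt0// expR_gt0.
by rewrite -[leRHS]invrK lef_pV2 ?posrE ?invr_gt0// invfM -expRN mulrC.
Qed.

(** Remove from v1 the linear term [p * (s - m)]. It does not change the increment of v over the
    cell, m being the midpoint, nor the integral against the kernel, by [last_moment0]. The
    remainder [psi] oscillates by at most the bound on v3 times the square of the step. *)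
Lemma last_error : (2 <= n)%N ->
  `|a n * (v (t n) - v (t n.-1)) - \int[mu]_(s in `]t n.-1, sg[) f s| <=
  C * G ^+ 4 * (2 * expR 2) * (step t n `^ al * (t n `^ (- al) / n%:R)).
Proof.
move=> n2; have x0 : 0 < t n.-1 by apply: (node_gt0 mesh); nlia.
set x := t n.-1 in x0 *; set h := step t n.
have h0 : 0 < h := step_n_gt0.
have xtn : x < t n by rewrite -subr_gt0.
have tnh : t n = x + h by rewrite /h /step /x; ring.
have sgn : sg < t n := t_theta_lt mesh al01 nN.
have mE : m = x + h / 2 by rewrite /m tnh -/x; field.
have mT : 0 < m < T.
  by rewrite mE; have := tn_T; rewrite tnh; lra.
have G1 := mesh_ge1 mesh; have G0 : 0 < G by lra.
set p := v2 m.
pose S3 := C * x `^ (al - 3).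
have S3_ge0 : 0 <= S3 by rewrite /S3 mulr_ge0 ?powR_ge0.
pose psi s := v1 s - p * (s - m).
have inT s : x <= s -> s < t n -> 0 < s < T.
  by move=> xs sn; rewrite (lt_le_trans x0 xs) (lt_le_trans sn tn_T).
have v2_lip s r : x <= s -> s < t n -> x <= r -> r < t n -> `|v2 s - v2 r| <= S3 * h.
  wlog rs : s r / r <= s => [hw xs sn xr rn|xs sn xr rn].
    by case: (leP r s) => [|/ltW] rs; [exact: hw|rewrite distrC; exact: hw].
  have D q : q \in `[r, s] -> is_derive q 1 v2 (v3 q).
    rewrite in_itv/= => /andP[rq qs]; apply: (tr_d3 vr).
    by apply: inT; [exact: le_trans xr rq|exact: le_lt_trans qs sn].
  have [q qI ->] := MVT_segment rs (fun q qI => D q (subset_itv_oo_cc qI))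
    (is_derive_within_continuous D).
  move: qI; rewrite in_itv/= => /andP[rq qs].
  have rs0 : 0 <= s - r by rewrite subr_ge0.
  rewrite normrM (ger0_norm rs0); apply: ler_pM => //; last by lra.
  apply: le_trans (tr_b3 vr _) _; first by apply: inT; [exact: le_trans xr rq|exact: le_lt_trans qs sn].
  apply: ler_wpM2l => //; rewrite -opprB !powRN lef_pV2 ?posrE ?powR_gt0//; last first.
    exact: lt_le_trans x0 (le_trans xr rq).
  by apply: le_powRl; [move: al01; lra|exact: ltW|exact: le_trans xr rq].
have Dpsi s : x <= s -> s < t n -> is_derive s 1 psi (v2 s - p).
  move=> xs sn; have D1 := tr_d2 vr (inT s xs sn).
  have D2 : is_derive s 1 (fun s => p * (s - m)) p.
    by apply: is_derive_eq; rewrite /GRing.scale/=; ring.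
  exact: is_deriveB.
have psi_lip s r : x <= s -> s < t n -> x <= r -> r < t n -> `|psi s - psi r| <= S3 * h * h.
  wlog rs : s r / r <= s => [hw xs sn xr rn|xs sn xr rn].
    by case: (leP r s) => [|/ltW] rs; [exact: hw|rewrite distrC; exact: hw].
  have D q : q \in `[r, s] -> is_derive q 1 psi (v2 q - p).
    rewrite in_itv/= => /andP[rq qs].
    by apply: Dpsi; [exact: le_trans xr rq|exact: le_lt_trans qs sn].
  have [q qI ->] := MVT_segment rs (fun q qI => D q (subset_itv_oo_cc qI))
    (is_derive_within_continuous D).
  move: qI; rewrite in_itv/= => /andP[rq qs].
  have rs0 : 0 <= s - r by rewrite subr_ge0.
  rewrite normrM (ger0_norm rs0); apply: ler_pM => //; last by lra.
  by apply: v2_lip; rewrite ?mE; lra.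
have [c cI Ec] : exists2 c, c \in `]x, t n[ & v (t n) - v x = psi c * h.
  have D q : q \in `]x, t n[ -> is_derive q 1 (fun s => v s - p * (s - m) ^+ 2 / 2) (psi q).
    rewrite in_itv/= => /andP[xq qn].
    have D1 := tr_d1 vr (inT q (ltW xq) qn).
    have D2 : is_derive q 1 (fun s => p * (s - m) ^+ 2 / 2) (p * (q - m)).
      by apply: is_derive_eq; rewrite /GRing.scale/=; field.
    exact: is_deriveB.
  have cF : {within `[x, t n], continuous (fun s => v s - p * (s - m) ^+ 2 / 2)}.
    apply: within_continuousB; first exact: (tr_sub_continuous vr (ltW x0) tn_T).
    have D2 (q : R) : is_derive q 1 (fun s : R => p * (s - m) ^+ 2 / 2) (p * (q - m)).
      by apply: is_derive_eq; rewrite /GRing.scale/=; field.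
    by apply: continuous_subspaceT => q; exact: is_derive_continuous (D2 q).
  have [c cI E] := MVT xtn D cF; exists c => //.
  rewrite (_ : h = t n - x); last by rewrite tnh; ring.
  by rewrite -E mE tnh; field.
move: cI; rewrite in_itv/= => /andP[c1 c2].
have inI s : s \in `[x, sg] -> x <= s /\ s < t n.
  by rewrite in_itv/= => /andP[xs ss]; split => //; exact: le_lt_trans ss sgn.
have cv1 : {within `[x, sg], continuous v1}.
  apply: continuous_in_subspaceT => s /[!inE]/= /inI[xs sn].
  exact: is_derive_continuous (tr_d2 vr (inT s xs sn)).
have cpsi : {within `[x, sg], continuous (fun s => psi c - psi s)}.
  apply: within_continuousB; first exact: within_continuous_cst.
  apply: continuous_in_subspaceT => s /[!inE]/= /inI[xs sn].
  exact: is_derive_continuous (Dpsi s xs sn).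
have csm : {within `[x, sg], continuous (fun s => s - m)}.
  by apply: within_continuousB; [exact: within_continuous_id|exact: within_continuous_cst].
have If := last_integrable cv1; have Ipsi := last_integrable cpsi.
have Ism := last_integrable csm.
have E : a n * (v (t n) - v x) - \int[mu]_(s in `]x, sg[) f s =
    \int[mu]_(s in `[x, sg]) (g s * (psi c - psi s)).
  rewrite Rintegral_itv_bndo_bndc; last first.
    by apply: f_sub => //; rewrite ?bnd_simp// ltW.
  rewrite Rintegral_itv_obnd_cbnd; last first.
    by apply: integrableS If => //; apply: subset_itv; rewrite ?bnd_simp.
  rewrite Ec mulrCA [a n * h](a_coef_lastE mesh al01 nN) -/th -YE.
  have -> : omega_prim al Y = \int[mu]_(s in `[x, sg]) g s.
    by rewrite g_integral.2 subrr omega_prim0// subr0.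
  have -> : \int[mu]_(s in `[x, sg]) f s = \int[mu]_(s in `[x, sg]) f s -
      p * \int[mu]_(s in `[x, sg]) (g s * (s - m)).
    by rewrite last_moment0 mulr0 subr0.
  have Ig := g_integral.1.
  have Ipsm : mu.-integrable `[x, sg] (EFin \o (fun s => p * (g s * (s - m)))).
    by apply: eq_integrable (integrableZl _ p Ism).
  have -> : psi c * \int[mu]_(s in `[x, sg]) g s = \int[mu]_(s in `[x, sg]) (psi c * g s).
    by rewrite RintegralZl.
  have -> : p * \int[mu]_(s in `[x, sg]) (g s * (s - m)) =
      \int[mu]_(s in `[x, sg]) (p * (g s * (s - m))).
    by rewrite RintegralZl.
  have E1 : \int[mu]_(s in `[x, sg]) f s - \int[mu]_(s in `[x, sg]) (p * (g s * (s - m))) =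
      \int[mu]_(s in `[x, sg]) (f s - p * (g s * (s - m))).
    by rewrite RintegralB.
  rewrite E1 -RintegralB//; last 2 first.
  - by apply: eq_integrable (integrableZl _ (psi c) Ig).
  - by apply: eq_integrable (integrableB _ If Ipsm).
  by apply: eq_Rintegral => s _; rewrite /f /psi; ring.
rewrite E; apply: le_trans (le_normr_Rintegral _ Ipsi) _ => //.
apply: (@le_trans _ _ (S3 * h * h * \int[mu]_(s in `[x, sg]) g s)).
  rewrite -RintegralZl//; last exact: g_integral.1.
  apply: le_Rintegral => //.
  - exact: integrable_norm Ipsi.
  - by apply: eq_integrable (integrableZl _ (S3 * h * h) g_integral.1).
  move=> s /= /inI[xs sn]; rewrite normrM (ger0_norm (omega_s_ge0 al01 sg s)) mulrC.
  apply: ler_wpM2r; first exact: omega_s_ge0.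
  by apply: psi_lip => //; exact: ltW.
rewrite g_integral.2 subrr omega_prim0// subr0 -/Y.
have W : omega_prim al Y <= h `^ (1 - al) * (2 * expR 2).
  apply: (@le_trans _ _ (omega_prim al h)).
    apply: le_omega_prim => //; first exact: ltW.
    by rewrite YE ler_piMl ?(ltW h0)// gerBl /th divr_ge0// ltW.
  by rewrite /omega_prim; apply: ler_wpM2l; [exact: powR_ge0|exact: GamV].
have hx : x `^ (al - 3) <= G ^+ 3 * t n `^ (al - 3).
  have tnx : t n / G <= x by rewrite ler_pdivrMr// mulrC; apply: (mesh_node_le mesh); rewrite n2 nleN.
  apply: (@le_trans _ _ ((t n / G) `^ (al - 3))).
    rewrite -opprB !powRN lef_pV2 ?posrE ?powR_gt0 ?divr_gt0//.
    by apply: le_powRl => //; [move: al01; lra|rewrite divr_ge0// ltW].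
  rewrite powRM ?invr_ge0 ?(ltW t_n_gt0) ?(ltW G0)// mulrC.
  rewrite (powR_invl _ (ltW G0)); apply: ler_wpM2r; first exact: powR_ge0.
  rewrite opprB -(powR_mulrn 3 (ltW G0)); apply: ler_powR => //.
  by move: al01; lra.
(* The left side is h^al t_n^(-al) (h / t_n)^(3 - 2 al); the exponent exceeds 1 and h <= t_n, so one
   factor h / t_n <= G / n remains. *)
have key : h * h * h `^ (1 - al) * t n `^ (al - 3) <= G * (h `^ al * (t n `^ (- al) / n%:R)).
  have q1 : h / t n <= 1 by rewrite ler_pdivrMr// mul1r tnh lerDr ltW.
  have q0 : 0 < h / t n by rewrite divr_gt0.
  have qE : h * h * h `^ (1 - al) * t n `^ (al - 3) =
      h `^ al * t n `^ (- al) * (h / t n) `^ (3 - 2 * al).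
    rewrite powRM ?invr_ge0 ?(ltW h0) ?(ltW t_n_gt0)// (powR_invl _ (ltW t_n_gt0)).
    rewrite -{1 2}(powRr1 (ltW h0)) -!powRD_gt0//.
    rewrite [RHS](_ : _ = (h `^ al * h `^ (3 - 2 * al)) * (t n `^ (- al) * t n `^ (- (3 - 2 * al)))); last by ring.
    by rewrite -!powRD_gt0//; congr (_ `^ _ * _ `^ _); ring.
  have qle : (h / t n) `^ (3 - 2 * al) <= G / n%:R.
    apply: (@le_trans _ _ (h / t n)).
      rewrite -[leRHS](powRr1 (ltW q0)); apply: ger_powR; first by rewrite q0.
      by move: al01; lra.
    rewrite ler_pdivrMr// mulrAC; exact: (mesh_step_le mesh).
  rewrite qE [leRHS](_ : _ = h `^ al * t n `^ (- al) * (G / n%:R)); last by ring.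
  by apply: ler_wpM2l => //; rewrite mulr_ge0 ?powR_ge0.
have e2 : 0 <= 2 * expR 2 :> R by rewrite mulr_ge0// expR_ge0.
have hh : 0 <= h * h by rewrite mulr_ge0 ?(ltW h0).
apply: (@le_trans _ _ (C * (G ^+ 3 * t n `^ (al - 3)) * h * h * (h `^ (1 - al) * (2 * expR 2)))).
  apply: ler_pM => //.
  - by rewrite -mulrA mulr_ge0.
  - exact: omega_prim_ge0.
  - rewrite -mulrA -[leRHS]mulrA; apply: ler_wpM2r => //.
    by rewrite /S3; apply: ler_wpM2l.
rewrite [leLHS](_ : _ = C * G ^+ 3 * (2 * expR 2) * (h * h * h `^ (1 - al) * t n `^ (al - 3))); last by ring.
rewrite [leRHS](_ : _ = C * G ^+ 3 * (2 * expR 2) * (G * (h `^ al * (t n `^ (- al) / n%:R)))); last by rewrite /h; ring.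
apply: ler_wpM2l => //; apply: mulr_ge0 => //.
by rewrite mulr_ge0// exprn_ge0// ltW.
Qed.

(** Both singularities lie in this cell, that of v1 at 0 and that of the kernel at t_(n-theta).
    Splitting in the middle leaves one on each side, against a bounded factor. Since tau_1 = t_1,
    the weight on the right equals 1. *)
Lemma single_step_error : n = 1%N ->
  `|a n * (v (t n) - v (t n.-1)) - \int[mu]_(s in `]t n.-1, sg[) f s| <=
  3 * (C / al) * (2 * expR 2) * (step t n `^ al * (t n `^ (- al) / n%:R)).
Proof.
move=> n_1; have t0 : t n.-1 = 0 by rewrite n_1 /= (mesh0 mesh).
have st : step t n = t n by rewrite /step t0 subr0.
have sg0 : 0 < sg by rewrite -t0.
have -> : step t n `^ al * (t n `^ (- al) / n%:R) = 1.
  have n1R : n%:R = 1 :> R by rewrite n_1.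
  by rewrite st n1R divr1 powRN mulfV// gt_eqF// powR_gt0.
rewrite mulr1 t0; set y := sg / 2.
have y0 : 0 < y by rewrite divr_gt0.
have ysg : y < sg by rewrite /y; lra.
have e2 : 0 <= 2 * expR 2 :> R by rewrite mulr_ge0// expR_ge0.
have I : \int[mu]_(s in `]0, sg[) f s = \int[mu]_(s in `]0, y]) f s + \int[mu]_(s in `]y, sg[) f s.
  rewrite -(@Rintegral_itvB R f (BRight 0) (BLeft sg) y).
  - by rewrite addrC subrK.
  - exact: fi.
  - by rewrite bnd_simp ltW.
  - by rewrite bnd_simp.
have gy : g y = omega (1 - al) y by rewrite /g /omega_s; congr (omega _ _); rewrite /y; field.
have GV1 : (Gamma (1 - al))^-1 <= 2 * expR 2.
  exact: le_trans (Gamma1BV_le al01) GamV.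
have I1 : `|\int[mu]_(s in `]0, y]) f s| <= C / al * (2 * expR 2).
  rewrite -Rintegral_itv_bndo_bndc; last first.
    by apply: f_sub => //; [exact: ltW|rewrite bnd_simp ltW].
  apply: le_trans (origin_integral_le al01 T0 vr sgT fi y0 (ltW ysg) (c := g y) _) _.
    by move=> s s0 sy; apply: le_omega_s => //; exact: ltW.
  rewrite gy omegaE// powRN [leLHS](_ : _ = C / al * (Gamma (1 - al))^-1); first exact: ler_wpM2l.
  have G1 := Gamma1B_gt0 al01; field.
  by rewrite !gt_eqF// powR_gt0.
have I2 : `|\int[mu]_(s in `]y, sg[) f s| <= C / al * (2 * expR 2).
  have If : mu.-integrable `]y, sg[ (EFin \o f).
    by apply: f_sub; rewrite ?bnd_simp// ltW.
  have Ig : mu.-integrable `]y, sg[ (EFin \o g).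
    apply: integrableS (omega_s_integral al01 (ltW ysg) (lexx sg)).1 => //.
    by apply: subset_itv; rewrite ?bnd_simp.
  have Ig' : mu.-integrable `]y, sg[ (EFin \o (fun s => C * y `^ (al - 1) * g s)).
    by apply: eq_integrable (integrableZl _ (C * y `^ (al - 1)) Ig).
  apply: le_trans (le_normr_Rintegral _ If) _ => //.
  apply: (@le_trans _ _ (\int[mu]_(s in `]y, sg[) (C * y `^ (al - 1) * g s))).
    apply: le_Rintegral => //; first exact: integrable_norm If.
    move=> s /=; rewrite in_itv/= => /andP[ys ss].
    rewrite /f normrM (ger0_norm (omega_s_ge0 al01 sg s)) mulrC.
    apply: ler_wpM2r; first exact: omega_s_ge0.
    apply: le_trans (tr_b1 vr _) _; first by rewrite (lt_trans y0 ys) (lt_le_trans ss sgT).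
    apply: ler_wpM2l => //; rewrite -opprB !powRN lef_pV2 ?posrE ?powR_gt0 ?(lt_trans y0 ys)//.
    by apply: le_powRl; [move: al01; lra|exact: ltW|exact: ltW].
  rewrite RintegralZl//.
  have -> : \int[mu]_(s in `]y, sg[) g s = omega_prim al y.
    rewrite Rintegral_itv_bndo_bndc// Rintegral_itv_obnd_cbnd; last first.
      apply: integrableS (omega_s_integral al01 (ltW ysg) (lexx sg)).1 => //.
      by apply: subset_itv; rewrite ?bnd_simp.
    rewrite (omega_s_integral al01 (ltW ysg) (lexx sg)).2 subrr omega_prim0// subr0.
    by congr (omega_prim _ _); rewrite /y; field.
  rewrite /omega_prim -mulrA [y `^ (al - 1) * _]mulrA -powRD_gt0//.
  rewrite (_ : al - 1 + (1 - al) = 0); last by ring.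
  rewrite powRr0 mul1r; apply: ler_pM => //; first by rewrite invr_ge0 ltW.
  by rewrite ler_pdivlMr// ler_piMr// ltW//; case/andP: al01.
have A : `|a n * (v (t n) - v 0)| <= C / al * (2 * expR 2).
  have an : 0 <= a n <= step t n `^ (- al) * (2 * expR 2).
    rewrite (ltW (lt_le_trans _ (a_coef_last_ge mesh al01 nN)))/=; last first.
      by apply: divr_gt0 => //; rewrite mulr_gt0 ?powR_gt0.
    rewrite /a (a_coef_lastE' mesh al01 nN) -/th -mulrA.
    apply: (@le_trans _ _ (step t n `^ (- al) / Gamma (2 - al))).
      rewrite ler_piMl//; first by rewrite divr_ge0 ?powR_ge0// ltW.
      apply: (@le_trans _ _ ((1 - th) `^ 0)); last by rewrite powRr0.
      have al_ge0 : 0 <= al by case/andP: al01 => /ltW.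
      by apply: ger_powR; [rewrite th1 gerBl divr_ge0|rewrite subr_ge0 ltW//; case/andP: al01].
    by apply: ler_wpM2l => //; exact: powR_ge0.
  case/andP: an => an0 an1; rewrite normrM (ger0_norm an0).
  have H := time_holder_le al01 T0 vr (lexx 0) (ltW t_n_gt0) tn_T.
  rewrite subr0 -st in H.
  apply: (@le_trans _ _ (step t n `^ (- al) * (2 * expR 2) * (C / al * step t n `^ al))).
    by apply: ler_pM => //; rewrite -st.
  rewrite [leLHS](_ : _ = (step t n `^ al)^-1 * step t n `^ al * (C / al * (2 * expR 2))); last by rewrite powRN; ring.
  by rewrite mulVf ?mul1r// gt_eqF// powR_gt0.
rewrite I; apply: le_trans (ler_normB _ _) _.
rewrite [leRHS](_ : _ = C / al * (2 * expR 2) + (C / al * (2 * expR 2) + C / al * (2 * expR 2))); last by ring.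
by apply: lerD => //; apply: le_trans (ler_normD _ _) _; exact: lerD.
Qed.

(** The parts come from the interior cells (2 times 8), the first cell (3 times 4) and the last
    cell, for n = 1 and n >= 2; 2 e^2 bounds 1 / Gamma (2 - al). *)
Definition truncation_const : R := C / al * (16 * G ^+ 5 + 12 + (3 + G ^+ 4) * (2 * expR 2)).

Lemma D_tau_truncation :
  `|D_tau t al th (v \o t) n - \int[mu]_(s in `]0, sg[) f s| <=
  truncation_const * (step t n `^ al * (omega (1 - al) (t n) + t n `^ (- al) / n%:R)).
Proof.
have G1 := mesh_ge1 mesh; have G0 : 0 < G by lra.
have e2 : 0 <= 2 * expR 2 :> R by rewrite mulr_ge0// expR_ge0.
have CC : C <= C / al by rewrite ler_pdivlMr// ler_piMr// ltW//; case/andP: al01.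
set h := step t n `^ al; have h0 : 0 <= h by exact: powR_ge0.
set w := omega (1 - al) (t n); have w0 : 0 <= w by exact: omega_ge0.
set q := t n `^ (- al) / n%:R; have q0 : 0 <= q by rewrite divr_ge0 ?powR_ge0.
have G4 : 0 <= G ^+ 4 by rewrite exprn_ge0// ltW.
have G5 : 0 <= G ^+ 5 by rewrite exprn_ge0// ltW.
have hq : 0 <= h * q by rewrite mulr_ge0.
have hw : 0 <= h * w by rewrite mulr_ge0.
have KA := CA_ge0.
have E : n = n.-1.+1 by rewrite prednK.
have -> : D_tau t al th (v \o t) n =
  \sum_(1 <= k < n) (a k * (v (t k) - v (t k.-1))) + a n * (v (t n) - v (t n.-1)) +
  \sum_(1 <= k < n) (b k * ((v (t k.+1) - v (t k)) / Defs.ratio t k.+1 - (v (t k) - v (t k.-1)))).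
  by rewrite /a /b; rewrite {1}E D_tau_split -E.
have := @caputo_split n.-1; rewrite prednK// => -> //.
set S1 := \sum_(1 <= k < n) (a k * _); set S2 := \sum_(1 <= k < n) (b k * _).
set S3 := \sum_(1 <= k < n) \int[mu]_(s in _) _.
pose L := a n * (v (t n) - v (t n.-1)) - \int[mu]_(s in `]t n.-1, sg[) f s.
have -> : S1 + a n * (v (t n) - v (t n.-1)) + S2 - (S3 + \int[mu]_(s in `]t n.-1, sg[) f s) =
  L + (S1 - S3 + S2) by rewrite /L; ring.
apply: le_trans (ler_normD _ _) _.
have [n_1|n_1] := eqVneq n 1%N.
  have -> : S1 - S3 + S2 = 0 by rewrite /S1 /S2 /S3 n_1 !big_geq// subrr addr0.
  rewrite normr0 addr0; apply: le_trans (single_step_error n_1) _.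
  rewrite -/h -/q /truncation_const.
  have h1 : 0 <= C / al * (h * w) by rewrite mulr_ge0.
  have h2 : 0 <= C / al * (h * q) by rewrite mulr_ge0.
  have h3 : 0 <= C / al * (h * q) * (2 * expR 2) by rewrite mulr_ge0.
  have h4 := mulr_ge0 h3 G4; have h5 := mulr_ge0 h1 G5; have h6 := mulr_ge0 h2 G5.
  have h7 := mulr_ge0 h1 e2; have h8 := mulr_ge0 h7 G4.
  lra.
have n2 : (2 <= n)%N by rewrite ltn_neqAle eq_sym n_1 n1.
have HL := last_error n2; rewrite -/L -/h -/q in HL.
have HS : `|S1 - S3 + S2| <= 3 * (C / al) * h * g (t 1%N) +
    2 * C * G ^+ 5 * h * \sum_(2 <= k < n) (k%:R^-1 * (g (t k) - g (t k.-1))).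
  rewrite /S1 /S3 /S2 -sumrB -big_split/=.
  apply: le_trans (ler_norm_sum _ _ _) _.
  rewrite [leLHS]big_ltn//; apply: lerD.
    by apply: le_trans (ler_normD _ _) _; exact: first_total.
  rewrite mulr_sumr big_nat_cond [leRHS]big_nat_cond; apply: ler_sum => k.
  rewrite andbT => kn; apply: le_trans (ler_normD _ _) _.
  exact: interior_total.
have HV := weighted_variation mesh al01 nN n2.
have Hg : g (t 1%N) <= 4 * w by apply: (omega_node_half mesh al01 nN).
have h1 : 0 <= 3 * (C / al) * h by apply: mulr_ge0 => //; apply: mulr_ge0.
have h2 : 0 <= 2 * C * G ^+ 5 * h by do 2 apply: mulr_ge0 => //; exact: mulr_ge0.
have H1 := ler_wpM2l h1 Hg; have H2 := ler_wpM2l h2 HV.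
rewrite -/w in H2.
have HC1 : C * (G ^+ 5 * (h * w)) <= C / al * (G ^+ 5 * (h * w)).
  by apply: ler_wpM2r => //; exact: mulr_ge0.
have HC2 : C * (G ^+ 4 * (2 * expR 2) * (h * q)) <= C / al * (G ^+ 4 * (2 * expR 2) * (h * q)).
  by apply: ler_wpM2r => //; do 2 apply: mulr_ge0 => //.
have r1 : 0 <= C / al * (h * q) by exact: mulr_ge0.
have r2 := mulr_ge0 r1 G5; have r3 := mulr_ge0 r1 e2.
have r4 : 0 <= C / al * (h * w) by exact: mulr_ge0.
have r5 := mulr_ge0 r4 e2; have r6 := mulr_ge0 r5 G4.
apply: (@le_trans _ _ (C / al * (G ^+ 4 * (2 * expR 2) * (h * q)) +
    (12 * (C / al * (h * w)) + 16 * (C / al * (G ^+ 5 * (h * w)))))).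
  apply: lerD; first by apply: le_trans HL _; rewrite [leLHS](_ : _ = C * (G ^+ 4 * (2 * expR 2) * (h * q)))//; ring.
  apply: le_trans HS _; apply: lerD.
    by apply: le_trans H1 _; rewrite le_eqVlt; apply/orP; left; apply/eqP; ring.
  apply: le_trans H2 _; apply: (@le_trans _ _ (16 * (C * (G ^+ 5 * (h * w))))).
    by rewrite le_eqVlt; apply/orP; left; apply/eqP; ring.
  exact: ler_wpM2l.
rewrite -subr_ge0 /truncation_const [leRHS](_ : _ =
  16 * (C / al * (h * q) * G ^+ 5) + 12 * (C / al * (h * q)) + 3 * (C / al * (h * q) * (2 * expR 2)) +
  3 * (C / al * (h * w) * (2 * expR 2)) + C / al * (h * w) * (2 * expR 2) * G ^+ 4); last by ring.
by rewrite !addr_ge0// mulr_ge0.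
Qed.

End Truncation.

(** * Spatial differences of Sobolev functions *)

Lemma is_derive_comp_addr (R : realType) (f : R -> R) (c x df : R) :
  is_derive (x + c) 1 f df -> is_derive x 1 (fun y => f (y + c)) df.
Proof.
move=> dfx; have := @is_derive1_comp R f (fun y => y + c) x df 1 dfx.
by rewrite mulr1; apply; apply: is_derive_eq; rewrite addr0.
Qed.

(** * Trigonometric polynomials as test functions *)

Section Trigonometric.
Context {R : realType}.
Notation mu := (@lebesgue_measure R).
Variables (L : R).
Hypothesis L0 : 0 < L.
Let w := pi *+ 2 / L.

(** Trigonometric polynomials of period L. The frequency m+1 is never 0, so every nonconstant term
    has a periodic primitive; the class is closed under shifts, derivatives and products with the
    basic cosine. *)
Inductive trig : (R -> R) -> Prop :=
| trig_cst c : trig (fun=> c)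
| trig_cos c b (m : nat) : trig (fun x => c * cos (m.+1%:R * w * x + b))
| trig_add f g : trig f -> trig g -> trig (fun x => f x + g x).

Let w0 : 0 < w. Proof. by rewrite divr_gt0// pmulrn_lgt0// pi_gt0. Qed.

Lemma trigZ k f : trig f -> trig (fun x => k * f x).
Proof.
elim=> [c|c b m|f1 f2 _ t1 _ t2]; first exact: trig_cst.
  rewrite (_ : (fun _ => _) = (fun x => (k * c) * cos (m.+1%:R * w * x + b))); first exact: trig_cos.
  by apply/funext => x; rewrite mulrA.
rewrite (_ : (fun _ => _) = (fun x => k * f1 x + k * f2 x)); first exact: trig_add.
by apply/funext => x; rewrite mulrDr.
Qed.

Lemma trigB f g : trig f -> trig g -> trig (fun x => f x - g x).
Proof.
move=> tf tg; rewrite (_ : (fun _ => _) = (fun x => f x + (-1) * g x)).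
  by apply: trig_add => //; exact: trigZ.
by apply/funext => x; rewrite mulN1r.
Qed.

Lemma trig_shift s f : trig f -> trig (fun x => f (x + s)).
Proof.
elim=> [c|c b m|f1 f2 _ t1 _ t2]; first exact: trig_cst; last exact: trig_add.
rewrite (_ : (fun _ => _) = (fun x => c * cos (m.+1%:R * w * x + (m.+1%:R * w * s + b)))).
  exact: trig_cos.
by apply/funext => x; rewrite addrA -mulrDr.
Qed.

Lemma trig_periodic f (x : R) : trig f -> f (x + L) = f x.
Proof.
elim=> [//|c b m|f1 f2 _ t1 _ t2]; last by rewrite t1 t2.
congr (_ * _).
have -> : m.+1%:R * w * (x + L) + b = m.+1%:R * w * x + b + (pi *+ 2) *+ m.+1.
  by rewrite /w -[_ *+ 2 *+ _]mulr_natl; field; rewrite gt_eqF.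
move: (_ * x + b) => y; elim: m.+1 => [|k IH]; first by rewrite addr0.
by rewrite mulrSr addrA cosD2pi.
Qed.

Lemma trig_is_derive f : trig f ->
  exists2 f', trig f' & forall x : R, is_derive x 1 f (f' x).
Proof.
elim=> [c|c b m|f1 f2 _ [g1 t1 d1] _ [g2 t2 d2]].
- by exists (fun=> 0); [exact: trig_cst|move=> x; exact: is_derive_cst].
- exists (fun x => (c * (m.+1%:R * w)) * cos (m.+1%:R * w * x + (b + pi / 2))); first exact: trig_cos.
  move=> x; rewrite addrA cosDpihalf.
  by apply: is_derive_eq; rewrite /GRing.scale/= !mulr1; ring.
- by exists (fun x => g1 x + g2 x); [exact: trig_add|move=> x; exact: is_deriveD].
Qed.

Lemma trig_decomposition f : trig f ->
  exists m H, trig H /\ forall x : R, is_derive x 1 H (f x - m).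
Proof.
elim=> [c|c b m|f1 f2 _ [m1 [H1 [t1 d1]]] _ [m2 [H2 [t2 d2]]]].
- exists c, (fun=> 0); split; first exact: trig_cst.
  by move=> x; rewrite subrr; exact: is_derive_cst.
- have mw0 : m.+1%:R * w != 0 by rewrite mulf_neq0// gt_eqF.
  exists 0, (fun x => (- (c / (m.+1%:R * w))) * cos (m.+1%:R * w * x + (b + pi / 2))).
  split; first exact: trig_cos.
  move=> x; rewrite subr0.
  have -> : (fun x => - (c / (m.+1%:R * w)) * cos (m.+1%:R * w * x + (b + pi / 2))) =
            (fun x => c / (m.+1%:R * w) * sin (m.+1%:R * w * x + b)).
    by apply/funext => y; rewrite addrA cosDpihalf mulrNN.
  apply: is_derive_eq; rewrite /GRing.scale/= !mulr1.
  by rewrite addr0 mulrCA mulrAC divfK// mulrC.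
- exists (m1 + m2), (fun x => H1 x + H2 x); split; first exact: trig_add.
  by move=> x; rewrite opprD addrACA; exact: is_deriveD.
Qed.

Lemma trig_continuous f : trig f -> continuous f.
Proof. by move=> /trig_is_derive[f' _ d] x; exact: is_derive_continuous (d x). Qed.

Lemma trig_derive1 f : trig f -> trig (derive1 f) /\ forall x : R, is_derive x 1 f (derive1 f x).
Proof.
move=> tf; have [f' tf' d] := trig_is_derive tf.
have -> : derive1 f = f' by apply/funext => x; rewrite derive1E derive_val.
by split.
Qed.

Lemma trig_derive1n n f : trig f -> trig (derive1n n f).
Proof. by elim: n => [//|n IH] tf; rewrite derive1nS; exact: (trig_derive1 (IH tf)).1. Qed.

Lemma trig_mul_cos f : trig f -> trig (fun x => f x * cos (w * x)).
Proof.
elim=> [c|c b m|f1 f2 _ t1 _ t2].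
- rewrite (_ : (fun _ => _) = (fun x => c * cos (1%:R * w * x + 0))); first exact: trig_cos.
  by apply/funext => x; rewrite mul1r addr0.
- rewrite (_ : (fun _ => _) = (fun x => c / 2 * cos (m.+2%:R * w * x + b) + c / 2 * cos (m%:R * w * x + b))).
    apply: trig_add; first exact: trig_cos.
    case: m => [|m]; last exact: trig_cos.
    rewrite (_ : (fun _ => _) = (fun=> c / 2 * cos b)); first exact: trig_cst.
    by apply/funext => x; rewrite mul0r mul0r add0r.
  apply/funext => x.
  set y := m.+1%:R * w * x + b.
  have -> : m.+2%:R * w * x + b = y + w * x by rewrite /y -[m.+2%:R]natr1; ring.
  have -> : m%:R * w * x + b = y - w * x by rewrite /y -natr1; ring.
  rewrite -mulrDr cosB [in RHS]cosD addrACA addNr addr0 -mulr2n.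
  by rewrite mulrnAr -mulrnAl -[_ / _ *+ _]mulr_natr divfK ?mulrA// pnatr_eq0.
- rewrite (_ : (fun _ => _) = (fun x => f1 x * cos (w * x) + f2 x * cos (w * x))); first exact: trig_add.
  by apply/funext => x; rewrite mulrDl.
Qed.

Lemma trig_Rintegral_mean f m H a : trig f -> trig H ->
  (forall x : R, is_derive x 1 H (f x - m)) ->
  \int[mu]_(x in `[0, L]) f (x + a) = m * L.
Proof.
move=> tf tH dH.
have dH' (x : R) : is_derive x 1 (fun y : R => H (y + a) + m * y) (f (x + a)).
  rewrite -(subrK m (f _)); apply: is_deriveD; first exact: is_derive_comp_addr.
  by apply: is_derive_eq; rewrite /GRing.scale/= mulr1.
apply: etrans (Rintegral_FTC (ltW L0) (fun x _ => dH' x) _) _.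
  by apply: continuous_subspaceT => x; exact: (trig_continuous (trig_shift a tf)).
by rewrite add0r [L + a]addrC trig_periodic// mulr0 addr0 addrC addKr.
Qed.

Definition fwd (s : R) (f : R -> R) (x : R) : R := f (x + s) - f x.

(** [g] is the integral of [f] over [x, x + s]. A difference of a kernel is thus the derivative of a
    kernel that is still nonnegative and whose mass is known, which is how differences are handed
    over to weak derivatives. *)
Lemma trig_average f s : trig f -> (forall x, 0 <= f x) -> 0 <= s ->
  exists g, [/\ trig g, forall x, 0 <= g x, derive1 g = fwd s f &
    forall a, \int[mu]_(x in `[0, L]) g (x + a) = s * \int[mu]_(x in `[0, L]) f (x + a)].
Proof.
move=> tf f0 s0; have [m [H [tH dH]]] := trig_decomposition tf.
pose P x := m * x + H x.
have dP (x : R) : is_derive x 1 P (f x).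
  by rewrite -(subrKC m (f x)); apply: is_deriveD; apply: is_derive_eq; rewrite /GRing.scale/= mulr1.
pose g x := P (x + s) - P x.
have gE : g = fun x => m * s + (H (x + s) - H x).
  by apply/funext => x; rewrite /g /P; ring.
have tg : trig g.
  by rewrite gE; apply: trig_add; [exact: trig_cst|apply: trigB => //; exact: trig_shift].
have dg (x : R) : is_derive x 1 g (fwd s f x).
  by apply: is_deriveB => //; exact: is_derive_comp_addr.
exists g; split => //.
- move=> x; rewrite /g -(@Rintegral_FTC _ f P x (x + s)) ?lerDl//.
    by apply: Rintegral_ge0 => y _; exact: f0.
  by apply: continuous_subspaceT => y; exact: trig_continuous.
- by apply/funext => x; rewrite derive1E derive_val.
- move=> a; rewrite (trig_Rintegral_mean a tf tH dH).
  have [m2 [H2 [tH2 dH2]]] := trig_decomposition tH.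
  apply: etrans (trig_Rintegral_mean (m := m * s) (H := fun x => H2 (x + s) - H2 x) a tg _ _) _; last by ring.
    by apply: trigB => //; exact: trig_shift.
  move=> x; rewrite gE addrC addKr.
  rewrite (_ : _ - H x = (H (x + s) - m2) - (H x - m2)); last by ring.
  exact: is_deriveB (is_derive_comp_addr (dH2 _)) (dH2 _).
Qed.

Lemma trig_Rintegral_shift f a : trig f ->
  \int[mu]_(x in `[0, L]) f (x + a) = \int[mu]_(x in `[0, L]) f x.
Proof.
move=> tf; have [m [H [tH dH]]] := trig_decomposition tf.
rewrite (trig_Rintegral_mean a tf tH dH) -(trig_Rintegral_mean 0 tf tH dH).
by congr (Rintegral _ _ _); apply/funext => x; rewrite addr0.
Qed.

Lemma trig_fwd s f : trig f -> trig (fwd s f).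
Proof. by move=> tf; apply: trigB => //; exact: trig_shift. Qed.

Lemma derive1n_fwd n s f : trig f -> derive1n n (fwd s f) = fwd s (derive1n n f).
Proof.
move=> tf; elim: n => [//|n IH]; rewrite !derive1nS IH; apply/funext => x.
have [_ d] := trig_derive1 (trig_derive1n n tf).
have := is_derive_comp_addr (d (x + s)) => /is_deriveB/(_ (d x)) d2.
by rewrite derive1E; exact: derive_val.
Qed.

Lemma trig_average_iter k s f : trig f -> (forall x, 0 <= f x) -> 0 <= s ->
  exists g, [/\ trig g, forall x, 0 <= g x, derive1n k g = iter k (fwd s) f &
    \int[mu]_(x in `[0, L]) g x = s ^+ k * \int[mu]_(x in `[0, L]) f x].
Proof.
move=> tf f0 s0; elim: k => [|k [g [tg g0 gk gi]]].
  by exists f; split => //; rewrite expr0 mul1r.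
have [h [th h0 hk hi]] := trig_average tg g0 s0; exists h; split => //.
  by rewrite derive1Sn hk derive1n_fwd// gk.
have := hi 0; rewrite !trig_Rintegral_shift// gi => ->.
by rewrite mulrA -exprS.
Qed.

(** Equal to cos^2 (w x / 2): it reaches its maximum 1 only at multiples of L, so its normalised
    powers concentrate there while remaining trigonometric polynomials. *)
Definition bump (x : R) : R := (1 + cos (w * x)) / 2.

Lemma bump_ge0 x : 0 <= bump x.
Proof. by rewrite divr_ge0// -lerBlDl sub0r cos_geN1. Qed.

Lemma bump_le1 x : bump x <= 1.
Proof. by rewrite ler_pdivrMr// mul1r -[leRHS]/(1 + 1)%R lerD2l cos_le1. Qed.

Lemma trig_bump n : trig (fun x => bump x ^+ n).
Proof.
elim: n => [|n IH]; first by under eq_fun do rewrite expr0; exact: trig_cst.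
rewrite (_ : (fun _ => _) = (fun x => 2^-1 * (bump x ^+ n) + 2^-1 * (bump x ^+ n * cos (w * x)))).
  by apply: trig_add; apply: trigZ => //; exact: trig_mul_cos.
by apply/funext => x; rewrite exprS [in LHS]/bump; field.
Qed.

Definition bump_mass n : R := \int[mu]_(x in `[0, L]) bump x ^+ n.

(* [bump^n sin(w x)] is periodic with derivative [w ((2n+2) bump^(n+1) - (2n+1) bump^n)]. *)
Lemma bump_massS n : bump_mass n - bump_mass n.+1 = bump_mass n / n.+1.*2%:R.
Proof.
have db (x : R) : is_derive x 1 (fun y : R => bump y ^+ n * sin (w * y))
    (w * n.+1.*2%:R * bump x ^+ n.+1 - w * n.*2.+1%:R * bump x ^+ n).
  have dbump : is_derive x 1 bump (- (w / 2) * sin (w * x)).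
    rewrite /bump; apply: is_derive_eq; rewrite /GRing.scale/= !mulr1.
    by rewrite mulr0 mulr0 !add0r mul1r; move: (w) (sin _) => u S; field.
  have dsin : is_derive x 1 (fun y : R => sin (w * y)) (w * cos (w * x)).
    by apply: is_derive_eq; rewrite /GRing.scale/= !mulr1 mulrC.
  have dpow : is_derive x 1 (fun y : R => bump y ^+ n) (n%:R * bump x ^+ n.-1 * (- (w / 2) * sin (w * x))).
    rewrite (_ : (fun y : R => bump y ^+ n) = bump ^+ n); last by apply/funext => y; rewrite exprfctE.
    exact: is_deriveX.
  apply: is_derive_eq; rewrite /GRing.scale/=.
  have S2 : sin (w * x) * sin (w * x) = 4 * bump x * (1 - bump x).
    have := cos2Dsin2 (w * x); rewrite /bump !expr2; move: (cos _) (sin _) => C S; nra.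
  have CE : cos (w * x) = 2 * bump x - 1 by rewrite /bump; field.
  rewrite -!muln2 -[(n * 2).+1%:R]natr1 !natrM -[n.+1%:R]natr1 CE.
  have E : n%:R * bump x ^+ n.-1 * bump x = n%:R * bump x ^+ n.
    by case: (n) => [|k]; rewrite ?mul0r// -mulrA -exprSr.
  rewrite [sin _ * _]mulrCA [sin _ * _]mulrCA S2.
  rewrite (_ : _ * _ * (_ * (4 * _ * _)) = (n%:R * bump x ^+ n.-1 * bump x) * (- (w / 2) * 4 * (1 - bump x))); last by ring.
  rewrite E exprS; move: (w) (bump x) (bump x ^+ n) (n%:R) => u b p q.
  by field.
have tb k : mu.-integrable `[0, L] (EFin \o (fun x : R => bump x ^+ k)).
  apply: continuous_itv_integrable; apply: continuous_subspaceT.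
  exact: trig_continuous (trig_bump k).
have tZ c k : mu.-integrable `[0, L] (EFin \o (fun x : R => c * bump x ^+ k)).
  by apply: eq_integrable (integrableZl _ c (tb k)).
have : \int[mu]_(x in `[0, L]) (w * n.+1.*2%:R * bump x ^+ n.+1 - w * n.*2.+1%:R * bump x ^+ n) = 0.
  apply: etrans (Rintegral_FTC (ltW L0) (fun x _ => db x) _) _.
    apply: continuous_subspaceT; apply: trig_continuous; apply: trigB; apply: trigZ; exact: trig_bump.
  by rewrite mulr0 sin0 mulr0 subr0 divfK ?gt_eqF// -[pi *+ 2]add0r sinD2pi sin0 mulr0.
rewrite RintegralB// !RintegralZl// -/(bump_mass n) -/(bump_mass n.+1) -[w * _ * bump_mass n.+1]mulrA -[w * _ * bump_mass n]mulrA -mulrBr => /eqP.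
rewrite mulf_eq0 gt_eqF//= subr_eq0 => /eqP E.
have n0 : n.+1.*2%:R != 0 :> R by rewrite pnatr_eq0.
apply: (mulfI n0); rewrite mulrBr E [_ * (_ / _)]mulrC divfK// -mulrBl.
rewrite (_ : n.+1.*2 = n.*2.+2)// -[n.*2.+2%:R]natr1 addrAC subrr add0r mul1r//.
Qed.

Lemma bump_mass_gt0 n : 0 < bump_mass n.
Proof.
elim: n => [|n IH].
  rewrite /bump_mass; under eq_Rintegral do rewrite expr0.
  by rewrite Rintegral_cst_itv ?subr0 ?mul1r// ltW.
have E := bump_massS n.
rewrite -[bump_mass n.+1](subKr (bump_mass n)) E -[X in X - _]mulr1 -mulrBr.
by rewrite mulr_gt0// subr_gt0 invf_lt1 ?ltr1n ?ltr0n.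
Qed.

Lemma bump_eq1 x : bump x = 1 -> exists z : int, x = z%:~R * L.
Proof.
move=> b1; have c1 : cos (w * x) = 1.
  have : cos (w * x) = 2 * bump x - 1 by rewrite /bump; field.
  by rewrite b1 => ->; ring.
have per n y : cos (w * (y + n%:R * L)) = cos (w * y).
  elim: n => [|n IH]; first by rewrite mul0r addr0.
  rewrite -natr1 mulrDl mul1r addrA -IH.
  have -> : w * (y + n%:R * L + L) = w * (y + n%:R * L) + pi *+ 2.
    by rewrite mulrDr divfK// gt_eqF.
  by rewrite cosD2pi.
exists (Num.floor (x / L)); set z := Num.floor (x / L).
pose r := x - z%:~R * L.
have r0 : 0 <= r by rewrite subr_ge0 -ler_pdivlMr// floor_le_tmp.
have rL : r < L.
  rewrite ltrBlDl -[X in _ + X]mul1r -mulrDl -ltr_pdivrMr// -[X in _ + X]/(1%:~R) -intrD.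
  by rewrite floorD1_gt.
have cr : cos (w * r) = 1.
  case E : z => [n|n].
    by rewrite -c1 -(per n r) /r E subrK.
  by rewrite -c1 -(per n.+1 x) /r E NegzE mulrNz mulNr opprK.
have wr0 : 0 <= w * r by rewrite mulr_ge0// ltW.
have wr2 : w * r < pi *+ 2 by rewrite -[ltRHS](divfK (negbT (gt_eqF L0))) ltr_pM2l.
suff : w * r = 0.
  by move=> /eqP; rewrite mulf_eq0 gt_eqF//= subr_eq0 => /eqP.
have pi0 : 0 <= pi :> R by rewrite ltW// pi_gt0.
have [wrp|wrp] := lerP (w * r) pi.
  by apply: (@cos_inj R); rewrite ?in_itv/= ?wr0 ?wrp ?lexx ?pi0// cr cos0.
have : pi *+ 2 - w * r = 0.
  apply: (@cos_inj R); rewrite ?in_itv/= ?lexx ?pi0//.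
    by rewrite subr_ge0 (ltW wr2) lerBlDr mulr2n lerD2l ltW.
  by rewrite addrC cosD2pi cosN cr cos0.
move/eqP; rewrite subr_eq0 => /eqP E.
by move: wr2; rewrite E ltxx.
Qed.

End Trigonometric.

(** * Product kernels on the torus and their concentration *)

Section Tensor.
Context {R : realType}.
Notation mu := (@lebesgue_measure R).
Notation mu2 := (mu \x mu)%E.
Variables (L : R).
Hypothesis L0 : 0 < L.

Definition tens (f g : R -> R) (p : R * R) : R := f p.1 * g p.2.

Lemma is_derive_dx (f g : R -> R) (p : R * R) : is_derive p.1 1 f (derive1 f p.1) ->
  is_derive p (1, 0) (tens f g) (tens (derive1 f) g p).
Proof.
move=> [df1 df2].
have E : (fun h : R => h^-1 *: ((tens f g \o shift p) (h *: (1, 0)) - tens f g p)) =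
         (fun h : R => g p.2 *: (h^-1 *: ((f \o shift p.1) (h *: (1:R)) - f p.1))).
  apply/funext => h; rewrite /tens /shift /= /GRing.scale/= mulr0 add0r -mulrBl.
  by rewrite [RHS]mulrCA [g _ * _]mulrC.
have D : (fun h : R => h^-1 *: ((tens f g \o shift p) (h *: (1, 0)) - tens f g p)) @ 0^' -->
    (tens (derive1 f) g p : R).
  rewrite E /tens mulrC; apply: cvgZr; rewrite derive1E; exact: df1.
by apply: DeriveDef; [apply/cvg_ex; exists (tens (derive1 f) g p)|exact: cvg_lim D].
Qed.

Lemma is_derive_dy (f g : R -> R) (p : R * R) : is_derive p.2 1 g (derive1 g p.2) ->
  is_derive p (0, 1) (tens f g) (tens f (derive1 g) p).
Proof.
move=> [df1 df2].
have E : (fun h : R => h^-1 *: ((tens f g \o shift p) (h *: (0, 1)) - tens f g p)) =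
         (fun h : R => f p.1 *: (h^-1 *: ((g \o shift p.2) (h *: (1:R)) - g p.2))).
  apply/funext => h; rewrite /tens /shift /= /GRing.scale/= mulr0 add0r -mulrBr.
  by rewrite mulrCA.
have D : (fun h : R => h^-1 *: ((tens f g \o shift p) (h *: (0, 1)) - tens f g p)) @ 0^' -->
    (tens f (derive1 g) p : R).
  rewrite E /tens; apply: cvgZr; rewrite derive1E; exact: df1.
by apply: DeriveDef; [apply/cvg_ex; exists (tens f (derive1 g) p)|exact: cvg_lim D].
Qed.

Lemma pderiv_tens a b (f g : R -> R) : trig L f -> trig L g ->
  pderiv a b (tens f g) = tens (derive1n a f) (derive1n b g).
Proof.
move=> tf tg; rewrite /pderiv; have -> : iter b dy (tens f g) = tens f (derive1n b g).
  elim: b => [//|b IH]; rewrite iterS IH; apply/funext => p.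
  have [_ d] := trig_derive1 (trig_derive1n b tg).
  by case: (is_derive_dy f (d p.2)).
elim: a => [//|a IH]; rewrite iterS IH; apply/funext => p.
have [_ d] := trig_derive1 (trig_derive1n a tf).
by case: (is_derive_dx (derive1n b g) (d p.1)).
Qed.

Lemma continuous_tens (f g : R -> R) : continuous f -> continuous g -> continuous (tens f g).
Proof.
move=> cf cg p; apply: cvgM.
- by apply: (@continuous_comp _ _ _ fst f); [exact: cvg_fst|exact: cf].
- by apply: (@continuous_comp _ _ _ snd g); [exact: cvg_snd|exact: cg].
Qed.

Lemma Ck_tens k (f g : R -> R) : trig L f -> trig L g -> Ck k (tens f g).
Proof.
move=> tf tg a b _; rewrite pderiv_tens//.
have ta := trig_derive1n a tf; have tb := trig_derive1n b tg; split.
  exact: continuous_tens (trig_continuous ta) (trig_continuous tb).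
move=> _ p; split.
  by case: (is_derive_dx (derive1n b g) ((trig_derive1 ta).2 p.1)).
by case: (is_derive_dy (derive1n a f) ((trig_derive1 tb).2 p.2)).
Qed.

Lemma periodic_tens (f g : R -> R) : trig L f -> trig L g -> Defs.periodic L (tens f g).
Proof. by move=> tf tg x y; rewrite /tens /= !trig_periodic. Qed.

Lemma measurable_cell : measurable (cell L : set (measurableTypeR R * measurableTypeR R)).
Proof. by apply: measurableX. Qed.

Lemma mu2_cell : mu2 (cell L) = (L * L)%:E.
Proof.
rewrite /cell product_measure1E//= lebesgue_measure_itv/= lte_fin L0 -EFinB.
by rewrite oppr0 addr0 -EFinM.
Qed.

Lemma measurable_tens (f g : R -> R) : continuous f -> continuous g ->
  measurable_fun setT (tens f g).
Proof.
move=> cf cg; apply: measurable_funM.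
- by apply: measurableT_comp => //; exact: continuous_measurable_fun.
- by apply: measurableT_comp => //; exact: continuous_measurable_fun.
Qed.

Lemma integral_tens (f g : R -> R) : continuous f -> continuous g ->
  (forall x, 0 <= f x) -> (forall x, 0 <= g x) ->
  \int[mu2]_(p in cell L) tens f g p =
  \int[mu]_(x in `[0, L]) f x * \int[mu]_(x in `[0, L]) g x.
Proof.
move=> cf cg f0 g0.
have fi : mu.-integrable `[0, L] (EFin \o f).
  by apply: continuous_itv_integrable; exact: continuous_subspaceT.
have gi : mu.-integrable `[0, L] (EFin \o g).
  by apply: continuous_itv_integrable; exact: continuous_subspaceT.
pose F := (EFin \o f) \_ `[0, L]; pose G := (EFin \o g) \_ `[0, L].
have F0 x : (0 <= F x)%E by apply: erestrict_ge0 => ? _; rewrite lee_fin.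
have G0 x : (0 <= G x)%E by apply: erestrict_ge0 => ? _; rewrite lee_fin.
have mF : measurable_fun setT F.
  apply/(measurable_restrictT _ _).1 => //.
  exact: (measurable_int mu fi).
have mG : measurable_fun setT G.
  apply/(measurable_restrictT _ _).1 => //.
  exact: (measurable_int mu gi).
have E : (fun p => (tens f g p)%:E) \_ (cell L) = (fun p : R * R => F p.1 * G p.2)%E.
  apply/funext => -[x y]; rewrite /F /G !patchE /tens /=.
  have -> : ((x, y) \in cell L) = (x \in `[0, L]%classic) && (y \in `[0, L]%classic).
    by apply/idP/andP; rewrite !inE.
  rewrite -[point]/(0%E : \bar R).
  by case: (x \in _); case: (y \in _); rewrite /= ?mule0 ?mul0e.
rewrite {1}/Rintegral integral_mkcond E fubini_tonelli1//=; last 2 first.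
- apply: emeasurable_funM.
  + exact: (measurableT_comp mF).
  + exact: (measurableT_comp mG).
- by move=> p; exact: mule_ge0.
rewrite /fubini_F/=.
under eq_integral do rewrite ge0_integralZl//.
rewrite ge0_integralZr//; last exact: integral_ge0.
rewrite /F /G -!integral_mkcond/= !EFin_Rintegral//.
Qed.

Lemma tens_bounded_integrable (v : R * R -> R) (C : R) (f g : R -> R) :
  continuous f -> continuous g -> measurable_fun (cell L) v ->
  {ae mu2, forall p, cell L p -> `|v p| <= C} ->
  mu2.-integrable (cell L) (EFin \o (fun p => v p * tens f g p)).
Proof.
move=> cf cg mv vC; have mD := measurable_cell.
have vi : mu2.-integrable (cell L) (EFin \o v).
  apply/integrableP; split; first exact/measurable_EFinP.
  apply: (@le_lt_trans _ _ (\int[mu2]_(p in cell L) (Num.max C 0)%:E)%E).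
    apply: ae_ge0_le_integral => //=.
    - by apply/measurable_EFinP; exact: measurableT_comp.
    - by move=> p _; rewrite lee_fin le_max lexx orbT.
    - have [N [mN N0 sub]] := vC; exists N; split => //; apply: subset_trans sub.
      by apply: subsetC => p H /H; rewrite lee_fin le_max => ->.
  by rewrite integral_cst// [X in (_ * X)%E]mu2_cell -EFinM ltry.
have : mu2.-integrable (cell L) ((EFin \o tens f g) \* (EFin \o v))%E.
  apply: integrableMr => //.
    exact: measurable_funS (measurable_tens cf cg).
  have cc : compact (cell L).
    by apply: compact_setX; exact: segment_compact.
  have : compact (tens f g @` cell L).
    apply: continuous_compact cc; apply: continuous_subspaceT; exact: continuous_tens.
  move/compact_bounded => -[M [Mr HM]]; exists M; split => // x Mx p pc.
  by apply: HM Mx _ _; exists p.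
apply: eq_integrable => // p _ /=.
by rewrite mulrC EFinM.
Qed.

Lemma tens_integrable (f g : R -> R) : continuous f -> continuous g ->
  mu2.-integrable (cell L) (EFin \o tens f g).
Proof.
move=> cf cg; have H : {ae mu2, forall p, cell L p -> `|1 : R| <= 1} by apply: aeW => p _; rewrite normr1.
have := @tens_bounded_integrable (fun=> 1) 1 f g cf cg (measurable_cst (1 : R)) H.
by apply: eq_integrable => [|p _ /=]; [exact: measurable_cell|rewrite mul1r].
Qed.

Local Notation ker n a := (fun x => bump L (x - a) ^+ n).

Lemma ker_trig n a : trig L (ker n a).
Proof. by have := trig_shift (- a) (trig_bump L n). Qed.

Lemma ker_mass n a : \int[mu]_(x in `[0, L]) ker n a x = bump_mass L n.
Proof. exact: trig_Rintegral_shift (- a) (trig_bump L n). Qed.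

Lemma periodic_int (u : R * R -> R) (x y : R) (m n : int) : Defs.periodic L u ->
  u (x + m%:~R * L, y + n%:~R * L) = u (x, y).
Proof.
move=> pu.
have Hx (k : nat) z y' : u (z + k%:R * L, y') = u (z, y').
  elim: k => [|k IH]; first by rewrite mul0r addr0.
  by rewrite -natr1 mulrDl mul1r addrA (pu _ _).1.
have Hy (k : nat) z x' : u (x', z + k%:R * L) = u (x', z).
  elim: k => [|k IH]; first by rewrite mul0r addr0.
  by rewrite -natr1 mulrDl mul1r addrA (pu _ _).2.
have -> : u (x + m%:~R * L, y + n%:~R * L) = u (x, y + n%:~R * L).
  case: m => k; first exact: Hx.
  by rewrite NegzE mulrNz mulNr -(Hx k.+1) subrK.
case: n => k; first exact: Hy.
by rewrite NegzE mulrNz mulNr -(Hy k.+1) subrK.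
Qed.

Lemma continuous_bump : continuous (bump L).
Proof.
have := trig_continuous (trig_bump L 1).
by rewrite (_ : (fun _ => _) = bump L)//; apply/funext => x; rewrite expr1.
Qed.

(** Where u differs from u(a, b) by at least [e], a compact set, the bracket is positive, as it
    vanishes only at the periodic images of (a, b); its minimum there determines A. This replaces a
    modulus of continuity by an expression whose integral against the kernels is known exactly. *)
Lemma continuous_osc (u : R * R -> R) (a b e : R) : continuous u ->
  Defs.periodic L u -> 0 < e -> exists2 A, 0 <= A & forall p, cell L p ->
  `|u p - u (a, b)| <= e + A * ((1 - bump L (p.1 - a)) + (1 - bump L (p.2 - b))).
Proof.
move=> cu pu e0.
pose D (p : R * R) := (1 - bump L (p.1 - a)) + (1 - bump L (p.2 - b)).
have D0 p : 0 <= D p by rewrite addr_ge0// subr_ge0 bump_le1.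
have cs c : continuous (fun x : R => 1 - bump L (x - c)).
  move=> x; apply: cvgB; first exact: cvg_cst.
  apply: (@continuous_comp _ _ _ (fun x => x - c) (bump L)); last exact: continuous_bump.
  by apply: cvgB; [exact: cvg_id|exact: cvg_cst].
have cD : continuous D.
  move=> p; apply: cvgD.
  - by apply: (@continuous_comp _ _ _ fst (fun x : R => 1 - bump L (x - a))); [exact: cvg_fst|exact: cs].
  - by apply: (@continuous_comp _ _ _ snd (fun x : R => 1 - bump L (x - b))); [exact: cvg_snd|exact: cs].
have cU : continuous (fun p => `|u p - u (a, b)|).
  by move=> p; apply: cvg_norm; apply: cvgB; [exact: cu|exact: cvg_cst].
have cc : compact (cell L) by apply: compact_setX; exact: segment_compact.
pose S := cell L `&` [set p | e <= `|u p - u (a, b)|].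
have cS : compact S.
  apply: compact_closedI => //.
  by apply: closed_comp (@closed_ge R e) => p _; exact: cU.
have [/eqP S0|/set0P S0] := boolP (S == set0).
  exists 0 => // p pc; rewrite mul0r addr0 leNgt; apply/negP => H.
  have Sp : S p by split => //; exact: ltW.
  by move: Sp; rewrite S0.
have [p0] := compact_EVT_min S0 cS (continuous_subspaceT cD); rewrite inE => -[p0c p0e] p0min.
have [q _ qmax] := compact_EVT_max (ex_intro _ p0 p0c) cc (continuous_subspaceT cU).
have Dp0 : 0 < D p0.
  rewrite lt_neqAle D0 andbT eq_sym; apply/negP; rewrite paddr_eq0 ?subr_ge0 ?bump_le1//.
  rewrite !subr_eq0 => /andP[/eqP/esym/bump_eq1-/(_ L0)[m Em] /eqP/esym/bump_eq1-/(_ L0)[n En]].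
  move: p0e; rewrite /= leNgt => /negP; apply.
  have -> : p0 = (a + m%:~R * L, b + n%:~R * L).
    by rewrite -Em -En !subrKC; case: (p0).
  by rewrite periodic_int// subrr normr0.
exists (`|u q - u (a, b)| / D p0); first exact: divr_ge0.
move=> p pc; have [pe|pe] := lerP e `|u p - u (a, b)|; last first.
  rewrite (le_trans (ltW pe))// lerDl; apply: mulr_ge0; first exact: divr_ge0.
  exact: D0.
have pS : p \in S by rewrite inE.
apply: (@le_trans _ _ (`|u q - u (a, b)|)); first by apply: qmax; rewrite inE.
rewrite -/(D p) -[leLHS]add0r lerD// ?(ltW e0)// mulrAC -mulrA ler_peMr// ler_pdivlMr// mul1r.
exact: p0min.
Qed.

Lemma bounded_cell (u : R * R -> R) : continuous u ->
  exists C, {ae mu2, forall p, cell L p -> `|u p| <= C}.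
Proof.
move=> cu.
have cc : compact (cell L) by apply: compact_setX; exact: segment_compact.
have cU : continuous (fun p => `|u p|) by move=> p; apply: cvg_norm; exact: cu.
have c0 : cell L (0, 0) by split; rewrite /= in_itv/= lexx ltW.
have [q _ qmax] := compact_EVT_max (ex_intro _ (0, 0) c0) cc (continuous_subspaceT cU).
by exists `|u q|; apply: aeW => p pc; apply: qmax; rewrite inE.
Qed.

(** Against the kernel each deficit 1 - bump integrates to (m_n - m_(n+1)) m_n, which is m_n^2 / (2n
    + 2) by [bump_massS]; the two coordinates together give A / (n + 1). *)
Lemma concentration (u : R * R -> R) (a b e : R) : continuous u ->
  Defs.periodic L u -> measurable_fun (cell L) u -> 0 < e ->
  exists2 A, 0 <= A & forall n,
  `|\int[mu2]_(p in cell L) (u p * tens (ker n a) (ker n b) p) - u (a, b) * bump_mass L n ^+ 2|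
  <= (e + A / n.+1%:R) * bump_mass L n ^+ 2.
Proof.
move=> cu pu mu_ e0; have [A A0 Au] := continuous_osc a b cu pu e0; exists A => // n.
set m := bump_mass L n.
have ck k c := trig_continuous (ker_trig k c).
have k0 k c (x : R) : 0 <= ker k c x by rewrite exprn_ge0// bump_ge0.
pose t := tens (ker n a) (ker n b).
pose t1 := tens (ker n.+1 a) (ker n b); pose t2 := tens (ker n a) (ker n.+1 b).
have t0 p : 0 <= t p by rewrite mulr_ge0.
have It : mu2.-integrable (cell L) (EFin \o t) by exact: tens_integrable.
have It1 : mu2.-integrable (cell L) (EFin \o t1) by exact: tens_integrable.
have It2 : mu2.-integrable (cell L) (EFin \o t2) by exact: tens_integrable.
have [C uC] := bounded_cell cu.
have Iu : mu2.-integrable (cell L) (EFin \o (fun p => u p * t p)).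
  exact: tens_bounded_integrable uC.
have mD := measurable_cell.
have Z c (f : R * R -> R) : mu2.-integrable (cell L) (EFin \o f) ->
    mu2.-integrable (cell L) (EFin \o (fun p => c * f p)).
  by move=> If; apply: eq_integrable (integrableZl _ c If).
have IB (f g : R * R -> R) : mu2.-integrable (cell L) (EFin \o f) ->
    mu2.-integrable (cell L) (EFin \o g) ->
    mu2.-integrable (cell L) (EFin \o (fun p => f p - g p)).
  by move=> If Ig; apply: eq_integrable (integrableB mD If Ig).
have Et : \int[mu2]_(p in cell L) t p = m ^+ 2.
  by rewrite /t integral_tens// !ker_mass -expr2.
have Et1 : \int[mu2]_(p in cell L) t1 p = bump_mass L n.+1 * m.
  by rewrite /t1 integral_tens// !ker_mass.
have Et2 : \int[mu2]_(p in cell L) t2 p = m * bump_mass L n.+1.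
  by rewrite /t2 integral_tens// !ker_mass.
have I1 : mu2.-integrable (cell L) (EFin \o (fun p => u p * t p - u (a, b) * t p)).
  exact: IB Iu (Z _ _ It).
have I2 : mu2.-integrable (cell L) (EFin \o (fun p => A * t1 p + A * t2 p)).
  by apply: eq_integrable (integrableD mD (Z A _ It1) (Z A _ It2)).
have I3 : mu2.-integrable (cell L) (EFin \o (fun p => (e + 2 * A) * t p - (A * t1 p + A * t2 p))).
  exact: IB (Z _ _ It) I2.
have -> : (e + A / n.+1%:R) * m ^+ 2 =
    \int[mu2]_(p in cell L) ((e + 2 * A) * t p - (A * t1 p + A * t2 p)).
  rewrite RintegralB//; last exact: Z.
  rewrite RintegralD//; [|exact: Z|exact: Z].
  rewrite !RintegralZl// Et Et1 Et2.
  have := bump_massS L0 n; rewrite -/m => /(congr1 (fun x => m - x)); rewrite subKr => ->.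
  have : n.+1%:R != 0 :> R by rewrite pnatr_eq0.
  by rewrite -muln2 natrM; move: (n.+1%:R) => x x0; field.
rewrite -Et -(RintegralZl _ mD It) -RintegralB//; last exact: Z.
apply: le_trans (le_normr_Rintegral mD I1) _.
apply: le_Rintegral => //; first exact: integrable_norm I1.
move=> p pc; rewrite -mulrBl normrM (ger0_norm (t0 p)).
apply: le_trans (ler_wpM2r (t0 p) (Au p pc)) _.
rewrite /t1 /t2 /t /tens /= le_eqVlt; apply/orP; left; apply/eqP.
by rewrite !exprS; ring.
Qed.

End Tensor.

(** * From weak derivatives to differences *)

Section WeakDifferences.
Context {R : realType}.
Notation mu := (@lebesgue_measure R).
Notation mu2 := (mu \x mu)%E.
Variables (L : R).
Hypothesis L0 : 0 < L.

Lemma ae_cell_bound_ge0 (v : R * R -> R) C :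
  {ae mu2, forall p, cell L p -> `|v p| <= C} -> 0 <= C.
Proof.
move=> [N [mN N0 sub]]; rewrite leNgt; apply/negP => C0.
have cN : cell L `<=` N.
  move=> p pc; apply: sub => /= H.
  by have := le_lt_trans (H pc) C0; rewrite ltNge normr_ge0.
have : (mu2 (cell L) <= mu2 N)%E by apply: le_measure => //; rewrite inE//; exact: measurable_cell.
by rewrite [X in (_ <= X)%E]N0 [X in (X <= _)%E]mu2_cell// lee_fin leNgt mulr_gt0.
Qed.

Lemma ae_bound_tens (v : R * R -> R) C (f g : R -> R) :
  continuous f -> continuous g -> (forall x : R, 0 <= f x) -> (forall x : R, 0 <= g x) ->
  measurable_fun (cell L) v -> {ae mu2, forall p, cell L p -> `|v p| <= C} ->
  `|\int[mu2]_(p in cell L) (v p * tens f g p)| <=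
  C * \int[mu2]_(p in cell L) tens f g p.
Proof.
move=> cf cg f0 g0 mv vC; have C0 := ae_cell_bound_ge0 vC.
have mD := @measurable_cell R L.
have I := tens_bounded_integrable L0 cf cg mv vC.
have It := tens_integrable L0 cf cg.
have ICt : mu2.-integrable (cell L) (EFin \o (fun p => C * tens f g p)).
  by apply: eq_integrable (integrableZl _ C It).
have t0 p : 0 <= tens f g p by exact: mulr_ge0.
apply: le_trans (le_normr_Rintegral mD I) _.
rewrite -RintegralZl// /Rintegral; apply: fine_le.
- by apply: integrable_fin_num => //; exact: integrable_norm I.
- exact: integrable_fin_num.
apply: ae_ge0_le_integral => //=.
- by have /integrableP[] := integrable_norm I.
- by move=> p _; rewrite lee_fin mulr_ge0.
- by have /integrableP[] := ICt.
have [N [mN N0 sub]] := vC; exists N; split => //; apply: subset_trans sub.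
apply: subsetC => p H /H vp.
by rewrite lee_fin normrM (ger0_norm (t0 p)) ler_wpM2r.
Qed.

(** Chooses the coordinate in which differences are taken, so that one argument covers rows and
    columns. *)
Variables (sw : bool).
Let bt (f g : R -> R) : R * R -> R := if sw then tens g f else tens f g.
Let ord (k : nat) : nat * nat := if sw then (0, k)%N else (k, 0)%N.

Lemma derive1n_shift (f : R -> R) k c : trig L f ->
  derive1n k (fun x => f (x + c)) = fun x => derive1n k f (x + c).
Proof.
move=> tf; elim: k => [//|k IH]; rewrite !derive1nS IH; apply/funext => x.
rewrite derive1E; have [_ d] := trig_derive1 (trig_derive1n k tf).
by case: (is_derive_comp_addr (d (x + c))).
Qed.

Variables (u D : R * R -> R) (C : R) (k : nat).
Hypotheses (cu : continuous u) (pu : Defs.periodic L u) (mu_ : measurable_fun (cell L) u).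
Hypotheses (mD : measurable_fun (cell L) D)
  (DC : {ae mu2, forall p, cell L p -> `|D p| <= C})
  (wD : weak_deriv L (ord k).1 (ord k).2 u D).

Section Pairing.
Variable g : R -> R.
Hypothesis tg : trig L g.
Hypothesis g0 : forall x : R, 0 <= g x.

Let J (H : R -> R) (a : R) : R := \int[mu2]_(p in cell L) (u p * bt (fun x => H (x + - a)) g p).

Let bt_integrable (v : R * R -> R) c f : trig L f -> measurable_fun (cell L) v ->
  {ae mu2, forall p, cell L p -> `|v p| <= c} ->
  mu2.-integrable (cell L) (EFin \o (fun p => v p * bt f g p)).
Proof.
move=> tf mv vc; have cf := trig_continuous tf; have cg := trig_continuous tg.
by rewrite /bt; case: sw; exact: tens_bounded_integrable vc.
Qed.

(** Shifting the argument of the kernel by [s] moves its centre by [- s]; this is the origin of the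
    negative step in the difference bounds. *)
Lemma pairing_fwd s H a : trig L H -> J (fwd s H) a = fwd (- s) (J H) a.
Proof.
move=> tH; have [c uc] := bounded_cell L0 cu.
have tHa b : trig L (fun x => H (x + - b)) by exact: trig_shift.
rewrite /fwd /J -RintegralB; [|exact: measurable_cell|exact: bt_integrable uc|exact: bt_integrable uc].
apply: eq_Rintegral => p _; rewrite -mulrBr /bt /tens.
have E (x : R) : x + - (a + - s) = x + - a + s by ring.
by case: sw; rewrite E; [rewrite -mulrBr|rewrite -mulrBl].
Qed.

Lemma pairing_fwd_iter s H a : trig L H ->
  J (iter k (fwd s) H) a = iter k (fwd (- s)) (J H) a.
Proof.
move=> tH; elim: k a => [//|j IH] a; rewrite !iterS pairing_fwd; last first.
  by elim: j {IH} => [//|j IH]; rewrite iterS; exact: trig_fwd.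
by congr (fwd _ _ _); exact/funext.
Qed.

(** The k-th difference of the kernel is the k-th derivative of an averaged kernel, so the weak
    derivative D takes over; positivity and the mass s^k of the averaged kernel then give the
    bound. *)
Lemma pairing_bound s H a : trig L H -> (forall x, 0 <= H x) -> 0 <= s ->
  `|iter k (fwd (- s)) (J H) a| <=
  C * (s ^+ k * (\int[mu]_(x in `[0, L]) H x * \int[mu]_(x in `[0, L]) g x)).
Proof.
move=> tH H0 s0; rewrite -pairing_fwd_iter//.
have [f [tf f0 fk fi]] := trig_average_iter L0 k tH H0 s0.
have tfa : trig L (fun x => f (x + - a)) by exact: trig_shift.
have -> : J (iter k (fwd s) H) a = (-1) ^+ k * \int[mu2]_(p in cell L) (D p * bt (fun x => f (x + - a)) g p).
  have pb : Defs.periodic L (bt (fun x => f (x + - a)) g).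
    by rewrite /bt; case: sw; exact: periodic_tens.
  have cb j : Ck j (bt (fun x => f (x + - a)) g).
    by rewrite /bt; case: sw; exact: (@Ck_tens _ L).
  have := wD pb cb; have -> : ((ord k).1 + (ord k).2)%N = k by rewrite /ord; case: sw; rewrite /= ?addn0.
  move=> <-; rewrite /J; congr (Rintegral _ _ _); apply/funext => p; congr (_ * _).
  by rewrite /bt /ord; case: sw; rewrite (@pderiv_tens _ L)// derive1n_shift// fk.
rewrite normrM normrX normrN1 expr1n mul1r.
have cf := trig_continuous tfa; have cg := trig_continuous tg.
have fi' := trig_Rintegral_shift L0 (- a) tf.
have -> : s ^+ k * (\int[mu]_(x in `[0, L]) H x * \int[mu]_(x in `[0, L]) g x) =
   \int[mu2]_(p in cell L) bt (fun x => f (x + - a)) g p.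
  rewrite mulrA -fi -fi' /bt; case: sw; rewrite integral_tens//.
  exact: mulrC.
by rewrite /bt; case: sw; exact: ae_bound_tens.
Qed.

End Pairing.

Let U b a : R := if sw then u (b, a) else u (a, b).

(** Divided by the kernel mass, the pairings tend to point values of u, and a difference involves
    finitely many points, so the bound passes to the limit. *)
Lemma weak_fwd_bound s a b : 0 <= s ->
  `|iter k (fwd (- s)) (U b) a| <= C * s ^+ k.
Proof.
move=> s0.
pose ker n c := fun x : R => bump L (x + - c) ^+ n.
pose J n c := \int[mu2]_(p in cell L) (u p * bt (ker n c) (ker n b) p).
pose E n c := J n c / bump_mass L n ^+ 2.
have m0 n : 0 < bump_mass L n ^+ 2 by rewrite exprn_gt0// bump_mass_gt0.
have E_cvg c : E n c @[n --> \oo] --> U b c.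
  apply/cvgrPdist_le => e e0; have e20 : 0 < e / 2 by rewrite divr_gt0.
  have [A A0 HA] : exists2 A, 0 <= A & forall n,
      `|J n c - U b c * bump_mass L n ^+ 2| <= (e / 2 + A / n.+1%:R) * bump_mass L n ^+ 2.
    by rewrite /J /bt /U; case: sw; exact: concentration.
  have /cvgrPdist_le/(_ _ e20) := natSinv_cvg0 A.
  apply: filterS => n; rewrite sub0r normrN ger0_norm ?divr_ge0// => An.
  have -> : U b c - E n c = - ((J n c - U b c * bump_mass L n ^+ 2) / bump_mass L n ^+ 2).
    by rewrite mulrBl mulfK ?gt_eqF// opprB.
  rewrite normrN normrM normfV (gtr0_norm (m0 n)).
  rewrite ler_pdivrMr// (le_trans (HA n))// ler_pM2r//.
  by rewrite [leRHS](splitr e) lerD2l.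
have iter_cvg j (F : nat -> R -> R) (G : R -> R) : (forall c, F n c @[n --> \oo] --> G c) ->
    forall c, iter j (fwd (- s)) (F n) c @[n --> \oo] --> iter j (fwd (- s)) G c.
  move=> FG; elim: j => [//|j IH] c.
  exact: cvgB (IH (c + - s)) (IH c).
have scale j c0 (F : R -> R) c : iter j (fwd (- s)) (fun x => F x / c0) c = iter j (fwd (- s)) F c / c0.
  elim: j c => [//|j IH] c; rewrite !iterS.
  rewrite (_ : iter j _ (fun x => _) = fun x => iter j (fwd (- s)) F x / c0); last exact/funext.
  by rewrite /fwd -mulrBl.
apply: cvgr_to_le (cvg_norm (iter_cvg k E (U b) E_cvg a)) _.
apply: nearW => n; rewrite /E scale normrM normfV (gtr0_norm (m0 n)) ler_pdivrMr//.
have tb : trig L (ker n b) by exact: (trig_shift (- b) (trig_bump L n)).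
have b0 (x : R) : 0 <= ker n b x by rewrite exprn_ge0// bump_ge0.
have := pairing_bound tb b0 a (trig_bump L n) _ s0.
move=> /(_ (fun x => exprn_ge0 n (bump_ge0 L x)))/le_trans; apply.
rewrite /ker (trig_Rintegral_shift L0 (- b) (trig_bump L n)) -expr2 mulrA//.
Qed.

End WeakDifferences.

Section SecondDifference.
Context {R : realType}.

Definition second_diff (U : R -> R) (s x : R) : R := U (x + s) - 2 * U x + U (x - s).

Lemma fwd2E (U : R -> R) s x : iter 2 (fwd (- s)) U (x + s) = second_diff U s x.
Proof.
rewrite /fwd /second_diff /=; have -> : x + s + - s = x by ring.
by have -> : x + - s = x - s by []; ring.
Qed.

(** The fourth difference measures the change of the second difference quotient when the step is
    doubled; it stands in for a fourth derivative. *)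
Lemma fwd4E (U : R -> R) s x :
  iter 4 (fwd (- s)) U (x + 2 * s) = second_diff U (2 * s) x - 4 * second_diff U s x.
Proof.
rewrite /fwd /second_diff /=.
have -> : x + 2 * s + - s = x + s by ring.
have -> : x + s + - s = x by ring.
have -> : x + - s + - s = x - 2 * s by ring.
by have -> : x + - s = x - s by []; ring.
Qed.

(** As a function of the step, the second difference minus c r^2 vanishes at 0 and is nonincreasing
    by the mean value theorem. The opposite inequality follows by applying it to -U. *)
Lemma second_diff_le (U U1 U2 : R -> R) x c s :
  (forall y : R, is_derive y 1 U (U1 y)) -> (forall y : R, is_derive y 1 U1 (U2 y)) ->
  0 <= s -> (forall y, `|x - y| <= s -> U2 y <= c) -> second_diff U s x <= c * s ^+ 2.
Proof.
move=> dU dU1 s0 Uc.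
pose q r := U (x + r) - 2 * U x + U (x - r) - c * r ^+ 2.
have dq (r : R) : is_derive r 1 q (U1 (x + r) - U1 (x - r) - 2 * c * r).
  have d1 : is_derive r 1 (fun r => U (x + r)) (U1 (x + r)).
    rewrite (_ : (fun r => _) = (fun r => U (r + x))); last by apply/funext => y; rewrite addrC.
    by apply: is_derive_comp_addr; rewrite addrC.
  have d2 : is_derive r 1 (fun r => U (x - r)) (- U1 (x - r)) by exact: is_derive_comp_subl.
  by apply: is_derive_eq; rewrite /GRing.scale/=; ring.
have [y yI E] := MVT_segment s0 (fun r _ => dq r)
  (is_derive_within_continuous (fun r _ => dq r)).
move: yI; rewrite in_itv/= => /andP[y0 ys].
have : x - y <= x + y by lra.
move=> /MVT_segment/(_ (fun r _ => dU1 r) (is_derive_within_continuous (fun r _ => dU1 r))) [z zI Ez].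
have U2c : U2 z <= c by apply: Uc; rewrite ler_norml; move: zI; rewrite in_itv/=; lra.
have : q s - q 0 <= 0.
  rewrite E mulr_le0_ge0 ?subr_ge0// Ez (_ : _ - _ = (U2 z - c) * (2 * y)); last by ring.
  by rewrite mulr_le0_ge0 ?subr_le0// mulr_ge0.
rewrite /q /second_diff addr0 subr0; lra.
Qed.

Section Consistency.
Variables (U U1 U2 : R -> R) (x : R).
Hypothesis dU : forall y : R, is_derive y 1 U (U1 y).
Hypothesis dU1 : forall y : R, is_derive y 1 U1 (U2 y).
Hypothesis cU2 : {for x, continuous U2}.

Lemma second_diff_limit (e : R) : 0 < e -> exists2 d, 0 < d & forall s, 0 < s < d ->
  `|second_diff U s x / s ^+ 2 - U2 x| <= e.
Proof.
move=> e0; have [d /= d0 Hd] := (@cvgrPdist_le _ _ _ _ _ _ _).1 cU2 e e0.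
exists d => // s /andP[s0 sd].
have near y : `|x - y| <= s -> `|U2 x - U2 y| <= e.
  by move=> xy; apply: Hd => /=; exact: le_lt_trans sd.
have s20 : 0 < s ^+ 2 by rewrite exprn_gt0.
have H1 : second_diff U s x <= (U2 x + e) * s ^+ 2.
  by apply: (second_diff_le dU dU1 (ltW s0)) => y /near; rewrite ler_norml; lra.
have H2 : second_diff (fun y => - U y) s x <= (- U2 x + e) * s ^+ 2.
  apply: (@second_diff_le _ (fun y => - U1 y) (fun y => - U2 y)) (ltW s0) _ => y.
  by move/near; rewrite ler_norml; lra.
rewrite (_ : second_diff (fun y => - U y) s x = - second_diff U s x) in H2; last first.
  by rewrite /second_diff; ring.
move: H1 H2; rewrite -!ler_pdivrMr// mulNr ler_norml; move: (_ / _) => q; lra.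
Qed.

(** Telescope the quotients along h / 2^j. Each halving costs at most C s_(j+1)^2, which is less
    than C (s_j^2 - s_(j+1)^2), so the sum stays below C h^2. The limit of the quotients requires
    only continuity of the second derivative. *)
Lemma second_diff_consistency C h : 0 <= C -> 0 < h ->
  (forall s, 0 <= s -> `|second_diff U (2 * s) x - 4 * second_diff U s x| <= C * s ^+ 4) ->
  `|second_diff U h x / h ^+ 2 - U2 x| <= C * h ^+ 2.
Proof.
move=> C0 h0 H.
pose s j := h / 2 ^+ j; pose E j := second_diff U (s j) x / s j ^+ 2.
have s0 j : 0 < s j by rewrite divr_gt0// exprn_gt0.
have sS j : s j = 2 * s j.+1 by rewrite /s exprS; field; rewrite expf_neq0.
have step j : `|E j - E j.+1| <= C * s j.+1 ^+ 2.
  rewrite (_ : E j - E j.+1 = (second_diff U (2 * s j.+1) x - 4 * second_diff U (s j.+1) x) / (4 * s j.+1 ^+ 2)); last first.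
    by rewrite /E sS; field; rewrite gt_eqF.
  rewrite normrM normfV ler_pdivrMr; last by rewrite normr_gt0 mulf_neq0// expf_neq0// gt_eqF.
  apply: le_trans (H _ (ltW (s0 _))) _.
  rewrite ger0_norm; last by apply: mulr_ge0 => //; apply: exprn_ge0; exact: ltW.
  rewrite [leRHS](_ : _ = 4 * (C * s j.+1 ^+ 4)); last by ring.
  rewrite ler_peMl ?ler1n//; apply: mulr_ge0 => //; apply: exprn_ge0; exact: ltW.
have sum j : `|E 0%N - E j| <= C * (h ^+ 2 - s j ^+ 2).
  elim: j => [|j IH]; first by rewrite /s expr0 divr1 !subrr normr0 mulr0.
  rewrite -[_ - E j.+1](subrKA (E j)); apply: le_trans (ler_normD _ _) _.
  apply: le_trans (lerD IH (step j)) _; rewrite -mulrDr ler_wpM2l// sS exprMn.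
  have := exprn_ge0 2 (ltW (s0 j.+1)); lra.
have scvg : s j @[j --> \oo] --> (0 : R).
  have := @cvg_geometric R h 2^-1; rewrite ger0_norm// invf_lt1// ltr1n => /(_ erefl).
  by apply: cvg_trans; apply: near_eq_cvg; apply: nearW => j; rewrite /geometric/= exprVn.
apply/ler_addgt0Pl => e e0.
have [d d0 Hd] := second_diff_limit e0.
have [j _ Hj] := (@cvgrPdist_lt _ _ _ _ _ _ _).1 scvg d d0.
have Ej : `|E j - U2 x| <= e.
  apply: Hd; rewrite s0/=.
  by have := Hj j (leqnn _); rewrite /= sub0r normrN gtr0_norm.
have -> : second_diff U h x / h ^+ 2 - U2 x = (E j - U2 x) + (E 0%N - E j).
  by rewrite /E /s expr0 divr1; ring.
apply: le_trans (ler_normD _ _) _; apply: lerD => //.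
apply: le_trans (sum j) _; rewrite ler_wpM2l// gerBl exprn_ge0// ltW//.
Qed.

End Consistency.
End SecondDifference.

Section GridLaplacian.
Context {R : realType}.
Notation mu := (@lebesgue_measure R).
Notation mu2 := (mu \x mu)%E.
Variables (L : R).
Hypothesis L0 : 0 < L.

Lemma is_derive_row (u : R * R -> R) (x y : R) : derivable u (x, y) (1, 0) ->
  is_derive x 1 (fun z : R => u (z, y)) (dx u (x, y)).
Proof.
move=> du.
have E : (fun h : R => h^-1 *: (((fun z : R => u (z, y)) \o shift x) (h *: (1:R)) - u (x, y))) =
         (fun h : R => h^-1 *: ((u \o shift (x, y)) (h *: (1, 0)) - u (x, y))).
  apply/funext => h; rewrite /shift /=; congr (_ *: (u _ - _)).
  by rewrite -[RHS]/(h *: (1:R) + x, h *: (0:R) + y) scaler0 add0r.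
have D : (fun h : R => h^-1 *: (((fun z : R => u (z, y)) \o shift x) (h *: (1:R)) - u (x, y))) @ 0^' -->
    (dx u (x, y) : R).
  by rewrite E; exact: du.
by apply: DeriveDef; [apply/cvg_ex; exists (dx u (x, y))|exact: cvg_lim D].
Qed.

Lemma is_derive_col (u : R * R -> R) (x y : R) : derivable u (x, y) (0, 1) ->
  is_derive y 1 (fun z : R => u (x, z)) (dy u (x, y)).
Proof.
move=> du.
have E : (fun h : R => h^-1 *: (((fun z : R => u (x, z)) \o shift y) (h *: (1:R)) - u (x, y))) =
         (fun h : R => h^-1 *: ((u \o shift (x, y)) (h *: (0, 1)) - u (x, y))).
  apply/funext => h; rewrite /shift /=; congr (_ *: (u _ - _)).
  by rewrite -[RHS]/(h *: (0:R) + x, h *: (1:R) + y) scaler0 add0r.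
have D : (fun h : R => h^-1 *: (((fun z : R => u (x, z)) \o shift y) (h *: (1:R)) - u (x, y))) @ 0^' -->
    (dy u (x, y) : R).
  by rewrite E; exact: du.
by apply: DeriveDef; [apply/cvg_ex; exists (dy u (x, y))|exact: cvg_lim D].
Qed.

Section WinftyBounds.
Variables (u : R * R -> R) (K : nat) (C : R).
Hypothesis pu : Defs.periodic L u.
Hypothesis uC : Winfty_norm_le L K u C.

Lemma Winfty_fwd_row k s a b : (k <= K)%N -> 0 <= s ->
  `|iter k (fwd (- s)) (fun x => u (x, b)) a| <= C * s ^+ k.
Proof.
move=> kK s0; have [cu [D [D0 HD]]] := uC.
have [m0 _ _] := HD 0%N 0%N isT; rewrite D0 in m0.
have [mD DC wD] := HD k 0%N (leq_trans (eq_leq (addn0 k)) kK).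
exact: (@weak_fwd_bound _ L L0 false u (D k 0%N) C k).
Qed.

Lemma Winfty_fwd_col k s a b : (k <= K)%N -> 0 <= s ->
  `|iter k (fwd (- s)) (fun y => u (b, y)) a| <= C * s ^+ k.
Proof.
move=> kK s0; have [cu [D [D0 HD]]] := uC.
have [m0 _ _] := HD 0%N 0%N isT; rewrite D0 in m0.
have [mD DC wD] := HD 0%N k kK.
exact: (@weak_fwd_bound _ L L0 true u (D 0%N k) C k).
Qed.

(** The difference bound of order 0, by which the essential bound on a continuous function holds at
    every point. *)
Lemma Winfty_bound p : `|u p| <= C.
Proof.
by case: p => a b; have := Winfty_fwd_row a b (leq0n K) (lexx 0); rewrite /= expr0 mulr1.
Qed.

Lemma Winfty_bound_ge0 : 0 <= C.
Proof. exact: le_trans (Winfty_bound (0, 0)). Qed.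

Lemma lap_h_on_grid (h : R) i j : lap_h h (on_grid h u) i j =
  second_diff (fun x => u (x, j%:~R * h)) h (i%:~R * h) / h ^+ 2 +
  second_diff (fun y => u (i%:~R * h, y)) h (j%:~R * h) / h ^+ 2.
Proof.
rewrite -mulrDl [RHS]mulrC /lap_h /on_grid /second_diff.
have Ep (k : int) : (k + 1)%:~R * h = k%:~R * h + h by rewrite intrD mulrDl mul1r.
have Em (k : int) : (k - 1)%:~R * h = k%:~R * h - h by rewrite intrB mulrBl mul1r.
by rewrite !Ep !Em; congr (_ * _); ring.
Qed.

Lemma lap_h_le h i j : (2 <= K)%N -> 0 < h -> `|lap_h h (on_grid h u) i j| <= 2 * C.
Proof.
move=> K2 h0; rewrite lap_h_on_grid -!fwd2E; apply: le_trans (ler_normD _ _) _.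
have h2 : 0 < h ^+ 2 by rewrite exprn_gt0.
rewrite !normrM normfV (gtr0_norm h2) -mulrDl ler_pdivrMr// -mulrA mulr2n mulrDl !mul1r.
by apply: lerD; [exact: Winfty_fwd_row K2 (ltW h0)|exact: Winfty_fwd_col K2 (ltW h0)].
Qed.

Lemma lap_h_consistency h i j : (4 <= K)%N -> Ck 2 u -> 0 < h ->
  `|lap_h h (on_grid h u) i j - laplacian u (i%:~R * h, j%:~R * h)| <= 2 * C * h ^+ 2.
Proof.
move=> K4 u2 h0; rewrite lap_h_on_grid /laplacian opprD addrACA.
set x := i%:~R * h; set y := j%:~R * h.
have C0 := Winfty_bound_ge0.
apply: le_trans (ler_normD _ _) _; rewrite [leRHS](_ : _ = C * h ^+ 2 + C * h ^+ 2); last by ring.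
have cont a b : (a + b <= 2)%N -> continuous (pderiv a b u) by move=> /u2[].
have deriv a b p : (a + b < 2)%N ->
    derivable (pderiv a b u) p (1, 0) /\ derivable (pderiv a b u) p (0, 1).
  by move=> ab; case: (u2 a b (ltnW ab)) => _; exact.
apply: lerD.
- have d1 (z : R) : is_derive z 1 (fun z => u (z, y)) (dx u (z, y)).
    exact: is_derive_row (deriv 0%N 0%N (z, y) isT).1.
  have d2 (z : R) : is_derive z 1 (fun z => dx u (z, y)) (pderiv 2 0 u (z, y)).
    exact: is_derive_row (deriv 1%N 0%N (z, y) isT).1.
  have c2 : {for x, continuous (fun z => pderiv 2 0 u (z, y))}.
    apply: (@continuous_comp _ _ _ (fun z : R => (z, y)) (pderiv 2 0 u)); last exact: cont.
    exact: (cvg_pair (F := nbhs x) (G := nbhs x) (H := nbhs y) cvg_id (cvg_cst y)).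
  apply: (second_diff_consistency d1 d2 c2 C0 h0) => s s0.
  by rewrite -fwd4E; exact: Winfty_fwd_row K4 s0.
- have d1 (z : R) : is_derive z 1 (fun z => u (x, z)) (dy u (x, z)).
    exact: is_derive_col (deriv 0%N 0%N (x, z) isT).2.
  have d2 (z : R) : is_derive z 1 (fun z => dy u (x, z)) (pderiv 0 2 u (x, z)).
    exact: is_derive_col (deriv 0%N 1%N (x, z) isT).2.
  have c2 : {for y, continuous (fun z => pderiv 0 2 u (x, z))}.
    apply: (@continuous_comp _ _ _ (fun z : R => (x, z)) (pderiv 0 2 u)); last exact: cont.
    exact: (cvg_pair (F := nbhs y) (G := nbhs x) (H := nbhs y) (cvg_cst x) cvg_id).
  apply: (second_diff_consistency d1 d2 c2 C0 h0) => s s0.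
  by rewrite -fwd4E; exact: Winfty_fwd_col K4 s0.
Qed.

End WinftyBounds.
End GridLaplacian.

(** * Graded meshes *)

Section GradedMesh.
Context {R : realType}.

Lemma powR_convex_bounds (g x y : R) : 1 <= g -> 0 < x -> x <= y ->
  g * x `^ (g - 1) * (y - x) <= y `^ g - x `^ g <= g * y `^ (g - 1) * (y - x).
Proof.
move=> g1 x0 xy; have g0 : 0 <= g := le_trans ler01 g1.
have D s : s \in `[x, y] -> is_derive s 1 (fun s : R => s `^ g) (g * s `^ (g - 1)).
  by rewrite in_itv/= => /andP[xs _]; apply: is_derive1_powR; exact: lt_le_trans xs.
have [c cI ->] := MVT_segment xy (fun s sI => D s (subset_itv_oo_cc sI))
  (is_derive_within_continuous D).
move: cI; rewrite in_itv/= => /andP[xc cy].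
have c0 : 0 < c := lt_le_trans x0 xc.
have yx : 0 <= y - x by rewrite subr_ge0.
by rewrite !(ler_wpM2r yx)// (ler_wpM2l g0)// le_powRl// ?subr_ge0// ltW.
Qed.

Variables (T gamma : R) (N : nat).
Hypotheses (T0 : 0 < T) (gamma1 : 1 <= gamma) (N0 : (0 < N)%N).

Let g0 : 0 < gamma := lt_le_trans ltr01 gamma1.
Let c : R := T / N%:R `^ gamma.

Let NR : 0 < N%:R :> R. Proof. by rewrite ltr0n. Qed.

Let c0 : 0 < c. Proof. by rewrite divr_gt0// powR_gt0. Qed.

Lemma graded_meshE k : graded_mesh T gamma N k = c * k%:R `^ gamma.
Proof.
rewrite /graded_mesh powRM ?invr_ge0// powR_invl// powRN /c.
by rewrite mulrA mulrAC.
Qed.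

Lemma graded_mesh_last : graded_mesh T gamma N N = T.
Proof. by rewrite graded_meshE divfK// gt_eqF// powR_gt0. Qed.

Lemma graded_step k : step (graded_mesh T gamma N) k = c * (k%:R `^ gamma - k.-1%:R `^ gamma).
Proof. by rewrite /step !graded_meshE mulrBr. Qed.

(** Convexity of k^gamma gives nondecreasing steps and tau_k <= gamma t_k / k; the other summand
    comes from k <= 2 (k-1), whence t_k <= 2^gamma t_(k-1) for k >= 2. *)
Lemma graded_mesh_regular : regular_mesh (graded_mesh T gamma N) N (gamma + 2 `^ gamma).
Proof.
have two0 : 0 < 2 `^ gamma :> R by rewrite powR_gt0.
have two2 : 2 <= 2 `^ gamma :> R.
  by rewrite -[leLHS]powRr1//; apply: ler_powR; rewrite ?ler1n.
have step1 (k : nat) : k%:R <= k.+1%:R :> R by rewrite ler_nat.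
have upper k : (0 < k)%N -> k%:R `^ gamma - k.-1%:R `^ gamma <= gamma * k%:R `^ (gamma - 1).
  case: k => [//|[_|k _]].
    by rewrite /= powR0 ?gt_eqF// powR1 subr0 mulr1.
  have k0 : 0 < k.+1%:R :> R by rewrite ltr0n.
  have /andP[_] := powR_convex_bounds gamma1 k0 (step1 k.+1).
  by rewrite -[k.+2%:R - _]natrB// subSnn mulr1.
split.
- by rewrite (le_trans gamma1)// lerDl ltW.
- by rewrite graded_meshE powR0 ?mulr0// gt_eqF.
- move=> k /andP[k1 _]; rewrite graded_step mulr_gt0// subr_gt0.
  by apply: gt0_ltr_powR => //; rewrite ?nnegrE// ltr_nat ltn_predL.
- move=> k /andP[k1 _]; rewrite !graded_step ler_pM2l//=.
  have k0 : 0 < k%:R :> R by rewrite ltr0n.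
  apply: le_trans (upper _ k1) _; have := powR_convex_bounds gamma1 k0 (step1 k).
  by case/andP => + _; rewrite -natrB// subSnn mulr1.
- move=> k /andP[k1 _]; rewrite graded_step graded_meshE.
  have k0 : 0 < k%:R :> R by rewrite ltr0n.
  apply: (@le_trans _ _ (c * (gamma * k%:R `^ (gamma - 1)))); first by rewrite ler_pM2l// upper.
  have -> : k%:R `^ (gamma - 1) = k%:R `^ gamma / k%:R :> R.
    by rewrite powRD_gt0// powR_inv1// ltW.
  rewrite -[leRHS]mulrA -[c * _ / _]mulrA mulrCA ler_wpM2r ?lerDl ?(ltW two0)//.
  by rewrite mulr_ge0 ?(ltW c0)// divr_ge0 ?powR_ge0.
- move=> k /andP[k2 _]; rewrite !graded_meshE.
  rewrite mulrCA ler_pM2l//.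
  have k1 : 0 < k.-1%:R :> R by rewrite ltr0n; lia.
  apply: (@le_trans _ _ (2 `^ gamma * k.-1%:R `^ gamma)).
    rewrite -powRM//; apply: ge0_ler_powR; rewrite ?nnegrE ?mulr_ge0//; first exact: ltW.
    by rewrite -natrM ler_nat; lia.
  by rewrite ler_wpM2r ?powR_ge0// lerDr ltW.
Qed.

End GradedMesh.

Section MeshRatio.
Context {R : realType}.

Lemma step_le_max_step (t : nat -> R) n K : (1 <= n <= K)%N -> step t n <= max_step t K.
Proof.
move=> nK; rewrite /max_step.
have nI : n \in index_iota 1 K.+1 by rewrite mem_index_iota ltnS.
exact: (@le_bigmax_seq _ _ _ _ 0 _ predT).
Qed.

Lemma regular_mesh_ratio (t : nat -> R) G K n : regular_mesh t K G -> (2 <= n <= K)%N ->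
  0 <= Defs.ratio t n <= G ^+ 2.
Proof.
move=> mesh /andP[n2 nK].
have n1K : (1 <= n.-1 <= K)%N by lia.
have nK' : (1 <= n <= K)%N by lia.
have s0 := mesh_step_gt0 mesh nK'; have s1 := mesh_step_gt0 mesh n1K.
have n0 : 0 < n%:R :> R by rewrite ltr0n; lia.
have G0 : 0 < G := lt_le_trans ltr01 (mesh_ge1 mesh).
apply/andP; split; first by rewrite divr_ge0// ltW.
rewrite ler_pdivrMr//; apply: le_trans (mesh_step_le mesh nK') _.
rewrite ler_pdivrMr// expr2 -!mulrA ler_pM2l//.
apply: le_trans (mesh_node_le mesh _) _; first by rewrite n2.
have nK1 : (n.-1 <= K)%N by case/andP: n1K.
rewrite ler_pM2l// mulrC; apply: le_trans (node_le_step mesh (leqnn _) nK1) _.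
by rewrite ler_pM2r// ler_nat leq_pred.
Qed.

End MeshRatio.

(** * The error equation *)

Section Clip.
Context {R : realType}.

(** The truncation of the extrapolation, with min and max in the order of [phi_hat], so that both
    agree by conversion. *)
Definition clip (x : R) : R := Num.min (Num.max x (-1)) 1.

Lemma clip_cases x :
  [\/ x <= -1 /\ clip x = -1, -1 <= x <= 1 /\ clip x = x | 1 <= x /\ clip x = 1].
Proof.
rewrite /clip; case: (leP x (-1)) => H1.
  by constructor 1; split => //; rewrite min_l//; lra.
by case: (leP x 1) => H2; [constructor 2; split => //; lra|constructor 3; split => //; lra].
Qed.

Lemma clip_bounds x : -1 <= clip x <= 1.
Proof. by case: (clip_cases x) => -[H ->]; lra. Qed.

Lemma clip_dist x d : 0 <= d -> `|x| <= 1 + d -> `|x - clip x| <= d.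
Proof. by move=> d0; rewrite !ler_norml; case: (clip_cases x) => -[H ->]; lra. Qed.

Lemma clip_lip x y : `|clip x - clip y| <= `|x - y|.
Proof.
have h1 := ler_norm (x - y); have h2 := ler_norm (- (x - y)); rewrite normrN in h2.
rewrite ler_norml.
by case: (clip_cases x) => -[H1 ->]; case: (clip_cases y) => -[H2 ->]; lra.
Qed.

Lemma norm_convex (u a b Y : R) : 0 <= u <= 1 -> `|a| <= Y -> `|b| <= Y ->
  `|(1 - u) * a + u * b| <= Y.
Proof.
move=> /andP[u0 u1] aY bY; have v0 : 0 <= 1 - u by rewrite subr_ge0.
apply: le_trans (ler_normD _ _) _; rewrite !normrM (ger0_norm u0) (ger0_norm v0).
have := ler_wpM2l v0 aY; have := ler_wpM2l u0 bY; lra.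
Qed.

End Clip.

(** Linear arithmetic behind a use of [comparison_step], isolated with the nonlinear quantities as
    atoms; [s] treats upper and lower bound together. *)
Lemma range_arith (R : realType) (s Kf k Y X W fz z b LL DD e2 Bn DBn : R) :
  s = 1 \/ s = -1 -> (Kf + 2 * k + 1) * Y <= X ->
  s * fz + k * (s * z - 1) <= (Kf + k) * (Bn + Y) ->
  s * (DD - e2 * LL - fz) <= Y + Y * W ->
  k * (s * (b - z)) <= k * Y -> Y * W <= X * W ->
  (Kf + k) * Bn + X + X * W <= DBn ->
  s * DD <= e2 * (s * LL) - k * (s * b - 1) + DBn.
Proof. by case=> ->; lra. Qed.

Lemma error_arith (R : realType) (s Kf k Y X W E fQ fh bP bp ph Q LP Lp DP Dp e2 K Bn DBn : R) :
  s = 1 \/ s = -1 -> Dp = e2 * Lp + fh - k * (bp - ph) ->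
  s * (DP - e2 * LP - fQ) <= Y + Y * W -> s * (fQ - fh) <= Kf * E ->
  k * (s * (bP - Q)) <= k * Y -> k * (s * (Q - ph)) <= k * E ->
  Y + k * Y + (Kf + k) * E <= K * Bn + X -> Y * W <= X * W ->
  K * Bn + X + X * W <= DBn ->
  s * (DP - Dp) <= e2 * (s * (LP - Lp)) - k * (s * (bP - bp)) + DBn.
Proof. by case=> -> ->; lra. Qed.

Section DiscreteError.
Context {R : realType}.
Variables (t : nat -> R) (N : nat) (G al : R).
Hypothesis mesh : regular_mesh t N G.
Hypothesis al01 : 0 < al < 1.
Let th := al / 2.
Variables (M : nat) (h eps kappa : R).
Hypotheses (M0 : (0 < M)%N) (h0 : 0 < h) (kappa0 : 0 <= kappa).
Variables (f : R -> R) (Kf Bd : R).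
Hypotheses (f1 : f 1 <= 0) (fN1 : 0 <= f (-1)) (Kf0 : 0 <= Kf) (Bd1 : 1 <= Bd).
Hypothesis f_nd : forall x y, -1 <= x -> x <= y -> y <= 1 ->
  f x + kappa * x <= f y + kappa * y.
Hypothesis f_lip : forall x y, `|x| <= Bd -> `|y| <= Bd -> `|f x - f y| <= Kf * `|x - y|.
(** [P] is the exact solution at the nodes, [Q] its value at t_(n-theta), [p] the scheme, and [Y]
    one common size for all consistency errors. [f] is controlled up to [Bd] because the exact
    values are not known beforehand to stay in [-1, 1]. *)
Variables (P Q p : nat -> @gridfun R) (Y : R).
Hypothesis Y0 : 0 <= Y.
Hypothesis cfl : forall n, (1 <= n <= N)%N -> step t n `^ al *
  (11 * (1 - th) * (4 * eps ^+ 2 / h ^+ 2 + kappa) * Gamma (2 - al)) <= 4.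
Hypotheses (VP : forall n, (n <= N)%N -> @Vh R M (P n)).
Hypothesis P0 : forall i j, `|P 0%N i j| <= 1.
Hypothesis QP : forall n i j, (1 <= n <= N)%N ->
  [/\ `|Q n i j - P n i j| <= Y, `|Q n i j - P n.-1 i j| <= Y &
      `|P n i j - P n.-1 i j| <= Y].
Hypothesis QB : forall n i j, (1 <= n <= N)%N -> `|Q n i j| <= Bd.
Hypothesis residual : forall n i j, (1 <= n <= N)%N ->
  `|D_tau t al th (fun k => P k i j) n - eps ^+ 2 * lap_h h (phi_bar th P n) i j - f (Q n i j)|
  <= Y + Y * (omega (1 - al) (t n) + t n `^ (- al) / n%:R).

(** At the truncated value c the left side is nonpositive, by monotonicity of f + kappa id on
    [-1, 1] and the signs of f at its ends; moving from c to z costs at most (Kf + kappa) d. *)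
Lemma reaction_bound (s z d : R) : s = 1 \/ s = -1 -> 0 <= d -> `|z| <= 1 + d -> `|z| <= Bd ->
  s * f z + kappa * (s * z - 1) <= (Kf + kappa) * d.
Proof.
move=> s1 d0 zd zB; have /andP[c1 c2] := clip_bounds z; have zc := clip_dist d0 zd.
move: (clip z) => c in c1 c2 zc *.
have cB : `|c| <= Bd by rewrite (le_trans _ Bd1)// ler_norml c1.
have H1 : Kf * `|z - c| <= Kf * d by exact: ler_wpM2l.
have H2 : kappa * `|z - c| <= kappa * d by exact: ler_wpM2l.
have H3 := f_lip zB cB; have H4 := ler_norm (z - c); have H5 := ler_norm (- (z - c)).
have H6 := ler_norm (f z - f c); have H7 := ler_norm (- (f z - f c)).
rewrite normrN in H5; rewrite normrN in H7.
have H8 := ler_wpM2l kappa0 H4; have H9 := ler_wpM2l kappa0 H5.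
have M1 := f_nd c1 c2 (lexx 1); have M2 := f_nd (lexx (-1)) c1 c2.
move: H1 H2 H3 H6 H7 H8 H9 M1 M2 f1 fN1; rewrite !mulr1 !mulrN1.
move: (f z) (f c) (f 1) (f (-1)) (Kf * `|z - c|) (kappa * `|z - c|) `|f z - f c| => Fz Fc F1 F2 a b e.
by case: s1 => ->; lra.
Qed.

Lemma weight_ge0 n : 0 <= omega (1 - al) (t n) + t n `^ (- al) / n%:R.
Proof.
by apply: addr_ge0; [exact: omega_ge0|apply: divr_ge0 => //; exact: powR_ge0].
Qed.

Lemma phi_bar_dist n i j : (1 <= n <= N)%N -> `|phi_bar th P n i j - Q n i j| <= Y.
Proof.
move=> nN; have [q1 q2 _] := QP i j nN; have [al0 al1] := andP al01.
rewrite /phi_bar (_ : _ - _ = (1 - th) * - (Q n i j - P n i j) + th * - (Q n i j - P n.-1 i j)); last by ring.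
apply: norm_convex; rewrite ?normrN//.
by rewrite divr_ge0 ?(ltW al0)//= ler_pdivrMr// mul1r (le_trans (ltW al1))// ler1n.
Qed.

Section Range.
Variables (B : nat -> R) (X : R).
Hypotheses (B0 : forall k, 0 <= B k) (XY : (Kf + 2 * kappa + 1) * Y <= X).
Hypothesis DB : forall n, (1 <= n <= N)%N ->
  (Kf + kappa) * B n.-1 + X + X * (omega (1 - al) (t n) + t n `^ (- al) / n%:R)
  <= D_tau t al th B n.

(** The sampled exact solution satisfies the scheme up to a residual, so the discrete comparison
    applies to it as well. The reaction is estimated through level n-1, at distance Y, which is why
    the feedback in [DB] is taken there. *)
Lemma exact_range n i j : (n <= N)%N -> `|P n i j| <= 1 + B n.
Proof.
have [al0 al1] := andP al01.
move: i j; elim/ltn_ind: n => n IH i j nN.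
have [n0|n0] := posnP n; first by rewrite n0 (le_trans (P0 i j))// lerDl.
have nN' : (1 <= n <= N)%N by rewrite n0.
suff H s : s = 1 \/ s = -1 -> forall i j, s * P n i j - 1 <= B n.
  have := H 1 (or_introl erefl) i j; have := H (-1) (or_intror erefl) i j.
  rewrite ler_norml; lra.
move=> s1; pose w k : gridfun := fun i j => s * P k i j - 1.
have ns : `|s| = 1 by case: s1 => ->; rewrite ?normrN normr1.
apply: (@comparison_step R M M0 t N G al mesh al01 h eps kappa kappa0 n w B nN' (cfl nN')) => //.
- move=> i' j'; have [e1 e2] := VP nN i' j'; by rewrite /w e1 e2.
- move=> k kn i' j'; have kN : (k <= N)%N := leq_trans (ltnW kn) nN.
  have := IH k kn i' j' kN; rewrite /w ler_norml; case: s1 => ->; lra.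
move=> i' j'.
have -> : D_tau t al (al / 2) (fun k => w k i' j') n = s * D_tau t al th (fun k => P k i' j') n.
  by rewrite /D_tau mulr_sumr; apply: eq_bigr => k _; rewrite /w; ring.
have -> : lap_h h (phi_bar (al / 2) w n) i' j' = s * lap_h h (phi_bar th P n) i' j'.
  by rewrite /lap_h /phi_bar /w -/th; ring.
have -> : phi_bar (al / 2) w n i' j' = s * phi_bar th P n i' j' - 1.
  by rewrite /phi_bar /w -/th; ring.
have R1 := residual i' j' nN'.
set W := omega _ _ + _ in R1; have W0 : 0 <= W := weight_ge0 n.
set LL := lap_h _ _ _ _ in R1 *; set DD := D_tau _ _ _ _ _ in R1 *.
have [q1 q2 q3] := QP i' j' nN'; have qb := phi_bar_dist i' j' nN'.
set z := Q n i' j' in R1 q1 q2 qb *; set b := phi_bar th P n i' j' in qb *.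
have n1 : (n.-1 < n)%N by rewrite prednK.
have n1N : (n.-1 <= N)%N := leq_trans (leq_pred n) nN.
have zd : `|z| <= 1 + (B n.-1 + Y).
  have := IH n.-1 n1 i' j' n1N; have := ler_normD (z - P n.-1 i' j') (P n.-1 i' j').
  rewrite subrK; lra.
have RB := reaction_bound s1 (addr_ge0 (B0 n.-1) Y0) zd (QB i' j' nN').
have sr : s * (DD - eps ^+ 2 * LL - f z) <= Y + Y * W.
  by apply: le_trans (ler_norm _) _; rewrite normrM ns mul1r.
have sb : s * (b - z) <= Y by apply: le_trans (ler_norm _) _; rewrite normrM ns mul1r.
have ksb := ler_wpM2l kappa0 sb.
have YX : Y <= X by apply: le_trans XY; rewrite ler_peMl//; move: Kf0 kappa0; lra.
have YW := ler_wpM2r W0 YX.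
exact: range_arith s1 XY RB sr ksb YW (DB nN').
Qed.

End Range.

Section Error.
Variables (B1 B : nat -> R) (D1 X : R).
Hypothesis range : forall n i j, (n <= N)%N -> `|P n i j| <= 1 + B1 n.
Hypotheses (B10 : forall k, 0 <= B1 k) (B1D : forall k, (k <= N)%N -> B1 k <= D1).
Hypotheses (B0 : forall k, 0 <= B k)
  (B_nd : forall k, (1 <= k <= N)%N -> B k.-1 <= B k).
Let K := (Kf + kappa) * (1 + 2 * G ^+ 2).
Hypothesis XY : (1 + kappa) * Y + (Kf + kappa) * (D1 + (3 + G ^+ 2) * Y) <= X.
Hypothesis DB : forall n, (1 <= n <= N)%N ->
  K * B n.-1 + X + X * (omega (1 - al) (t n) + t n `^ (- al) / n%:R)
  <= D_tau t al th B n.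
Hypothesis Vp : forall n, (n <= N)%N -> @Vh R M (p n).
Hypothesis p0 : forall i j, p 0%N i j = P 0%N i j.
Hypothesis scheme : forall n i j, (1 <= n <= N)%N ->
  D_tau t al th (fun k => p k i j) n =
    eps ^+ 2 * lap_h h (phi_bar th p n) i j + f (phi_hat t th p n i j)
    - kappa * (phi_bar th p n i j - phi_hat t th p n i j).

Lemma phi_hat_bound n i j : (1 <= n <= N)%N -> `|phi_hat t th p n i j| <= Bd.
Proof.
move=> nN; rewrite /phi_hat; case: eqP => _; first by rewrite p0 (le_trans (P0 i j)).
by apply: le_trans Bd1; rewrite ler_norml; exact: clip_bounds.
Qed.

(** Truncating Q costs D1 + Y by [range]. As the truncation is 1-Lipschitz, it remains to compare Q
    with the extrapolation: one part is the increments of the exact solution, the other earlier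
    errors with weights 1 + q and q, where q <= G^2. At n = 1 the scheme uses its initial value
    directly. *)
Lemma phi_hat_dist n i j : (1 <= n <= N)%N ->
  (forall k, (k < n)%N -> `|P k i j - p k i j| <= B k) ->
  `|Q n i j - phi_hat t th p n i j| <= (1 + 2 * G ^+ 2) * B n.-1 + D1 + (3 + G ^+ 2) * Y.
Proof.
move=> nN IH; have [q1 q2 _] := QP i j nN.
have n0 : (0 < n)%N by case/andP: nN.
have nleN : (n <= N)%N by case/andP: nN.
have n1N : (n.-1 <= N)%N := leq_trans (leq_pred n) nleN.
have n1 : (n.-1 < n)%N by rewrite prednK.
have G20 : 0 <= G ^+ 2 by rewrite exprn_ge0// (le_trans ler01 (mesh_ge1 mesh)).
have G2B : 0 <= G ^+ 2 * B n.-1 by rewrite mulr_ge0.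
have G2Y : 0 <= G ^+ 2 * Y by rewrite mulr_ge0.
have D10 : 0 <= D1 := le_trans (B10 0%N) (B1D (leq0n N)).
have Bn := B0 n.-1.
rewrite /phi_hat; case: eqP => [E|/eqP n_1].
  rewrite p0; move: q2; rewrite E /= => q2; apply: le_trans q2 _.
  move: G2B G2Y Bn; rewrite E /=; move: Y0; lra.
have n2 : (2 <= n)%N by rewrite ltn_neqAle eq_sym n_1.
set q := (1 - th) * Defs.ratio t n.
set ext := (1 + q) * p n.-1 i j - q * p n.-2 i j; rewrite -/(clip ext).
have nN2 : (2 <= n <= N)%N by rewrite n2.
have /andP[r0 r1] := regular_mesh_ratio mesh nN2.
have q01 : 0 <= q <= G ^+ 2.
  have t0 : 0 <= 1 - th <= 1 by rewrite /th; move: al01; lra.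
  case/andP: t0 => t0 t1; rewrite mulr_ge0//=.
  by apply: le_trans r1; rewrite ler_piMl.
case/andP: q01 => q0 qG.
have n2N : (1 <= n.-1 <= N)%N by rewrite n1N andbT -ltnS prednK.
have [_ _ q3] := QP i j n2N;
have e1 := IH n.-1 n1; have e2 := IH n.-2 (leq_ltn_trans (leq_pred _) n1).
have Bnd : B n.-2 <= B n.-1 := B_nd n2N.
have d1 : `|Q n i j - clip (Q n i j)| <= D1 + Y.
  apply: clip_dist; first exact: addr_ge0.
  have := ler_normD (Q n i j - P n.-1 i j) (P n.-1 i j); rewrite subrK.
  have := range i j n1N; have := B1D n1N; lra.
have d2 := clip_lip (Q n i j) ext.
have d3 : `|Q n i j - ext| <= Y + q * Y + ((1 + q) * B n.-1 + q * B n.-2).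
  rewrite (_ : _ - ext = (Q n i j - P n.-1 i j) - q * (P n.-1 i j - P n.-2 i j) +
    ((1 + q) * (P n.-1 i j - p n.-1 i j) - q * (P n.-2 i j - p n.-2 i j))); last by rewrite /ext; ring.
  have q10 : 0 <= 1 + q by rewrite addr_ge0.
  apply: le_trans (ler_normD _ _) _; apply: lerD.
    apply: le_trans (ler_normB _ _) _; apply: lerD => //.
    by rewrite normrM (ger0_norm q0) ler_wpM2l.
  apply: le_trans (ler_normB _ _) _; apply: lerD.
    by rewrite normrM (ger0_norm q10) ler_wpM2l.
  by rewrite normrM (ger0_norm q0) ler_wpM2l.
rewrite -(subrKA (clip (Q n i j))); apply: le_trans (ler_normD _ _) _.
have m1 := ler_wpM2r Y0 qG; have m2 := ler_wpM2r Bn qG; have m3 := ler_wpM2l q0 Bnd.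
apply: le_trans (lerD d1 (le_trans d2 d3)) _.
move: m1 m2 m3 Y0; move: (G ^+ 2) (q) => g u; lra.
Qed.

Lemma scheme_error n i j : (n <= N)%N -> `|P n i j - p n i j| <= B n.
Proof.
move: i j; elim/ltn_ind: n => n IH i j nN.
have [n0|n0] := posnP n; first by rewrite n0 p0 subrr normr0.
have nN' : (1 <= n <= N)%N by rewrite n0.
suff H s : s = 1 \/ s = -1 -> forall i j, s * (P n i j - p n i j) <= B n.
  have := H 1 (or_introl erefl) i j; have := H (-1) (or_intror erefl) i j.
  rewrite ler_norml; lra.
move=> s1; pose w k : gridfun := fun i j => s * (P k i j - p k i j).
have ns : `|s| = 1 by case: s1 => ->; rewrite ?normrN normr1.
have sle (x y : R) : `|x| <= y -> s * x <= y.
  by move=> xy; apply: le_trans (ler_norm _) _; rewrite normrM ns mul1r.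
apply: (@comparison_step R M M0 t N G al mesh al01 h eps kappa kappa0 n w B nN' (cfl nN')) => //.
- by move=> i' j'; have [e1 e2] := VP nN i' j'; have [e3 e4] := Vp nN i' j'; rewrite /w e1 e2 e3 e4.
- move=> k kn i' j'; have kN : (k <= N)%N := leq_trans (ltnW kn) nN.
  by apply: sle; exact: IH.
move=> i' j'.
have -> : D_tau t al (al / 2) (fun k => w k i' j') n =
    s * (D_tau t al th (fun k => P k i' j') n - D_tau t al th (fun k => p k i' j') n).
  by rewrite /D_tau -sumrB mulr_sumr; apply: eq_bigr => k _; rewrite /w; ring.
have -> : lap_h h (phi_bar (al / 2) w n) i' j' =
    s * (lap_h h (phi_bar th P n) i' j' - lap_h h (phi_bar th p n) i' j').
  by rewrite /lap_h /phi_bar /w -/th; ring.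
have -> : phi_bar (al / 2) w n i' j' = s * (phi_bar th P n i' j' - phi_bar th p n i' j').
  by rewrite /phi_bar /w -/th; ring.
have IH' k : (k < n)%N -> `|P k i' j' - p k i' j'| <= B k.
  by move=> kn; apply: IH => //; exact: leq_trans (ltnW kn) nN.
have dist := phi_hat_dist nN' IH'.
have W0 := weight_ge0 n.
have D10 : 0 <= D1 := le_trans (B10 0%N) (B1D (leq0n N)).
have KK : 0 <= Kf + kappa by exact: addr_ge0.
have G20 : 0 <= G ^+ 2 by rewrite exprn_ge0// (le_trans ler01 (mesh_ge1 mesh)).
apply: (error_arith s1 (scheme i' j' nN') (sle _ _ (residual i' j' nN'))
  (sle _ _ (le_trans (f_lip (QB i' j' nN') (phi_hat_bound i' j' nN')) (ler_wpM2l Kf0 dist)))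
  (ler_wpM2l kappa0 (sle _ _ (phi_bar_dist i' j' nN')))
  (ler_wpM2l kappa0 (sle _ _ dist)) _ _ (DB nN')).
  by apply: le_trans (lerD (lexx (K * B n.-1)) XY); rewrite /K; lra.
apply: ler_wpM2r => //; apply: le_trans XY.
have m1 : 0 <= kappa * Y by exact: mulr_ge0.
have m2 : 0 <= (Kf + kappa) * (D1 + (3 + G ^+ 2) * Y).
  by apply: mulr_ge0 => //; apply: addr_ge0 => //; apply: mulr_ge0 => //; exact: addr_ge0.
by apply: le_trans (lerD (lexx _) m2); rewrite mulrDl mul1r addr0 lerDl.
Qed.

End Error.

End DiscreteError.

(** * Regularity in time of the exact solution *)

Section TimeDerivative.
Context {R : realType}.

(** The quotient filter lives on ]0, T], so identities valid only there, such as spatial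
    periodicity, are inherited by time derivatives. *)
Lemma dt_ext (T : R) (u v : R -> R) s : (forall s, 0 < s <= T -> u s = v s) ->
  0 < s <= T -> dt T u s = dt T v s.
Proof.
move=> uv sT; rewrite /dt; congr (lim _); apply/funext => P; apply/propext.
have H (u1 u2 : R -> R) : (forall s, 0 < s <= T -> u1 s = u2 s) ->
    dt_quot T u1 s P -> dt_quot T u2 s P.
  move=> u12; apply: (@filterS R (s^') _) => r H rT; move: (H rT).
  by rewrite /= (u12 s)// (u12 r)//; move: rT; rewrite /= in_itv.
by split; apply: H => // r rT; rewrite uv.
Qed.

Lemma iter_dt_ext (T : R) (u v : R -> R) l s : (forall s, 0 < s <= T -> u s = v s) ->
  0 < s <= T -> iter l (dt T) u s = iter l (dt T) v s.
Proof.
by move=> uv; elim: l s => [|l IH] s sT; [exact: uv|rewrite !iterS; exact: dt_ext].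
Qed.

Lemma dt_is_derive (T : R) (u : R -> R) s : 0 < s < T -> cvg (dt_quot T u s) ->
  is_derive s 1 u (dt T u s).
Proof.
move=> /andP[s0 sT] cu.
have D : (fun h : R => h^-1 *: ((u \o shift s) (h *: (1:R)) - u s)) @ 0^' --> (dt T u s : R).
  apply/cvgrPdist_le => e e0.
  have := (@cvgrPdist_le _ _ _ _ _ _ _).1 cu e e0.
  move=> /(_ (within_filter _ _)) H.
  have {H} : \forall r \near s^', 0 < r <= T -> `|dt T u s - (u r - u s) / (r - s)| <= e.
    by apply: (@filterS R (s^') _) H => r H rT; apply: H; rewrite /= in_itv.
  move=> [d /= d0 Hd].
  exists (Num.min d (Num.min s (T - s))) => /=; first by rewrite !lt_min d0 s0 subr_gt0.
  move=> h /=; rewrite sub0r normrN !lt_min => /and3P[hd hs hT] h0.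
  have h1 := ler_norm h; have h2 := ler_norm (- h); rewrite normrN in h2.
  have := Hd (h + s); rewrite /= (_ : s - (h + s) = - h); last by ring.
  rewrite normrN => /(_ hd); rewrite -subr_eq0 addrK => /(_ h0).
  have -> : 0 < h + s <= T by apply/andP; split; lra.
  by move=> /(_ isT); rewrite mulrC /shift /GRing.scale/= mulr1.
by apply: DeriveDef; [apply/cvg_ex; exists (dt T u s)|exact: cvg_lim D].
Qed.

End TimeDerivative.

Section Solution.
Context {R : realType}.
Notation mu := (@lebesgue_measure R).
Variables (L T alpha eps Cphi : R) (f : R -> R).
Variables (phi_init : R * R -> R) (phi : R -> R * R -> R).
Hypotheses (L0 : 0 < L) (T0 : 0 < T) (al01 : 0 < alpha < 1).
Hypothesis sol : allen_cahn_solution L T alpha eps f phi_init phi.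
Hypothesis reg : regularity L T alpha Cphi phi.

Let V l s p := iter l (dt T) (phi^~ p) s.

(** Absorbs the 1 in 1 + s^(al - l): on ]0, T] one has s^(l - al) <= (1 + T)^3 for l <= 3. *)
Definition time_const : R := Cphi * (1 + (1 + T) ^+ 3).

Lemma V_periodic l s : 0 < s <= T -> Defs.periodic L (V l s).
Proof.
move=> sT x y; split; apply: iter_dt_ext sT => r /andP[r0 rT].
- by case: (ac_periodic sol (t := r) _ x y); rewrite ?(ltW r0) ?rT.
- by case: (ac_periodic sol (t := r) _ x y); rewrite ?(ltW r0) ?rT.
Qed.

Lemma phi_bound s p : 0 < s <= T -> `|phi s p| <= Cphi.
Proof.
move=> sT; apply: (Winfty_bound L0 _ (reg_space reg sT)).
exact: (V_periodic 0 sT).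
Qed.

Lemma Cphi_ge0 : 0 <= Cphi.
Proof. by apply: le_trans (phi_bound (s := T) (0, 0) _) => //; rewrite T0 lexx. Qed.

Lemma time_weight_le l s : 0 < s <= T -> (1 <= l <= 3)%N ->
  Cphi * (1 + s `^ (alpha - l%:R)) <= time_const * s `^ (alpha - l%:R).
Proof.
move=> /andP[s0 sT] /andP[l1 l3]; have [al0 al1] := andP al01.
rewrite /time_const -mulrA; apply: (ler_wpM2l Cphi_ge0).
rewrite mulrDl mul1r addrC lerD2l.
have sp : 0 < s `^ (alpha - l%:R) by rewrite powR_gt0.
rewrite -ler_pdivrMr// mul1r -powRN opprB.
have l3R : l%:R <= 3 :> R by rewrite ler_nat.
have l1R : 1 <= l%:R :> R by rewrite ler1n.
have T1 : 1 <= 1 + T by rewrite lerDl ltW.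
apply: (@le_trans _ _ ((1 + T) `^ (l%:R - alpha))).
  by apply: ge0_ler_powR; rewrite ?nnegrE//; lra.
by rewrite -powR_mulrn ?(le_trans ler01)//; apply: ler_powR => //; lra.
Qed.

Lemma V_is_derive l s p : 0 < s < T -> (l < 3)%N ->
  is_derive s 1 (fun s => V l s p) (V l.+1 s p).
Proof.
move=> sT l3; apply: dt_is_derive => //; apply: (reg_time_derivable reg) => //.
by case/andP: sT => s0 /ltW sT; rewrite s0.
Qed.

Let oo_oc s : 0 < s < T -> 0 < s <= T.
Proof. by case/andP => -> /ltW. Qed.

Lemma V_bound l s p : 0 < s < T -> (1 <= l <= 3)%N ->
  `|V l s p| <= time_const * s `^ (alpha - l%:R).
Proof.
move=> /oo_oc sT l3; apply: le_trans (time_weight_le sT l3).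
exact: (Winfty_bound L0 (V_periodic l sT) (reg_time reg sT l3)).
Qed.

Lemma phi_time_continuous p : {within `[0, T], continuous (phi^~ p)}.
Proof.
apply/subspace_continuousP => s /=; rewrite in_itv/= => sI.
have := (@subspace_continuousP _ _ _ _).1 (ac_continuous sol) (s, p) sI.
apply: cvg_trans => P /= H.
have : \forall z \near nbhs (s, p), 0 <= z.1 <= T -> P (phi z.1 z.2) by exact: H.
move=> [[A B] /= [As Bp] AB].
apply: (@filterS R (nbhs s) _ A) As => r Ar rI.
have rI' : 0 <= r <= T by move: rI; rewrite /= in_itv.
exact: (AB (r, p) (conj Ar (nbhs_singleton Bp)) rI').
Qed.

Lemma phi_time_regular p :
  time_regular alpha T time_const (phi^~ p) (fun s => V 1 s p) (fun s => V 2 s p) (fun s => V 3 s p).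
Proof.
split; first exact: phi_time_continuous.
- by move=> s sT; exact: (V_is_derive (l := 0)).
- by move=> s sT; exact: V_is_derive.
- by move=> s sT; exact: V_is_derive.
- by move=> s sT; exact: V_bound.
- by move=> s sT; exact: V_bound.
- by move=> s sT; exact: V_bound.
Qed.

Section Lap.
Variables (h : R) (i j : int).
Hypothesis h0 : 0 < h.
Let W l s := lap_h h (on_grid h (V l s)) i j.

Lemma W_is_derive l s : 0 < s < T -> (l < 3)%N -> is_derive s 1 (W l) (W l.+1 s).
Proof.
move=> sT l3; rewrite /W /lap_h /on_grid.
have D p := V_is_derive p sT l3.
have D1 := D ((i + 1)%:~R * h, j%:~R * h); have D2 := D ((i - 1)%:~R * h, j%:~R * h).
have D3 := D (i%:~R * h, (j + 1)%:~R * h); have D4 := D (i%:~R * h, (j - 1)%:~R * h).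
have D5 := D (i%:~R * h, j%:~R * h).
by apply: is_derive_eq; rewrite /GRing.scale/=; ring.
Qed.

Lemma W_bound l s : 0 < s < T -> (1 <= l <= 3)%N ->
  `|W l s| <= 2 * time_const * s `^ (alpha - l%:R).
Proof.
move=> /oo_oc sT l3; rewrite -mulrA.
apply: (@le_trans _ _ (2 * (Cphi * (1 + s `^ (alpha - l%:R))))).
  exact: (lap_h_le L0 (V_periodic l sT) (reg_time reg sT l3)).
by rewrite ler_pM2l// time_weight_le.
Qed.

(** The constant does not depend on h, because second differences of the time derivatives are
    controlled by their W^(2,oo) norms. This permits replacing the average in [phi_bar] by the value
    at t_(n-theta) under the discrete Laplacian. *)
Lemma lap_time_regular :
  time_regular alpha T (2 * time_const) (W 0) (W 1) (W 2) (W 3).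
Proof.
split.
- have c p := phi_time_continuous p; rewrite /W /lap_h /on_grid /V /=.
  have cD (u v : R -> R) : {within `[0, T], continuous u} -> {within `[0, T], continuous v} ->
      {within `[0, T], continuous (fun s => u s + v s)}.
    by move=> cu cv x; apply: continuousD; [exact: cu|exact: cv].
  apply: within_continuousM; first exact: within_continuous_cst.
  apply: within_continuousB.
    by apply: (cD); [apply: (cD); [apply: (cD)|]|]; exact: (c).
  by apply: within_continuousM; [exact: within_continuous_cst|exact: (c)].
- by move=> s sT; exact: W_is_derive.
- by move=> s sT; exact: W_is_derive.
- by move=> s sT; exact: W_is_derive.
- by move=> s sT; exact: W_bound.
- by move=> s sT; exact: W_bound.
- by move=> s sT; exact: W_bound.
Qed.

End Lap.
End Solution.

Section Consistency.
Context {R : realType}.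
Notation mu := (@lebesgue_measure R).

Lemma on_grid_Vh (L : R) (u : R * R -> R) (M : nat) : (0 < M)%N ->
  Defs.periodic L u -> Vh M (on_grid (L / M%:R) u).
Proof.
move=> M0 pu i j; rewrite /on_grid.
have E (k : int) : (k + M%:Z)%:~R * (L / M%:R) = k%:~R * (L / M%:R) + L.
  by rewrite intrD mulrDl; congr (_ + _); rewrite mulrC divfK// pnatr_eq0 -lt0n.
by rewrite !E; exact: pu.
Qed.

Variables (L T alpha eps Cphi : R) (f : R -> R).
Variables (phi_init : R * R -> R) (phi : R -> R * R -> R).
Hypotheses (L0 : 0 < L) (T0 : 0 < T) (al01 : 0 < alpha < 1).
Hypothesis sol : allen_cahn_solution L T alpha eps f phi_init phi.
Hypothesis reg : regularity L T alpha Cphi phi.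
Variables (t : nat -> R) (N : nat) (G a0 h S : R).
Hypotheses (mesh : regular_mesh t N G) (tN : t N = T) (a00 : 0 < a0 <= alpha).
Hypotheses (h0 : 0 < h) (S0 : 0 <= S).
Hypothesis step_S : forall n, (1 <= n <= N)%N -> step t n `^ alpha <= S * h ^+ 2.

Let th := alpha / 2.
Let C1 := time_const T Cphi.

Lemma time_const_ge0 : 0 <= C1.
Proof. by rewrite mulr_ge0 ?(Cphi_ge0 L0 T0 sol reg)// addr_ge0// exprn_ge0// addr_ge0// ltW. Qed.

Lemma holder_cell (C : R) v v1 v2 v3 n x y : time_regular alpha T C v v1 v2 v3 ->
  (1 <= n <= N)%N -> t n.-1 <= x <= t n -> t n.-1 <= y <= t n ->
  `|v y - v x| <= C / a0 * (S * h ^+ 2).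
Proof.
move=> vr nN; have C0 := time_regular_C_ge0 T0 vr.
wlog xy : x y / x <= y => [H xI yI|].
  by have [xy|/ltW yx] := lerP x y; [exact: H|rewrite distrC; exact: H].
move=> /andP[x1 _] /andP[_ y2]; have [n1 nleN] := andP nN; have [a0_gt a0al] := andP a00.
have x0 : 0 <= x.
  by apply: le_trans x1; apply: (node_ge0 mesh); exact: leq_trans (leq_pred n) nleN.
have yT : y <= T by rewrite (le_trans y2)// -tN; apply: (node_le mesh); rewrite nleN leqnn.
apply: le_trans (time_holder_le al01 T0 vr x0 xy yT) _.
apply: ler_pM; rewrite ?powR_ge0//; first by rewrite divr_ge0//; case/andP: al01 => /ltW.
  by apply: ler_wpM2l => //; rewrite lef_pV2 ?posrE//; case/andP: al01.
apply: le_trans (step_S nN); apply: ge0_ler_powR; rewrite ?nnegrE ?subr_ge0//.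
- by case/andP: al01 => /ltW.
- exact: le_trans x1 (le_trans xy y2).
- by rewrite /step lerB.
Qed.

(** Summands: increments in time, the Laplacian (replaced by differences, then averaged in time),
    and truncation. Each is taken at [a0], which is the worst case of the range. *)
Definition consistency_const : R :=
  C1 / a0 * S + eps ^+ 2 * (2 * Cphi + 2 * C1 / a0 * S) + truncation_const G a0 C1 * S.

Lemma consistency_parts :
  [/\ 0 <= C1 / a0 * S, 0 <= eps ^+ 2 * (2 * Cphi + 2 * C1 / a0 * S),
      0 <= truncation_const G a0 C1 &
      truncation_const G alpha C1 <= truncation_const G a0 C1].
Proof.
have [a0_gt a0al] := andP a00; have C10 := time_const_ge0.
have Cp0 := Cphi_ge0 L0 T0 sol reg.
have G0 : 0 <= G := le_trans ler01 (mesh_ge1 mesh).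
have c0 : 0 <= C1 / a0 by rewrite divr_ge0// ltW.
have e0 : 0 <= expR 2 :> R by exact: expR_ge0.
have D0 : 0 <= 16 * G ^+ 5 + 12 + (3 + G ^+ 4) * (2 * expR 2).
  apply: addr_ge0; first by apply: addr_ge0 => //; apply: mulr_ge0 => //; exact: exprn_ge0.
  apply: mulr_ge0; last exact: mulr_ge0.
  by apply: addr_ge0 => //; exact: exprn_ge0.
split.
- exact: mulr_ge0.
- apply: mulr_ge0; first exact: sqr_ge0.
  by apply: addr_ge0; [exact: mulr_ge0|rewrite -mulrA -mulrA mulr_ge0// mulrA mulr_ge0].
- exact: mulr_ge0.
- apply: ler_wpM2r => //; apply: ler_wpM2l => //.
  by rewrite lef_pV2 ?posrE//; case/andP: al01.
Qed.

Lemma theta_cell n : (1 <= n <= N)%N -> t n.-1 <= t_theta t th n <= t n.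
Proof.
move=> nN; have n1 : (n.-1 < n)%N by rewrite prednK//; case/andP: nN.
by rewrite (ltW (t_theta_gt mesh al01 nN n1)) (ltW (t_theta_lt mesh al01 nN)).
Qed.

Lemma solution_increments n i j : (1 <= n <= N)%N ->
  let P k := on_grid h (phi (t k)) i j in
  let q := on_grid h (phi (t_theta t th n)) i j in
  [/\ `|q - P n| <= consistency_const * h ^+ 2, `|q - P n.-1| <= consistency_const * h ^+ 2 &
      `|P n - P n.-1| <= consistency_const * h ^+ 2].
Proof.
move=> nN P q; have [c1 c2 c3 _] := consistency_parts.
have vr := phi_time_regular L0 T0 al01 sol reg (i%:~R * h, j%:~R * h).
have tt := theta_cell nN; have tn : t n.-1 <= t n by case/andP: tt => /le_trans; apply.
have H x y : t n.-1 <= x <= t n -> t n.-1 <= y <= t n ->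
    `|phi y (i%:~R * h, j%:~R * h) - phi x (i%:~R * h, j%:~R * h)| <= consistency_const * h ^+ 2.
  move=> xI yI; apply: le_trans (holder_cell vr nN xI yI) _; rewrite mulrA.
  apply: ler_wpM2r; first exact: sqr_ge0.
  by rewrite /consistency_const -addrA lerDl addr_ge0// mulr_ge0.
by split; apply: H; rewrite // ?lexx ?tn.
Qed.

Lemma solution_residual n i j : (1 <= n <= N)%N ->
  `|D_tau t alpha th (fun k => on_grid h (phi (t k)) i j) n
    - eps ^+ 2 * lap_h h (phi_bar th (fun k => on_grid h (phi (t k))) n) i j
    - f (on_grid h (phi (t_theta t th n)) i j)| <=
  consistency_const * h ^+ 2 +
  consistency_const * h ^+ 2 * (omega (1 - alpha) (t n) + t n `^ (- alpha) / n%:R).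
Proof.
move=> nN; have [c1 c2 c3 c4] := consistency_parts.
set s := t_theta t th n; set p := (i%:~R * h, j%:~R * h).
have vr := phi_time_regular L0 T0 al01 sol reg p.
have tt := theta_cell nN; have tn : t n.-1 <= t n by case/andP: tt => /le_trans; apply.
have [n1 nleN] := andP nN.
have sT : 0 < s <= T.
  apply/andP; split.
    rewrite -(mesh0 mesh); exact: (t_theta_gt mesh al01 nN).
  by case/andP: tt => _ /le_trans; apply; rewrite -tN; apply: (node_le mesh); rewrite nleN leqnn.
have v1E r : r \in `]0, s[ -> omega (1 - alpha) (s - r) * derive1 (phi^~ p) r =
    omega_s alpha s r * iter 1 (dt T) (phi^~ p) r.
  rewrite in_itv/= => /andP[r0 rs]; congr (_ * _).
  have rT : 0 < r < T by rewrite r0 (lt_le_trans rs)//; case/andP: sT.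
  by rewrite derive1E; case: (tr_d1 vr rT).
have fi : mu.-integrable `]0, s[ (EFin \o (fun r => omega_s alpha s r * iter 1 (dt T) (phi^~ p) r)).
  apply: eq_integrable (ac_caputo_integrable sol p sT) => //.
  by move=> r; rewrite inE => rI /=; rewrite v1E.
have tNT : t N <= T by rewrite tN.
have := D_tau_truncation mesh al01 nN tNT vr fi.
have -> : \int[mu]_(r in `]0, s[) (omega_s alpha s r * iter 1 (dt T) (phi^~ p) r) =
    eps ^+ 2 * laplacian (phi s) p + f (phi s p).
  rewrite -(ac_equation sol p sT) /caputo; apply: eq_Rintegral => r.
  by rewrite inE => rI; rewrite v1E.
rewrite -/th -/C1; set w := omega _ _ + _; set tc := truncation_const _ _ _.
set Dt := D_tau _ _ _ _ _; set LB := lap_h h (phi_bar _ _ _) i j => TR.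
pose W r := lap_h h (on_grid h (phi r)) i j.
have lapW : `|W s - laplacian (phi s) p| <= 2 * Cphi * h ^+ 2.
  have pphi : Defs.periodic L (phi s).
    by apply: (ac_periodic sol); case/andP: sT => /ltW -> ->.
  exact: (lap_h_consistency L0 pphi (reg_space reg sT) i j (leqnn 4) (ac_C2 sol sT) h0).
have wr := lap_time_regular L0 T0 al01 sol reg i j h0.
have WLB : `|W s - LB| <= 2 * C1 / a0 * (S * h ^+ 2).
  have -> : W s - LB = (1 - th) * (W s - W (t n)) + th * (W s - W (t n.-1)).
    by rewrite /LB /W /lap_h /phi_bar; ring.
  apply: norm_convex.
  - have [al0 al1] := andP al01.
    by rewrite divr_ge0 ?(ltW al0)//= ler_pdivrMr// mul1r (le_trans (ltW al1))// ler1n.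
  - by apply: (holder_cell wr nN) => //; rewrite tn lexx.
  - by apply: (holder_cell wr nN) => //; rewrite tn lexx.
have w0 : 0 <= w by exact: weight_ge0.
have e0 := sqr_ge0 eps; have H0 := sqr_ge0 h.
(* The differential equation is exact at t_(n-theta); what is left is the truncation error and two
   errors of the Laplacian. *)
rewrite (_ : Dt - _ - _ = (Dt - (eps ^+ 2 * laplacian (phi s) p + f (phi s p))) +
  eps ^+ 2 * (- (W s - laplacian (phi s) p) + (W s - LB))); last by rewrite /on_grid -/p; ring.
apply: le_trans (ler_normD _ _) _; rewrite addrC; apply: lerD.
  rewrite normrM (ger0_norm e0).
  apply: (@le_trans _ _ (eps ^+ 2 * (2 * Cphi * h ^+ 2 + 2 * C1 / a0 * (S * h ^+ 2)))).
    apply: ler_wpM2l => //; apply: le_trans (ler_normD _ _) _.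
    by rewrite normrN; exact: lerD.
  rewrite [leLHS](_ : _ = eps ^+ 2 * (2 * Cphi + 2 * C1 / a0 * S) * h ^+ 2); last by ring.
  by apply: ler_wpM2r => //; rewrite /consistency_const -/C1 addrAC lerDr addr_ge0// mulr_ge0.
apply: le_trans TR _; rewrite mulrA; apply: ler_wpM2r => //.
apply: (@le_trans _ _ (truncation_const G a0 C1 * (S * h ^+ 2))).
  exact: le_trans (ler_wpM2r (powR_ge0 _ _) c4) (ler_wpM2l c3 (step_S nN)).
rewrite mulrA; apply: ler_wpM2r => //.
by rewrite /consistency_const lerDr addr_ge0.
Qed.

End Consistency.

(** * Conclusion *)

Section Nonlinearity.
Context {R : realType}.
Variables (f : R -> R) (kappa : R).
Hypotheses (df : forall x : R, derivable f x 1) (cf : continuous (derive1 f)).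

Let f_is_derive (x : R) : is_derive x 1 f (derive1 f x).
Proof. by apply: DeriveDef; [exact: df|rewrite derive1E]. Qed.

Lemma f_MVT (x y : R) : x <= y -> exists2 z, x <= z <= y & f y - f x = derive1 f z * (y - x).
Proof.
move=> xy; have [z zI E] := MVT_segment xy (fun z _ => f_is_derive z)
  (is_derive_within_continuous (fun z _ => f_is_derive z)).
by exists z => //; move: zI; rewrite in_itv.
Qed.

Lemma derive1_bounded (b : R) : 0 <= b -> exists2 K, 0 <= K &
  forall x, `|x| <= b -> `|derive1 f x| <= K.
Proof.
move=> b0; have cn : {within `[- b, b], continuous (fun x => `|derive1 f x|)}.
  by apply: continuous_subspaceT => x; apply: cvg_norm; exact: cf.
have bb : - b <= b by lra.
have [c _ cmax] := EVT_max bb cn; exists `|derive1 f c| => // x xb.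
by apply: cmax; rewrite in_itv/= -ler_norml.
Qed.

Lemma f_lipschitz (b : R) : 0 <= b -> exists2 K, 0 <= K &
  forall x y, `|x| <= b -> `|y| <= b -> `|f x - f y| <= K * `|x - y|.
Proof.
move=> b0; have [K K0 HK] := derive1_bounded b0; exists K => // x y.
wlog yx : x y / y <= x => [H xb yb|].
  have [yx|/ltW xy] := leP y x; first exact: H.
  by rewrite distrC [`|x - y|]distrC; exact: H.
move=> xb yb; have [z zI ->] := f_MVT yx; rewrite normrM; apply: ler_wpM2r => //.
by apply: HK; move: xb yb zI; rewrite !ler_norml; lra.
Qed.

Hypothesis kappa_ge : sup [set `|derive1 f x| | x in `[-1, 1]] <= kappa.

Lemma derive1_le_kappa (x : R) : -1 <= x <= 1 -> `|derive1 f x| <= kappa.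
Proof.
move=> xI; apply: le_trans kappa_ge; apply: ub_le_sup.
  have [K _ HK] := derive1_bounded ler01; exists K => _ [y /= yI <-].
  by apply: HK; move: yI; rewrite in_itv/= ler_norml.
by exists x => //=; rewrite in_itv.
Qed.

Lemma stabilization_ge0 : 0 <= kappa.
Proof. by apply: le_trans (derive1_le_kappa (x := 0) _) => //; lra. Qed.

Lemma stabilized_nondecreasing (x y : R) : -1 <= x -> x <= y -> y <= 1 ->
  f x + kappa * x <= f y + kappa * y.
Proof.
move=> x1 xy y1; have [z zI E] := f_MVT xy.
have : `|derive1 f z| <= kappa by apply: derive1_le_kappa; lra.
rewrite ler_norml => /andP[dz _].
have : 0 <= (derive1 f z + kappa) * (y - x) by rewrite mulr_ge0// ?subr_ge0//; lra.
by rewrite mulrDl -E; lra.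
Qed.

End Nonlinearity.

Section StepRestriction.
Context {R : realType}.

Lemma powR_inv_le (al tau Z : R) : 0 < al -> 0 < Z -> 0 <= tau ->
  tau <= (4 / Z) `^ al^-1 -> tau `^ al * Z <= 4.
Proof.
move=> al0 Z0 tau0 H; rewrite -ler_pdivlMr//.
have Z4 : 0 <= 4 / Z by rewrite divr_ge0// ltW.
apply: (@le_trans _ _ (((4 / Z) `^ al^-1) `^ al)).
  by apply: ge0_ler_powR; rewrite ?nnegrE ?powR_ge0// ltW.
by rewrite -powRrM mulVf ?gt_eqF// powRr1.
Qed.

Lemma restriction_pos (al eps h kappa : R) : 0 < al < 1 -> 0 < eps -> 0 < h -> 0 <= kappa ->
  0 < 11 * (1 - al / 2) * (4 * eps ^+ 2 / h ^+ 2 + kappa) * Gamma (2 - al).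
Proof.
move=> al01 e0 h0 k0; apply: mulr_gt0; last exact: Gamma2B_gt0.
apply: mulr_gt0; first by move: al01; lra.
by apply: ltr_wpDr => //; rewrite divr_gt0 ?mulr_gt0 ?exprn_gt0.
Qed.

(** The diffusive term 4 eps^2 / h^2 alone forces x <= C h^2; the constant comes from Gamma (2 - al)
    >= e^(-2) / 2 and is independent of al. *)
Lemma step_le_grid (al eps h kappa x : R) : 0 < al < 1 -> 0 < eps -> 0 < h -> 0 <= kappa ->
  0 <= x -> x * (11 * (1 - al / 2) * (4 * eps ^+ 2 / h ^+ 2 + kappa) * Gamma (2 - al)) <= 4 ->
  x <= 4 * expR 2 / eps ^+ 2 * h ^+ 2.
Proof.
move=> al01 e0 h0 k0 x0 H.
have [G1 _] := andP (Gamma2B_bounds al01).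
have E0 : 0 < expR (- 2) :> R by exact: expR_gt0.
have EE : expR 2 * expR (- 2) = 1 :> R by rewrite -expRD subrr expR0.
have a0 : 0 < eps ^+ 2 / h ^+ 2 by rewrite divr_gt0 ?exprn_gt0.
have : x * (eps ^+ 2 / h ^+ 2) * expR (- 2) <= 4.
  apply: le_trans H; rewrite -mulrA; apply: ler_wpM2l => //.
  have : 1 * (expR (- 2) / 2) <= 11 * (1 - al / 2) * (expR (- 2) / 2).
    by rewrite ler_pM2r ?divr_gt0//; move: al01; lra.
  have : 2 * (eps ^+ 2 / h ^+ 2) * (expR (- 2) / 2) <=
    (11 * (1 - al / 2)) * (4 * eps ^+ 2 / h ^+ 2 + kappa) * Gamma (2 - al).
    apply: ler_pM => //; first by rewrite mulr_ge0 ?ltW.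
    rewrite -[4 * _ / _]mulrA; move: a0 al01; set q := eps ^+ 2 / _ => q0 al01.
    have : 0 <= (11 * (1 - al / 2) - 2) * q by rewrite mulr_ge0 ?(ltW q0)//; lra.
    have : 0 <= (11 * (1 - al / 2)) * (3 * q + kappa).
      by apply: mulr_ge0; [lra|apply: addr_ge0 => //; rewrite mulr_ge0// ltW].
    lra.
  by lra.
rewrite -ler_pdivlMr// -ler_pdivlMr//.
rewrite [X in _ <= X](_ : _ = 4 * expR 2 / eps ^+ 2 * h ^+ 2)//.
have : expR (- 2) != 0 :> R by rewrite gt_eqF.
move: EE; move: (expR (- 2)) => u + u0; move=> uE; rewrite (_ : expR 2 = u^-1); last first.
  by apply: (mulIf u0); rewrite uE mulVf.
by field; rewrite u0 !gt_eqF// exprn_gt0.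
Qed.

End StepRestriction.

Lemma grid_initial_bound (R : realType) (L : R) (u : R * R -> R) (M : nat) i j :
  0 < L -> (0 < M)%N -> Defs.periodic L u -> (forall x, cell L x -> `|u x| <= 1) ->
  `|on_grid (L / M%:R) u i j| <= 1.
Proof.
move=> L0 M0 pu u1; have [k [l ->]] := Vh_ord M0 i j (on_grid_Vh M0 pu).
have I (m : 'I_M) : 0 <= (m : nat)%:Z%:~R * (L / M%:R) <= L.
  have M0R : 0 < M%:R :> R by rewrite ltr0n.
  rewrite -pmulrn mulr_ge0 ?divr_ge0 ?(ltW L0)//= mulrCA ler_piMr ?(ltW L0)//.
  by rewrite ler_pdivrMr// mul1r ler_nat ltnW.
by apply: u1; split; rewrite /= in_itv/=; exact: I.
Qed.

Definition grid_error_le (R : realType) (L T eps gamma kappa Cphi : R) (f : R -> R)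
    (alpha C : R) : Prop :=
  forall (phi_init : R * R -> R) (phi : R -> R * R -> R)
         (M N : nat) (h : R) (t : nat -> R) (p : nat -> gridfun),
    (forall x, cell L x -> `|phi_init x| <= 1) ->
    allen_cahn_solution L T alpha eps f phi_init phi ->
    regularity L T alpha Cphi phi ->
    (0 < M)%N -> h = L / M%:R -> (0 < N)%N -> t = graded_mesh T gamma N ->
    max_step t N <=
      (4 / (11 * (1 - alpha / 2) * (4 * eps ^+ 2 / h ^+ 2 + kappa)
            * Gamma (2 - alpha))) `^ alpha^-1 ->
    imex_alikhanov t alpha (alpha / 2) M N h eps kappa f (on_grid h phi_init) p ->
    forall n, (n <= N)%N ->
      grid_norm M (fun i j => on_grid h (phi (t n)) i j - p n i j) <= C * h ^+ 2.

(* The first step restriction bounds tau^alpha by a multiple of h^2, so every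
   consistency error is O(h^2) and the mesh grading plays no further role. *)
Lemma error_bound (R : realType) (L T eps gamma kappa Cphi a0 : R) (F f : R -> R) :
  0 < L -> 0 < T -> 0 < eps -> 1 <= gamma -> bistable F f ->
  sup [set `|derive1 f x| | x in `[-1, 1]] <= kappa -> 0 < a0 < 1 ->
  exists2 C : R, 0 < C & forall alpha, a0 <= alpha < 1 ->
    grid_error_le L T eps gamma kappa Cphi f alpha C.
Proof.
move=> L0 T0 eps0 gamma1 Ff kappa_ge a01.
have df := bistable_derivable Ff; have cf := bistable_C1 Ff.
have f1 := bistable_right Ff; have fN1 := bistable_left Ff.
have k0 := stabilization_ge0 cf kappa_ge.
have f_nd := stabilized_nondecreasing df cf kappa_ge.
(* With a negative bound the regularity assumptions are contradictory, so any constant serves. *)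
have [Cphi0|Cphi0] := leP 0 Cphi; last first.
  exists 1 => // alpha /andP[a0al al1] phi_init phi M N h t p _ sol reg.
  by have := Cphi_ge0 L0 T0 sol reg; rewrite leNgt Cphi0.
(* This radius covers the exact solution, bounded by Cphi, and the truncated extrapolation, bounded
   by 1. *)
have Bd1 : 1 <= 1 + Cphi by rewrite lerDl.
have [Kf Kf0 f_lip] := f_lipschitz df cf (le_trans ler01 Bd1).
pose G := gamma + 2 `^ gamma.
have G1 : 1 <= G by rewrite (le_trans gamma1)// lerDl powR_ge0.
pose S : R := 4 * expR 2 / eps ^+ 2.
have S0 : 0 <= S by rewrite divr_ge0 ?sqr_ge0// mulr_ge0// expR_ge0.
pose Cy := consistency_const T eps Cphi G a0 S.
have K10 : 0 <= Kf + kappa by exact: addr_ge0.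
have G20 : 0 <= G ^+ 2 := exprn_ge0 2 (le_trans ler01 G1).
have G2p : 0 <= 1 + 2 * G ^+ 2 by rewrite addr_ge0// mulr_ge0.
(* The first barrier controls the range of the exact solution, the second the error; the latter
   needs the factor 1 + 2 G^2 by which the extrapolation may amplify earlier errors. *)
have [Ca Ca0 HCa] := exists_barrier a01 T0 G1 K10.
have [Cb Cb0 HCb] := exists_barrier a01 T0 G1 (mulr_ge0 K10 G2p).
pose cx := (1 + kappa) * Cy + (Kf + kappa) * (Ca * ((Kf + 2 * kappa + 1) * Cy) + (3 + G ^+ 2) * Cy).
(* The constant must be positive before a solution is given, while [0 <= cx] is derived only from
   the properties of one; hence the absolute value. *)
exists (1 + `|Cb * cx|); first by rewrite ltr_wpDr.
move=> al aal phi_init phi M N h t p init1 sol reg M0 hE N0 tE cfl0 [Vp p0 scheme].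
have [a0al al1] := andP aal; have [a0_gt _] := andP a01.
have al01 : 0 < al < 1 by rewrite al1 (lt_le_trans a0_gt).
have h0 : 0 < h by rewrite hE divr_gt0// ltr0n.
have mesh : regular_mesh t N G by rewrite tE; exact: graded_mesh_regular.
have tN : t N = T by rewrite tE graded_mesh_last.
have Z0 := restriction_pos al01 eps0 h0 k0.
have cfl n : (1 <= n <= N)%N -> step t n `^ al *
    (11 * (1 - al / 2) * (4 * eps ^+ 2 / h ^+ 2 + kappa) * Gamma (2 - al)) <= 4.
  move=> nN; apply: powR_inv_le => //; first by case/andP: al01.
    exact: ltW (mesh_step_gt0 mesh nN).
  exact: le_trans (step_le_max_step t nN) cfl0.
have step_S n : (1 <= n <= N)%N -> step t n `^ al <= S * h ^+ 2.
  move=> nN; exact: (step_le_grid al01 eps0 h0 k0 (powR_ge0 _ _) (cfl n nN)).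
have a0_al : 0 < a0 <= al by rewrite a0_gt.
have tI n : (n <= N)%N -> 0 <= t n <= T.
  by move=> nN; rewrite (node_ge0 mesh)// -tN (node_le mesh)// nN leqnn.
pose P k := on_grid h (phi (t k)).
pose Q n := on_grid h (phi (t_theta t (al / 2) n)).
have VP n : (n <= N)%N -> Vh M (P n).
  by move=> nN; rewrite /P hE; apply: on_grid_Vh => //; exact: (ac_periodic sol (tI n nN)).
have phi0 : phi 0 = phi_init by apply/funext => x; exact: (ac_init sol).
have P0E : P 0%N = on_grid h phi_init by rewrite /P (mesh0 mesh) phi0.
have P0 i j : `|P 0%N i j| <= 1.
  rewrite P0E hE; apply: grid_initial_bound => //.
  by rewrite -phi0; apply: (ac_periodic sol); rewrite lexx ltW.
pose Y := Cy * h ^+ 2.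
have H0 := sqr_ge0 h.
have [c1 c2 c3 c4] := consistency_parts L0 T0 al01 sol reg mesh a0_al S0.
have Cy0 : 0 <= Cy by rewrite !addr_ge0// mulr_ge0.
have Y0 : 0 <= Y by exact: mulr_ge0.
have QP n i j : (1 <= n <= N)%N -> [/\ `|Q n i j - P n i j| <= Y,
    `|Q n i j - P n.-1 i j| <= Y & `|P n i j - P n.-1 i j| <= Y].
  exact: (solution_increments L0 T0 al01 sol reg mesh tN a0_al S0 step_S).
have QB n i j : (1 <= n <= N)%N -> `|Q n i j| <= 1 + Cphi.
  move=> nN; apply: (@le_trans _ _ Cphi); last by rewrite lerDr.
  apply: (phi_bound L0 sol reg); apply/andP; split.
    by rewrite -(mesh0 mesh); apply: (t_theta_gt mesh al01 nN); case/andP: nN.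
  have [_ nleN] := andP nN; have /andP[_ tnT] := tI n nleN.
  exact: le_trans (ltW (t_theta_lt mesh al01 nN)) tnT.
have res n i j (nN : (1 <= n <= N)%N) :=
  solution_residual L0 T0 al01 sol reg mesh tN a0_al h0 S0 step_S i j nN.
have mT : t N <= T by rewrite tN.
have c10 : 0 <= Kf + 2 * kappa + 1 by rewrite !addr_ge0// mulr_ge0.
have X10 : 0 <= (Kf + 2 * kappa + 1) * Y by exact: mulr_ge0.
have [B1 [B10 B1nd B1C B1D]] := HCa al t N _ aal mesh mT X10.
have range n i j : (n <= N)%N -> `|P n i j| <= 1 + B1 n.
  exact: (exact_range mesh al01 M0 k0 f1 fN1 Kf0 Bd1 f_nd f_lip Y0 cfl VP P0 QP QB res B10 (lexx _) B1D).
have cx0 : 0 <= cx.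
  apply: addr_ge0; first by rewrite mulr_ge0// addr_ge0.
  apply: mulr_ge0 => //; apply: addr_ge0; last by rewrite mulr_ge0// addr_ge0.
  by apply: mulr_ge0; [exact: ltW|exact: mulr_ge0].
have X0 : 0 <= cx * h ^+ 2 by exact: mulr_ge0.
have [B [B0 Bnd BC BD]] := HCb al t N _ aal mesh mT X0.
have XY : (1 + kappa) * Y + (Kf + kappa) * (Ca * ((Kf + 2 * kappa + 1) * Y) + (3 + G ^+ 2) * Y) <= cx * h ^+ 2.
  by rewrite le_eqVlt; apply/orP; left; apply/eqP; rewrite /cx /Y; ring.
have p0P i j : p 0%N i j = P 0%N i j by rewrite p0 P0E.
move=> n nN; apply: grid_norm_le; first by rewrite mulr_ge0// addr_ge0.
move=> i j.
apply: (@le_trans _ _ (B n)).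
  exact: (scheme_error mesh al01 M0 k0 Kf0 Bd1 f_lip Y0 cfl VP P0 QP QB res range B10 B1C B0 Bnd XY BD Vp p0P scheme).
apply: le_trans (BC n nN) _; rewrite mulrA; apply: ler_wpM2r => //.
by rewrite (le_trans (ler_norm _))// lerDr.
Qed.

Theorem theorem4p4 (R : realType) (L T eps gamma kappa Cphi : R)
    (F f : R -> R)
    (L_gt0 : 0 < L) (T_gt0 : 0 < T) (eps_gt0 : 0 < eps) (gamma_ge1 : 1 <= gamma)
    (Ff : bistable F f)
    (kappa_ge : sup [set `|derive1 f x| | x in `[-1, 1]] <= kappa) :
  exists C3 : R -> R,
    [/\ forall alpha, 0 < alpha < 1 -> 0 < C3 alpha,
        alpha_robust C3 &
        forall (alpha theta : R) (phi_init : R * R -> R) (phi : R -> R * R -> R)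
               (M N : nat) (h : R) (t : nat -> R) (p : nat -> gridfun),
          0 < alpha < 1 -> theta = alpha / 2 ->
          (forall x, cell L x -> `|phi_init x| <= 1) ->
          allen_cahn_solution L T alpha eps f phi_init phi ->
          regularity L T alpha Cphi phi ->
          (0 < M)%N -> h = L / M%:R ->
          (0 < N)%N -> t = graded_mesh T gamma N ->
          max_step t N <=
            (4 / (11 * (1 - theta) * (4 * eps ^+ 2 / h ^+ 2 + kappa)
                  * Gamma (2 - alpha))) `^ alpha^-1 ->
          max_step t N <=
            (2 / (33 * kappa * Gamma (2 - alpha)
                  * (1 + 2 * (1 - theta) * max_ratio t N))) `^ alpha^-1 ->
          imex_alikhanov t alpha theta M N h eps kappa f
            (on_grid h phi_init) p ->
          forall n, (n <= N)%N ->
            grid_norm M (fun i j => on_grid h (phi (t n)) i j - p n i j)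
              <= C3 alpha
                 * (N%:R `^ (- Num.min (gamma * alpha) 2) + h ^+ 2)].
Proof.
have half01 : 0 < (2^-1 : R) < 1 by rewrite invr_gt0 ltr0n invf_lt1// ltr1n.
(* The condition on [a0] sits under the existential so that choice yields a function defined on all
   reals. *)
have key a0 : exists C, 0 < a0 < 1 -> 0 < C /\
    forall alpha, a0 <= alpha < 1 -> grid_error_le L T eps gamma kappa Cphi f alpha C.
  have [a01|a01] := pselect (0 < a0 < 1); last by exists 1 => /a01.
  by have [C C0 HC] := error_bound Cphi L_gt0 T_gt0 eps_gt0 gamma_ge1 Ff kappa_ge a01; exists C.
have [C HC] := choice key.
(* Constant in alpha on [1/2, 1), hence alpha-robust. *)
pose base (al : R) : R := if 2^-1 <= al then 2^-1 else al.
have base01 al : 0 < al < 1 -> 0 < base al < 1.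
  by rewrite /base; case: ifP.
have base_le al : base al <= al by rewrite /base; case: ifP.
exists (C \o base); split.
- by move=> al al01; exact: (HC _ (base01 al al01)).1.
- exists `|C 2^-1|; near=> al => /=; rewrite /base ifT//.
  by near: al; apply: nbhs_left_ge; case/andP: half01.
move=> alpha theta phi_init phi M N h t p al01 -> init1 sol reg M0 hE N0 tE cfl _ scheme n nN.
have [C0 HCb] := HC _ (base01 alpha al01).
have bal : base alpha <= alpha < 1 by rewrite base_le; case/andP: al01.
apply: le_trans (HCb _ bal _ _ _ _ _ _ _ init1 sol reg M0 hE N0 tE cfl scheme n nN) _.
by rewrite ler_pM2l// lerDr powR_ge0.
Unshelve. all: by end_near.
Qed.
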